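(* Let $(G_k)$ be a sequence of random graphs on $n_k\to\infty$ vertices which is either (A) a sequence of two-communities random graphs satisfying assumptions (A1)-(A4) of the context, with $\alpha=\alpha_k$ given by $\alpha=\alpha_1+\alpha_2$, or (B) a sequence of $m$-communities random graphs satisfying assumptions (B1)-(B4) of the context, with $\alpha=\alpha_k$ the Cheeger constant of the matrix $Q$. Let $t_{\mathrm{rel}}$ and $t_{\mathrm{rel}}^*$ be the relaxation time and the absolute relaxation time of the simple random walk on $G_k$. Then there exists a constant $C>0$ such that with high probability (as $k\to\infty$) $$\frac1{C\alpha}\le t_{\mathrm{rel}}\le t_{\mathrm{rel}}^*\le\frac C\alpha.$$
   Context: For an irreducible reversible chain on a finite state space with transition matrix $P$: $\gamma_*=1-\max\{|\lambda|:\lambda\text{ eigenvalue of }P,\lambda\ne1\}$, $t_{\mathrm{rel}}^*=1/\gamma_*$; $\gamma=1-\max\{\lambda:\lambda\text{ eigenvalue of }P,\lambda\ne1\}$, $t_{\mathrm{rel}}=1/\gamma$. The simple random walk on a multigraph moves at each step along a uniformly chosen half-edge at its current vertex. ''With high probability'' means with probability $1-o(1)$. $f\asymp g$ means $f\le cg$ and $g\le cf$ for a constant $c$. The constant $C$ is allowed to depend on the maximal degree $\Delta$ and on $\min_{i,j}n_i/n_j$ (and on the fixed number $m$). (A) Two-communities random graph. $V=V_1\sqcup V_2$, $n_i=|V_i|$, $n=n_1+n_2$; $d:V\to\mathbb N\setminus\{0,1\}$ with $N_i=\sum_{v\in V_i}d(v)$ even, $N=N_1+N_2$; $p$ an even integer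 with $2\le p\le\min\{N_1,N_2\}$. Each $v$ receives $d(v)$ half-edges. In each community $p$ half-edges chosen uniformly at random are labelled outgoing, the others internal. Outgoing half-edges of community 1 are matched with those of community 2 uniformly at random, and the internal half-edges of each community are matched by a uniform random perfect matching; matched half-edges form edges (loops, multiple edges allowed). $\alpha_i=p/N_i$. Assumptions (constants uniform in $k$): (A1) $\alpha_1+\alpha_2\le1$; (A2) $N_1\asymp N_2\asymp N$; (A3) $\min_vd(v)\ge3$; (A4) $\Delta=\max_vd(v)=O(1)$. (B) $m$-communities random graph, $m\ge2$ fixed. $V=\bigsqcup_{i=1}^mV_i$, $|V_i|=n_i$, $n=\sum n_i$; $E$ a symmetric $m\times m$ matrix with non-negative integer entries and even diagonal; $\deg^{\mathrm{int}},\deg^{\mathrm{out}}:V\to\mathbb N_0$ with $\sum_{j\ne i}E_{i,j}=\sum_{v\in V_i}\deg^{\mathrm{out}}(v)$ and $E_{i,i}=\sum_{v\in V_i}\deg^{\mathrm{int}}(v)$. Each $v$ receives $\deg^{\mathrm{int}}(v)$ internal and $\deg^{\mathrm{out}}(v)$ outgoing half-edges, $d=\deg^{\mathrm{int}}+\deg^{\mathrm{out}}$. Internal half-edges of each community are matched to each other uniformly at random. For each $i$ the outgoing half-edges of community $i$ are partitioned uniformly at random into sets of $E_{i,j}$ ''$j$-half-edges'', $j\ne i$, and for $i\ne j$ the $j$-half-edges of community $i$ are matched uniformly at random to the $i$-half-edges of community $j$. $Q(i,j)=E_{i,j}/\sum_\ell E_{i,\ell}$. Assumptions (constants uniform in $k$):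 (B1) $Q$ irreducible; (B2) $n_i\asymp n$ for all $i$; (B3) $\deg^{\mathrm{int}}(v)\ge3$ for all $v$; (B4) $\Delta=\max_vd(v)=O(1)$. The Cheeger constant of a transition matrix $P$ with invariant distribution $\pi$ is $\Phi_*=\min_{A:\,0<\pi(A)\le1/2}\frac{\sum_{x\in A,y\in A^c}\pi(x)P(x,y)}{\pi(A)}$. *)

(* Defs.v *)
From HB Require Import structures.
From mathcomp Require Import all_boot all_order all_algebra all_fingroup.
From mathcomp Require Import all_classical all_reals all_analysis.
Import Order.TTheory GRing.Theory Num.Theory.

Set Implicit Arguments.
Unset Strict Implicit.
Unset Printing Implicit Defensive.

Local Open Scope ring_scope.

Definition irreducible (R : realType) (n : nat) (P : 'M[R]_n) : Prop :=
  forall x y : 'I_n, exists t : nat, 0 < (P ^+ t) x y.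

(* The transition matrix of a reversible chain has only real eigenvalues, so
   eigenvalues are taken in R.  [sup] is over a finite set, hence a maximum. *)
Definition spectral_gap (R : realType) (n : nat) (P : 'M[R]_n) : R :=
  1 - sup [set lam : R | eigenvalue P lam /\ lam <> 1]%classic.

Definition abs_spectral_gap (R : realType) (n : nat) (P : 'M[R]_n) : R :=
  1 - sup [set `|lam| | lam in
             [set lam : R | eigenvalue P lam /\ lam <> 1]]%classic.

Definition t_rel (R : realType) (n : nat) (P : 'M[R]_n) : R :=
  (spectral_gap P)^-1.

(* When the absolute gap is 0 (periodic chain) this is 0 instead of +oo; since
   t_rel P > 0 for an irreducible reversible chain P on at least 2 states,
   t_rel P <= abs_t_rel P <= c then fails, as it does with the value +oo. *)
Definition abs_t_rel (R : realType) (n : nat) (P : 'M[R]_n) : R :=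
  (abs_spectral_gap P)^-1.

Definition invariant_distribution (R : realType) (n : nat) (P : 'M[R]_n)
    (pi : 'rV[R]_n) : Prop :=
  [/\ forall x, 0 <= pi 0 x, \sum_x pi 0 x = 1 & pi *m P = pi].

(* An invariant distribution of P; it is unique when P is irreducible. *)
Definition invariant (R : realType) (n : nat) (P : 'M[R]_n) : 'rV[R]_n :=
  xget 0 (invariant_distribution P).

Definition cheeger (R : realType) (n : nat) (P : 'M[R]_n) : R :=
  let pi := invariant P in
  let mass (A : {set 'I_n}) : R := \sum_(x in A) pi 0 x in
  inf [set (\sum_(x in A) \sum_(y in ~: A) pi 0 x * P x y) / mass A | A in
         [set A : {set 'I_n} | 0 < mass A <= 2^-1]]%classic.

(* [H] is the set of half-edges, [src h] the vertex carrying [h], and [s] maps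
   every half-edge to its partner.  A loop contributes two half-edges. *)
Definition perfect_matching (H : finType) (s : {perm H}) : bool :=
  [forall h, (s h != h) && (s (s h) == h)].

Definition srw (R : realType) (n : nat) (H : finType) (src : H -> 'I_n)
    (s : {perm H}) : 'M[R]_n :=
  \matrix_(x, y) (#|[set h | (src h == x) && (src (s h) == y)]|%:R
                  / #|[set h | src h == x]|%:R).

Definition unif_mean (R : realType) (T : finType) (A : {set T}) (f : T -> R) : R :=
  (\sum_(x in A) f x) / #|A|%:R.

Definition unif_prob (R : realType) (T : finType) (A : {set T}) (ev : T -> Prop) : R :=
  unif_mean A (fun x => (`[< ev x >] : nat)%:R).

Definition community (n m : nat) (comm : 'I_n -> 'I_m) (i : 'I_m) : {set 'I_n} :=
  [set v | comm v == i].

(* inf over k of the min over i, j of n_i / n_j. *)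
Definition community_ratio (R : realType) (m : nat) (n : nat -> nat)
    (comm : forall k, 'I_(n k) -> 'I_m) : R :=
  inf [set r : R | exists k i j,
         r = #|community (@comm k) i|%:R / #|community (@comm k) j|%:R]%classic.

Definition asymp (R : realType) (f g : nat -> R) : Prop :=
  exists c : R, 0 < c /\ forall k, f k <= c * g k /\ g k <= c * f k.

Record two_communities := TwoCommunities {
  tc_n : nat;
  tc_comm : 'I_tc_n -> 'I_2;
  tc_deg : 'I_tc_n -> nat;
  tc_p : nat;
  tc_deg_ge2 : forall v, (2 <= tc_deg v)%N;
  tc_even : forall i, ~~ odd (\sum_(v in community tc_comm i) tc_deg v)%N;
  tc_p_even : ~~ odd tc_p;
  tc_p_ge2 : (2 <= tc_p)%N;
  tc_p_le : forall i, (tc_p <= \sum_(v in community tc_comm i) tc_deg v)%N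
}.

Definition tc_N (G : two_communities) (i : 'I_2) : nat :=
  (\sum_(v in community (@tc_comm G) i) tc_deg v)%N.

Definition tc_half_edge (G : two_communities) : finType :=
  {v : 'I_(tc_n G) & 'I_(tc_deg v)}.

Definition tc_src (G : two_communities) (h : tc_half_edge G) : 'I_(tc_n G) :=
  tag h.

Definition tc_side (G : two_communities) (h : tc_half_edge G) : 'I_2 :=
  tc_comm (tc_src h).

(* The possible sets of outgoing half-edges.  This is a product over the two
   communities, so a uniform element makes independent uniform choices. *)
Definition tc_outgoing (G : two_communities) : {set {set tc_half_edge G}} :=
  [set O : {set tc_half_edge G} |
    [forall i, #|[set h in O | tc_side h == i]| == tc_p G]].

(* The matchings allowed once the outgoing half-edges are chosen.  Such a
   matching amounts to a matching of the outgoing half-edges of one community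
   with those of the other and one perfect matching of the internal half-edges
   of each community, so uniformity here is independent uniformity of these. *)
Definition tc_matchings (G : two_communities) (O : {set tc_half_edge G}) :
    {set {perm tc_half_edge G}} :=
  [set s | perfect_matching s &&
    [forall h, ((s h \in O) == (h \in O)) &&
               ((tc_side (s h) != tc_side h) == (h \in O))]].

Definition tc_prob (R : realType) (G : two_communities)
    (ev : 'M[R]_(tc_n G) -> Prop) : R :=
  unif_mean (tc_outgoing G) (fun O =>
    unif_prob R (tc_matchings O) (fun s => ev (srw R (@tc_src G) s))).

Definition tc_alpha (R : realType) (G : two_communities) : R :=
  \sum_(i < 2) (tc_p G)%:R / (tc_N G i)%:R.

Definition tc_assumptions (R : realType) (D : nat) (G : nat -> two_communities) : Prop :=
  [/\ forall k, tc_alpha R (G k) <= 1,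
      asymp (fun k => (tc_N (G k) 0)%:R : R) (fun k => (tc_N (G k) 1)%:R) /\
      asymp (fun k => (tc_N (G k) 1)%:R : R)
            (fun k => (tc_N (G k) 0 + tc_N (G k) 1)%:R),
      forall k (v : 'I_(tc_n (G k))), (3 <= tc_deg v)%N &
      forall k (v : 'I_(tc_n (G k))), (tc_deg v <= D)%N].

Record m_communities (m : nat) := MCommunities {
  mc_n : nat;
  mc_comm : 'I_mc_n -> 'I_m;
  mc_E : 'M[nat]_m;
  mc_int : 'I_mc_n -> nat;
  mc_out : 'I_mc_n -> nat;
  mc_E_sym : mc_E^T = mc_E;
  mc_E_even : forall i, ~~ odd (mc_E i i);
  mc_E_out : forall i,
    (\sum_(j | j != i) mc_E i j = \sum_(v in community mc_comm i) mc_out v)%N;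
  mc_E_int : forall i,
    (mc_E i i = \sum_(v in community mc_comm i) mc_int v)%N
}.

(* [inl] marks the internal half-edges and [inr] the outgoing ones. *)
Definition mc_half_edge (m : nat) (G : m_communities m) : finType :=
  {v : 'I_(mc_n G) & ('I_(mc_int v) + 'I_(mc_out v))%type}.

Definition mc_src (m : nat) (G : m_communities m) (h : mc_half_edge G) : 'I_(mc_n G) :=
  tag h.

Definition mc_side (m : nat) (G : m_communities m) (h : mc_half_edge G) : 'I_m :=
  mc_comm (mc_src h).

Definition mc_internal (m : nat) (G : m_communities m) (h : mc_half_edge G) : bool :=
  if tagged h is inl _ then true else false.

(* A labelling sends a half-edge of community i to the community of its future
   partner: i itself for an internal half-edge, and j for a "j-half-edge".  The
   admissible labellings form a product over the communities, so a uniform one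
   partitions the outgoing half-edges of the communities independently. *)
Definition mc_labellings (m : nat) (G : m_communities m) :
    {set {ffun mc_half_edge G -> 'I_m}} :=
  [set l : {ffun mc_half_edge G -> 'I_m} |
    [forall h, (l h == mc_side h) == mc_internal h] &&
    [forall i, forall j, (j != i) ==>
      (#|[set h | (mc_side h == i) && (l h == j)]| == mc_E G i j)]].

(* As for two communities, a uniform element amounts to independent uniform
   matchings inside each community and between each pair of communities. *)
Definition mc_matchings (m : nat) (G : m_communities m)
    (l : {ffun mc_half_edge G -> 'I_m}) : {set {perm mc_half_edge G}} :=
  [set s | perfect_matching s &&
    [forall h, (mc_side (s h) == l h) && (l (s h) == mc_side h)]].

Definition mc_prob (R : realType) (m : nat) (G : m_communities m)
    (ev : 'M[R]_(mc_n G) -> Prop) : R :=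
  unif_mean (mc_labellings G) (fun l =>
    unif_prob R (mc_matchings l) (fun s => ev (srw R (@mc_src m G) s))).

Definition mc_Q (R : realType) (m : nat) (G : m_communities m) : 'M[R]_m :=
  \matrix_(i, j) ((mc_E G i j)%:R / (\sum_l mc_E G i l)%:R).

Definition mc_assumptions (R : realType) (m D : nat) (G : nat -> m_communities m) : Prop :=
  [/\ forall k, irreducible (mc_Q R (G k)),
      forall i, asymp (fun k => #|community (@mc_comm m (G k)) i|%:R : R)
                      (fun k => (mc_n (G k))%:R),
      forall k (v : 'I_(mc_n (G k))), (3 <= mc_int v)%N &
      forall k (v : 'I_(mc_n (G k))), (mc_int v + mc_out v <= D)%N].

(* Relaxation times are defined for irreducible chains only, so irreducibility
   (connectedness of the graph) is part of the event. *)
Definition relaxation_bounds (R : realType) (C alpha : R) (n : nat) (P : 'M[R]_n) : Prop :=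
  [/\ irreducible P,
      (C * alpha)^-1 <= t_rel P,
      t_rel P <= abs_t_rel P &
      abs_t_rel P <= C / alpha].

(* Main.v *)
Require Import Defs.
From mathcomp Require Import all_boot all_order all_algebra all_fingroup.
From mathcomp Require Import all_classical all_reals all_analysis.
From mathcomp Require Import zify ring lra.
Import Order.TTheory GRing.Theory Num.Theory.
Import numFieldNormedType.Exports.

Set Implicit Arguments.
Unset Strict Implicit.
Unset Printing Implicit Defensive.

Local Open Scope ring_scope.

(** In the walk on a multigraph with half-edges h, vertices src h and matching s, the
    relaxation times are governed by two inequalities.  The first is a Poincare
    inequality: for some constant a, the sum of the (g v - a) ^ 2 is at most C / alpha
    times the energy of g, the sum over h of (g (src h) - g (src (s h))) ^ 2
    ([two_blocks_poincare], [mc_poincare]).  It separates the eigenvalues from 1.  The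
    second bounds the sum of the f v ^ 2 by C times the sum of the squares of
    f (src h) + f (src (s h)), and separates the eigenvalues from - 1
    ([sum_square_le_signless_energy]).  The bound in the other direction comes from a test
    function that is constant on the two sides of a cut ([eigenvalue_ge_cut]): the cut
    between the two communities, whose conductance is alpha up to constants, or the cut
    given by the set of communities that realizes the Cheeger constant of Q.  The
    translation to relaxation times is [srw_relaxation].

    Both inequalities are deterministic consequences of edge expansion, in two forms: small
    sets of vertices expand, and so do colourings in which, in some community, no colour is
    dominant.  Given a function on the vertices, level sets between two quantiles of a
    community are handled by the second form and the tails beyond the quantiles by the
    first, through the argument of Cheeger.  This reduces a Poincare inequality to comparing
    the quantiles of distinct communities along the edges joining them, and this
    comparison is where 1 / alpha appears.

    The expansion holds with high probability because the law of the matching is invariant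
    under permutations of half-edges inside a community ([random_pairing]).  A colouring of
    the half-edges is therefore as likely to be respected by the matching as any other one
    with the same histogram.  For a fixed matching, the respected colourings of a
    histogram class of size X number at most sqrt X up to small factors, because half of
    each pair determines the colouring and halves of two colourings can be mixed
    ([compatible_class_square]).  A colouring of the vertices whose histogram class has size
    w induces a class of size at least w ^ 3 on the half-edges, since every vertex carries
    three of them ([cube_hclass_on_half_edges]).  So it is respected with probability at most
    w ^ (- 3 / 2), up to small factors, and the same holds with a few exceptional edges
    ([Pr_mismatches]); this survives the union bound over the w colourings of the class
    ([large_expansion_whp], [small_expansion_whp]). *)

(** * Colourings with a given histogram *)

Lemma le_of_eq (d : Order.disp_t) (T : porderType d) (x y : T) : x = y -> (x <= y)%O.
Proof. by move=> ->. Qed.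

Lemma card_preim_le (H V : finType) (src : H -> V) (D : nat) (A : {set V}) :
  (forall v, (#|[set h | src h == v]| <= D)%N) -> (#|[set h | src h \in A]| <= D * #|A|)%N.
Proof.
move=> deg; rewrite -sum1_card (partition_big src (mem A)) /=; last by move=> h; rewrite inE.
rewrite mulnC -sum_nat_const; apply: leq_sum => v vA; apply: leq_trans (deg v).
rewrite sum1_card; apply/subset_leq_card/fintype.subsetP => h.
by rewrite unfold_in /= !inE => /andP[].
Qed.

(** Listed along an enumeration of X, the values of f and of g are permutations of
    each other, and s is the permutation of the positions. *)
Lemma perm_of_fibers (X Y : finType) (f g : X -> Y) :
  (forall y, #|[set x | f x == y]| = #|[set x | g x == y]|) ->
  exists s : {perm X}, forall x, g x = f (s x).
Proof.
move=> fibers.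
have card_count (h : X -> Y) y :
    count_mem y [seq h x | x <- enum X] = #|[set x | h x == y]|.
  rewrite count_map -size_filter cardE /enum_mem; congr (size _);
  by rewrite -enumT -!filter_predI; apply: eq_filter => x; rewrite !inE andbT.
have sizeE (h : X -> Y) : size [seq h x | x <- enum X] == #|X|.
  by rewrite size_map -cardE.
have : perm_eq [seq g x | x <- enum X] (Tuple (sizeE f)).
  by apply/allP => y _ /=; rewrite !card_count fibers.
case/tuple_permP => p gE.
have gfE x : g x = f (enum_val (p (enum_rank x))).
  have -> : g x = nth (g x) [seq g x | x <- enum X] (enum_rank x).
    by rewrite (nth_map x) -?cardE ?ltn_ord // nth_enum_rank.
  rewrite gE -[RHS]/(f _).
  set i := enum_rank x; rewrite (nth_map i) ?size_enum_ord ?ltn_ord //.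
  rewrite nth_ord_enum (tnth_nth (g x)) /= (nth_map x) -?cardE ?ltn_ord //.
  by congr f; rewrite [RHS](enum_val_nth x).
have inj : injective (fun x => enum_val (p (enum_rank x)) : X).
  by move=> x y /enum_val_inj /perm_inj /enum_rank_inj.
by exists (perm inj) => x; rewrite permE.
Qed.

Lemma sum_square_le (X : finType) (A : {set X}) (y : X -> nat) :
  ((\sum_(i in A) y i) ^ 2 <= #|A| * \sum_(i in A) y i ^ 2)%N.
Proof.
rewrite -[leqLHS]mulnn big_distrlr /= -(leq_pmul2l (isT : 0 < 2)%N).
rewrite big_distrr /=.
apply: (@leq_trans (\sum_(i in A) \sum_(j in A) (y i ^ 2 + y j ^ 2))%N).
  apply: leq_sum => i _; rewrite big_distrr /=.
  by apply: leq_sum => j _; apply: nat_Cauchy.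
rewrite (eq_bigr (fun i => #|A| * y i ^ 2 + \sum_(j in A) y j ^ 2)%N); last first.
  by move=> i _; rewrite big_split /= sum_nat_const.
by rewrite big_split /= -big_distrr /= sum_nat_const mul2n addnn.
Qed.

Section Colourings.

Variables (X K T : finType) (key : X -> K).
Implicit Types a b : {ffun X -> T}.

Definition hist a : {ffun K * T -> nat} :=
  [ffun kt => #|[set x | (key x, a x) == kt]|].

(** The orbit of a under the permutations that preserve the keys: see
    [permuted_hclass] and [hclass_permuted]. *)
Definition hclass a : {set {ffun X -> T}} := [set b | hist b == hist a].

Lemma mem_hclass a : a \in hclass a.
Proof. by rewrite inE. Qed.

Lemma hclassP a b :
  reflect (forall k t, #|[set x | (key x == k) && (b x == t)]|
                     = #|[set x | (key x == k) && (a x == t)]|)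
          (b \in hclass a).
Proof.
rewrite inE; apply: (iffP eqP) => [/ffunP E k t|E].
  by have := E (k, t); rewrite !ffunE.
by apply/ffunP => -[k t]; rewrite !ffunE; exact: E.
Qed.

Definition permuted (g : {perm X}) a : {ffun X -> T} := [ffun x => a (g x)].

Definition preserves_key (g : {perm X}) := forall x, key (g x) = key x.

Lemma permuted_hclass g a : preserves_key g -> permuted g a \in hclass a.
Proof.
move=> gk; apply/hclassP => k t.
rewrite -(card_imset _ (@perm_inj _ g)); congr #|pred_of_set _|.
apply/setP => x; rewrite -{1}(permKV g x) mem_imset ?inE; last exact: perm_inj.
by rewrite ffunE -gk permKV.
Qed.

Lemma hclass_permuted a b :
  b \in hclass a -> exists2 g, preserves_key g & b = permuted g a.
Proof.
move/hclassP => E.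
have [|g gE] := @perm_of_fibers _ _ (fun x => (key x, a x)) (fun x => (key x, b x)).
  by case=> k t; exact: (esym (E k t)).
exists g => [x|]; first by case: (gE x).
by apply/ffunP => x; rewrite ffunE; case: (gE x).
Qed.

Definition differ a b : nat := #|[set x | a x != b x]|.

Lemma differ_permuted g a b : differ (permuted g a) (permuted g b) = differ a b.
Proof.
rewrite /differ -(card_imset _ (@perm_inj _ g)); congr #|pred_of_set _|.
apply/setP => x; rewrite -{1}(permKV g x) mem_imset ?inE; last exact: perm_inj.
by rewrite !ffunE permKV.
Qed.

Lemma differC a b : differ a b = differ b a.
Proof. by apply: eq_card => x; rewrite !inE eq_sym. Qed.

End Colourings.

(** * Colourings compatible with a matching *)

Section CompatibleColourings.

Variables (H T : finType) (f : H -> H) (tau : T -> T).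
Hypotheses (fK : involutive f) (tauK : involutive tau).
Implicit Types a b : {ffun H -> T}.

(** Fixed points of f stand for half-edges without a partner, and are unconstrained. *)
Definition compatible a := [forall h, (f h != h) ==> (a (f h) == tau (a h))].

Definition mismatches a : {set H} := [set h | a (f h) != tau (a h)].

(** A choice of one element in each pair {h, f h}; it contains no fixed point of f. *)
Definition lower_half : pred H := fun h => (enum_rank h < enum_rank (f h))%N.

Lemma lower_halfN h : f h != h -> lower_half (f h) = ~~ lower_half h.
Proof.
move=> fh; rewrite /lower_half fK -leqNgt [RHS]leq_eqVlt.
suff /negbTE -> : nat_of_ord (enum_rank (f h)) != enum_rank h by [].
by apply: contra fh => /eqP /ord_inj /enum_rank_inj ->.
Qed.

Lemma compatibleP a :
  reflect (forall h, f h != h -> a (f h) = tau (a h)) (compatible a).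
Proof.
apply: (iffP forallP) => E h; first by move=> fh; apply/eqP/(implyP (E h)).
by apply/implyP => fh; apply/eqP/E.
Qed.

(** Repairs every mismatched pair by changing one of its two colours. *)
Definition recolour a : {ffun H -> T} :=
  [ffun h => if lower_half h && (h \in mismatches a) then tau (a (f h)) else a h].

Lemma recolour_compatible a : compatible (recolour a).
Proof.
have lower h : lower_half h -> recolour a h = tau (a (f h)).
  by move=> hU; rewrite ffunE hU inE; case: eqP => //= ->; rewrite tauK.
have upper h : ~~ lower_half h -> recolour a h = a h.
  by move=> hU; rewrite ffunE (negbTE hU).
apply/compatibleP => h fh; have [hU|hU] := boolP (lower_half h).
  by rewrite upper ?lower_halfN ?hU // lower // tauK.
by rewrite lower ?lower_halfN // upper // fK.
Qed.

Lemma differ_recolour a : (differ a (recolour a) <= #|mismatches a|)%N.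
Proof.
apply/subset_leq_card/fintype.subsetP => h; rewrite !inE ffunE inE.
by case: (a (f h) == _) => //; rewrite andbF eqxx.
Qed.

Variables (K : finType) (key : H -> K).

Definition compatible_class (a : {ffun H -> T}) : {set {ffun H -> T}} :=
  [set b in hclass key a | compatible b].

(** Two compatible colourings b and c with the same profile can be mixed, taking b on
    the lower halves and c elsewhere.  The mixture has the histogram of c again, and it
    determines both b and c, because a compatible colouring is known as soon as it is
    known on one element of each pair.  So there are at most as many pairs (b, c) with
    equal profiles as elements in the class, and the Cauchy-Schwarz inequality over the
    profiles concludes. *)
Lemma compatible_class_square (a : {ffun H -> T}) (F : finType)
    (profile : {ffun H -> T} -> F) :
  (forall b c, profile b = profile c ->
     (forall k t, #|[set h | lower_half h && ((key h == k) && (b h == t))]|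
                = #|[set h | lower_half h && ((key h == k) && (c h == t))]|) /\
     (forall h, f h = h -> b h = c h)) ->
  (#|compatible_class a| ^ 2
     <= #|profile @: compatible_class a| * #|hclass key a|)%N.
Proof.
move=> profileP.
have [Y YE] : exists Y, Y = compatible_class a by exists (compatible_class a).
rewrite -YE.
have {}YE b : (b \in Y) = (b \in hclass key a) && compatible b by rewrite YE inE.
pose mix (p : {ffun H -> T} * {ffun H -> T}) : {ffun H -> T} :=
  [ffun h => if lower_half h then p.1 h else p.2 h].
pose Z := [set p : {ffun H -> T} * {ffun H -> T} |
            [&& p.1 \in Y, p.2 \in Y & profile p.1 == profile p.2]].
have -> : #|Y| = (\sum_(i in profile @: Y) #|[set b in Y | profile b == i]|)%N.
  rewrite -sum1_card (partition_big_imset profile) /=.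
  by apply: eq_bigr => i _; rewrite -sum1_card; apply: eq_bigl => b; rewrite !inE.
apply: leq_trans (sum_square_le _ _) _; rewrite leq_mul2l; apply/orP; right.
have <- : #|Z| = (\sum_(i in profile @: Y) #|[set b in Y | profile b == i]| ^ 2)%N.
  rewrite -sum1_card (partition_big (fun p => profile p.1) (mem (profile @: Y))) /=.
    apply: eq_bigr => i _; rewrite -mulnn -cardsX -sum1_card; apply: eq_bigl => p.
    rewrite !inE; case: (p.1 \in Y) => //=; case: (p.2 \in Y) => //=.
      by case: (profile p.1 =P i) => [->|]; rewrite ?andbF ?andbT // eq_sym.
    by rewrite andbF.
  by move=> p; rewrite inE => /and3P[pY _ _]; apply: imset_f.
have mixinj : {in Z &, injective mix}.
  move=> [b c] [b' c']; rewrite !inE !YE /=.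
  move=> /and3P[/andP[_ /compatibleP bC] /andP[_ /compatibleP cC] /eqP bc].
  move=> /and3P[/andP[_ /compatibleP bC'] /andP[_ /compatibleP cC'] /eqP bc'] E.
  have low h : lower_half h -> b h = b' h.
    by move=> hU; move/ffunP: E => /(_ h); rewrite !ffunE hU.
  have up h : ~~ lower_half h -> c h = c' h.
    by move=> hU; move/ffunP: E => /(_ h); rewrite !ffunE (negbTE hU).
  have fixU h : f h = h -> ~~ lower_half h by move=> fh; rewrite /lower_half fh ltnn.
  have cc : c = c'.
    apply/ffunP => h; have [hU|/up //] := boolP (lower_half h).
    have fh : f h != h by apply: contraL hU => /eqP /fixU.
    by apply: (inv_inj tauK); rewrite -cC // -cC' // up // lower_halfN // hU.
  have bb : b = b'.
    apply/ffunP => h; have [/low //|hU] := boolP (lower_half h).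
    have [fh|fh] := eqVneq (f h) h.
      by rewrite (profileP _ _ bc).2 // (profileP _ _ bc').2 // cc.
    by apply: (inv_inj tauK); rewrite -bC // -bC' // low // lower_halfN // hU.
  by rewrite bb cc.
rewrite -(card_in_imset mixinj); apply/subset_leq_card/fintype.subsetP => _ /imsetP[[b c] bcZ ->].
move: bcZ; rewrite inE /= !YE => /and3P[/andP[_ _] /andP[ccl _] /eqP /profileP[E _]].
apply/hclassP => k t; rewrite -(hclassP _ _ _ ccl k t).
rewrite -(cardsID [set h | lower_half h]) -[RHS](cardsID [set h | lower_half h]).
congr (_ + _)%N; last first.
  apply: eq_card => h; rewrite !inE ffunE; case: (lower_half h) => //=.
transitivity #|[set h | lower_half h && ((key h == k) && (b h == t))]|.
  by apply: eq_card => h; rewrite !inE ffunE andbC; case: (lower_half h).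
by rewrite E; apply: eq_card => h; rewrite !inE andbC.
Qed.

End CompatibleColourings.

Section Balls.

Variables (R : realType) (X T : finType).
Implicit Types a b : {ffun X -> T}.

Definition ball_of a (beta : R) : {set {ffun X -> T}} :=
  [set b | (differ a b)%:R <= beta].

(** Chernoff bound for the size of a Hamming ball of radius beta among the colourings
    of N points; l is the exponential parameter, left free. *)
Definition ball_bound (N : nat) (beta l : R) : R :=
  expR (beta * l + #|T|%:R * N%:R * expR (- l)).

(** Give the weight exp (- l differ a b) to every b: the total weight is a product over
    the points, and each element of the ball weighs at least exp (- l beta). *)
Lemma card_ball_of a (beta l : R) : 0 <= l ->
  #|ball_of a beta|%:R <= ball_bound #|X| beta l.
Proof.
move=> l0; pose wt x t : R := if a x == t then 1 else expR (- l).
have prodE b : \prod_x wt x (b x) = expR (- ((differ a b)%:R * l)).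
  rewrite -mulrN expRM_natl /differ -prodr_const [RHS]big_mkcond /=.
  by apply: eq_bigr => x _; rewrite inE /wt; case: eqP.
have total : \sum_(b : {ffun X -> T}) \prod_x wt x (b x)
               <= expR (#|T|%:R * #|X|%:R * expR (- l)).
  rewrite -bigA_distr_bigA /=.
  have -> : expR (#|T|%:R * #|X|%:R * expR (- l)) =
            \prod_(x : X) expR (#|T|%:R * expR (- l)).
    by rewrite prodr_const -expRM_natl; congr expR; rewrite mulrCA mulrA mulrC; ring.
  apply: ler_prod => x _; apply/andP; split.
    by apply: sumr_ge0 => t _; rewrite /wt; case: ifP => _; rewrite ?expR_ge0.
  apply: le_trans (expR_ge1Dx _).
  rewrite (bigD1 (a x)) //= /wt eqxx lerD2l.
  rewrite (eq_bigr (fun=> expR (- l))) => [|t /negbTE]; last by rewrite eq_sym => ->.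
  by rewrite sumr_const -[_ *+ _]mulr_natl ler_wpM2r ?expR_ge0 // ler_nat max_card.
rewrite /ball_bound expRD mulrC.
have : #|ball_of a beta|%:R * expR (- (beta * l)) <= expR (#|T|%:R * #|X|%:R * expR (- l)).
  apply: le_trans total.
  rewrite -sum1_card natr_sum mulr_suml big_mkcond /=; apply: ler_sum => b _.
  rewrite prodE inE; case: ifP => [bB|_]; last exact: expR_ge0.
  by rewrite mul1r ler_expR lerN2 ler_wpM2r.
by rewrite expRN ler_pdivrMr ?expR_gt0.
Qed.

(** A permutation carries a and b to colourings at the same distance, so the class of a
    is covered by the balls centred in the class of b. *)
Lemma card_hclass_ball (K : finType) (key : X -> K) a b (beta l : R) : 0 <= l ->
  (differ a b)%:R <= beta ->
  #|hclass key a|%:R <= ball_bound #|X| beta l * #|hclass key b|%:R.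
Proof.
move=> l0 ab.
have sub : hclass key a \subset \bigcup_(c in hclass key b) ball_of c beta.
  apply/fintype.subsetP => a' /hclass_permuted[g gk ->]; apply/bigcupP.
  exists (permuted g b); first exact: permuted_hclass.
  by rewrite inE differ_permuted differC.
apply: le_trans (_ : (\sum_(c in hclass key b) #|ball_of c beta|)%:R <= _).
  rewrite ler_nat; apply: leq_trans (subset_leq_card sub) _.
  elim/big_rec2: _ => [|c m A _ le_Am]; first by rewrite cards0.
  by apply: leq_trans (leq_card_setU _ _) _; rewrite leq_add2l.
rewrite natr_sum mulrC mulr_natl -sumr_const.
by apply: ler_sum => c _; apply: card_ball_of.
Qed.

End Balls.

(** * Exchangeable random matchings *)

Lemma le_sqrt_sqr (R : realType) (x y : R) : x ^+ 2 <= y -> x <= Num.sqrt y.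
Proof.
move=> xy; apply: le_trans (ler_norm x) _; rewrite -sqrtr_sqr ler_sqrt //.
by apply: le_trans xy; apply: sqr_ge0.
Qed.

(** Common form of the two random multigraphs.  The half-edges that may be permuted
    without changing the law are those of the same block and the same liveness.  Live
    half-edges are the ones along which expansion is measured: all of them for two
    communities, the internal ones for several communities.  Each vertex has at least three
    live half-edges, exhibited by [slot], which is where the lower bound 3 on the degrees enters. *)
Record random_pairing (R : realType) := RandomPairing {
  vertex : finType;
  block : finType;
  half_edge : finType;
  block_of : vertex -> block;
  owner : half_edge -> vertex;
  live : pred half_edge;
  slot : vertex * 'I_3 -> half_edge;
  slot_inj : injective slot;
  owner_slot : forall p, owner (slot p) = p.1;
  live_slot : forall p, live (slot p);
  law : {perm half_edge} -> R;
  law_ge0 : forall s, 0 <= law s;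
  law_total : \sum_s law s = 1;
  law_conj : forall (g s : {perm half_edge}),
    preserves_key (fun h => (block_of (owner h), live h)) g -> law (s ^ g)%g = law s;
  law_matching : forall s, law s != 0 -> perfect_matching s
}.

Section RandomPairing.

Variables (R : realType) (M : random_pairing R).
Local Notation V := (vertex M).
Local Notation H := (half_edge M).
Local Notation mu := (@law R M).

Definition half_edge_key (h : H) : block M * bool := (block_of (owner h), live h).

Definition Pr (E : pred {perm H}) : R := \sum_(s | E s) mu s.

Lemma Pr_ge0 E : 0 <= Pr E.
Proof. by apply: sumr_ge0 => s _; exact: law_ge0. Qed.

Lemma Pr_le (E F : pred {perm H}) : (forall s, mu s != 0 -> E s -> F s) -> Pr E <= Pr F.
Proof.
move=> EF; rewrite /Pr [leLHS]big_mkcond [leRHS]big_mkcond /=; apply: ler_sum => s _.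
have [->|mus] := eqVneq (mu s) 0; first by rewrite !if_same.
case: ifP => [/(EF _ mus) ->//|_]; case: ifP => // _; exact: law_ge0.
Qed.

Lemma Pr_le1 (E : pred {perm H}) : Pr E <= 1.
Proof.
rewrite -(law_total M) /Pr [leRHS](bigID E) /= lerDl; apply: sumr_ge0 => s _.
exact: law_ge0.
Qed.

Lemma Pr_ge (F : pred {perm H}) (b : R) : Pr (fun s => ~~ F s) <= b -> 1 - b <= Pr F.
Proof.
by move=> Fb; rewrite lerBlDr -(law_total M) (bigID F) /= lerD2l.
Qed.

Lemma Pr_and_ge (E F : pred {perm H}) (a b : R) :
  1 - a <= Pr E -> Pr (fun s => ~~ F s) <= b -> 1 - (a + b) <= Pr (fun s => E s && F s).
Proof.
move=> Ea Fb; have : Pr E <= Pr (fun s => E s && F s) + Pr (fun s => ~~ F s).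
  rewrite {1}/Pr (bigID F) /= lerD2l /Pr [leLHS]big_mkcond [leRHS]big_mkcond.
  by apply: ler_sum => s _; case: (E s); case: (F s); rewrite ?law_ge0.
lra.
Qed.

Lemma Pr_union (C : finType) (S : pred C) (E : C -> pred {perm H}) :
  Pr (fun s => [exists c, S c && E c s]) <= \sum_(c | S c) Pr (E c).
Proof.
rewrite /Pr (eq_bigr (fun c => \sum_s if E c s then mu s else 0)); last first.
  by move=> c _; rewrite big_mkcond.
rewrite exchange_big /= big_mkcond /=; apply: ler_sum => s _.
have term_ge0 c : 0 <= (if E c s then mu s else 0) by case: ifP; rewrite ?law_ge0.
case: ifP => [/existsP[c /andP[Sc Ec]]|_]; last exact: sumr_ge0.
by rewrite (bigD1 c) //= Ec lerDl; apply: sumr_ge0.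
Qed.

Section Pairing.

Variables (T : finType) (t0 : T) (tau : T -> T) (tauK : involutive tau).
(* The involution phi s may pair only some of the half-edges and fix the others. *)
Variable phi : {perm H} -> H -> H.
Hypothesis phiK : forall s, mu s != 0 -> involutive (phi s).
Hypothesis phi_conj : forall (g s : {perm H}) h,
  preserves_key half_edge_key g -> phi (s ^ g)%g (g h) = g (phi s h).
Implicit Types (a b : {ffun H -> T}) (c : {ffun V -> T}).

(** The profiles of [compatible_class_square]: the histogram of the lower halves and the
    colours of the fixed points.  Only their number matters. *)
Definition few_profiles (f : H -> H) a (B : R) :=
  exists (F : finType) (profile : {ffun H -> T} -> F),
    (forall b b', profile b = profile b' ->
       (forall k t,
          #|[set h | lower_half f h && ((half_edge_key h == k) && (b h == t))]|
        = #|[set h | lower_half f h && ((half_edge_key h == k) && (b' h == t))]|) /\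
       (forall h, f h = h -> b h = b' h)) /\
    #|profile @: compatible_class f tau half_edge_key a|%:R <= B.

Lemma compatible_permuted (g s : {perm H}) a : preserves_key half_edge_key g ->
  compatible (phi s) tau (permuted g a) = compatible (phi (s ^ g)%g) tau a.
Proof.
move=> gk; apply/compatibleP/compatibleP => E h.
  rewrite -(permKV g h) phi_conj // (inj_eq perm_inj) => /E.
  by rewrite !ffunE.
move=> fh; have := E (g h); rewrite phi_conj // (inj_eq perm_inj) => /(_ fh).
by rewrite !ffunE.
Qed.

Lemma Pr_compatible_exchange a b : b \in hclass half_edge_key a ->
  Pr (fun s => compatible (phi s) tau b) = Pr (fun s => compatible (phi s) tau a).
Proof.
move=> /hclass_permuted[g gk ->]; rewrite /Pr [RHS](reindex_inj (conjg_inj g)) /=.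
apply: eq_big => [s|s _]; first exact: compatible_permuted.
by rewrite law_conj.
Qed.

(** All colourings in the class of a are equally likely to be compatible, so this
    probability is the mean proportion of compatible colourings in the class, and
    [compatible_class_square] bounds the proportion for every single matching. *)
Lemma Pr_compatible a (B : R) :
  (forall s, mu s != 0 -> few_profiles (phi s) a B) ->
  Pr (fun s => compatible (phi s) tau a) ^+ 2 * #|hclass half_edge_key a|%:R <= B.
Proof.
move=> few; set P := Pr _; pose X := #|hclass half_edge_key a|%:R : R.
have X0 : 0 < X by rewrite ltr0n; apply/card_gt0P; exists a; apply: mem_hclass.
have PX : P * X = \sum_s mu s * #|compatible_class (phi s) tau half_edge_key a|%:R.
  rewrite mulr_natr -sumr_const.
  rewrite -(eq_bigr _ (fun b => @Pr_compatible_exchange a b)) /Pr.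
  rewrite (eq_bigr (fun b => \sum_s (compatible (phi s) tau b)%:R * mu s)).
    rewrite exchange_big /=; apply: eq_bigr => s _.
    rewrite -mulr_suml -natr_sum mulrC; congr (_ * _%:R).
    rewrite -sum1_card [RHS]big_mkcond [LHS]big_mkcond /=; apply: eq_bigr => b _.
    by rewrite [b \in compatible_class _ _ _ _]inE; case: (b \in _); case: compatible.
  by move=> b _; rewrite big_mkcond; apply: eq_bigr => s _; case: compatible;
     rewrite ?mul1r ?mul0r.
have B0 : 0 <= B.
  have [s mus|mu0] := pickP (fun s => mu s != 0).
    by have [F [p [_]]] := few s mus; apply: le_trans.
  have := law_total M; rewrite big1 => [/eqP|s _]; first by rewrite eq_sym oner_eq0.
  by apply/eqP; have := mu0 s => /negbFE.
have PXle : P * X <= Num.sqrt (B * X).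
  rewrite PX.
  have -> : Num.sqrt (B * X) = \sum_s mu s * Num.sqrt (B * X).
    by rewrite -mulr_suml law_total mul1r.
  apply: ler_sum => s _.
  have [->|mus] := eqVneq (mu s) 0; first by rewrite !mul0r.
  rewrite ler_wpM2l ?law_ge0 //; apply: le_sqrt_sqr.
  have [F [p [pP pB]]] := few s mus.
  apply: le_trans (_ : #|p @: compatible_class (phi s) tau half_edge_key a|%:R * X <= _).
    by rewrite -natrX -natrM ler_nat; apply: compatible_class_square => //; apply: phiK.
  by rewrite ler_wpM2r // ltW.
have : (P * X) ^+ 2 <= B * X.
  rewrite -[leRHS]sqr_sqrtr ?mulr_ge0 ?(ltW X0) //.
  by rewrite ler_pXn2r ?nnegrE ?sqrtr_ge0 ?mulr_ge0 ?Pr_ge0 ?(ltW X0).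
by rewrite exprMn [X ^+ 2]expr2 mulrA ler_pM2r.
Qed.

(** Half-edges that are not live get the neutral colour t0, so that two of them matched
    together are no mismatch when tau fixes t0. *)
Definition on_half_edges c : {ffun H -> T} :=
  [ffun h => if live h then c (owner h) else t0].

(** Colour the j-th slots of the vertices by the j-th of three arbitrary members of the
    class of c.  The exponent 3 is decisive: with the square root of [Pr_compatible] it
    gives a probability of order w ^ (- 3 / 2), which survives a union bound over the w
    colourings of the class of c. *)
Lemma cube_hclass_on_half_edges c :
  (#|hclass (@block_of R M) c| ^ 3 <= #|hclass half_edge_key (on_half_edges c)|)%N.
Proof.
pose mix (p : {ffun 'I_3 -> {ffun V -> T}}) : {ffun H -> T} :=
  [ffun h => if [pick vj | slot vj == h] is Some vj then p vj.2 vj.1 else on_half_edges c h].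
have mix_slot p vj : mix p (slot vj) = p vj.2 vj.1.
  rewrite ffunE; case: pickP => [wk /eqP /slot_inj -> //|/(_ vj)].
  by rewrite eqxx.
have mix_free p h : h \notin codom (@slot R M) -> mix p h = on_half_edges c h.
  move=> hF; rewrite ffunE; case: pickP => // vj /eqP E.
  by rewrite -E codom_f in hF.
have mix_inj : injective mix.
  move=> p q E; apply/ffunP => j; apply/ffunP => v.
  by rewrite -(mix_slot p (v, j)) E mix_slot.
pose P := [set p : {ffun 'I_3 -> {ffun V -> T}} |
  p \in ffun_on (mem (hclass (@block_of R M) c))].
have -> : (#|hclass (@block_of R M) c| ^ 3)%N = #|P|.
  by rewrite [RHS]cardsE card_ffun_on card_ord.
rewrite -(card_imset _ mix_inj); apply/subset_leq_card/fintype.subsetP.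
move=> _ /imsetP[p + ->]; rewrite inE => /ffun_onP pP; apply/hclassP => k t.
rewrite -(cardsID [set h in codom (@slot R M)]) -[RHS](cardsID [set h in codom (@slot R M)]).
congr (_ + _)%N; last first.
  apply: eq_card => h; rewrite !inE; case: (boolP (h \in codom _)) => //= hF.
  by rewrite mix_free.
have slots (b : {ffun H -> T}) (q : 'I_3 -> {ffun V -> T}) :
    (forall vj, b (slot vj) = q vj.2 vj.1) ->
    #|[set h | (half_edge_key h == k) && (b h == t)] :&: [set h in codom (@slot R M)]|
    = (\sum_(j < 3) #|[set v | (block_of v == k.1) && (q j v == t)]| * k.2)%N.
  move=> bq.
  have -> : [set h | (half_edge_key h == k) && (b h == t)] :&: [set h in codom (@slot R M)]
          = (@slot R M) @: [set vj | [&& block_of vj.1 == k.1, q vj.2 vj.1 == t & k.2]].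
    apply/setP => h; rewrite !inE; apply/idP/imsetP => [/andP[/andP[hk ht] /codomP[vj hE]]|].
      exists vj => //; rewrite inE -bq -hE ht /=.
      by rewrite -(eqP hk) /= hE owner_slot live_slot eqxx.
    case=> -[v j]; rewrite inE /= => /and3P[bk qt k2] ->.
    rewrite codom_f bq /= qt !andbT /half_edge_key owner_slot live_slot.
    by rewrite (eqP bk); move: k2; case: (k) => i [] //= _; rewrite eqxx.
  rewrite card_imset; last exact: slot_inj.
  rewrite -sum1_card (partition_big (fun vj => vj.2) predT) //=.
  apply: eq_bigr => j _; rewrite sum1_card.
  rewrite -[RHS]mulnC; case: (k.2); rewrite ?mul0n ?mul1n; last first.
    by apply: eq_card0 => vj; rewrite [LHS]unfold_in /= inE !andbF.
  rewrite -(card_imset _ (_ : injective (fun v : V => (v, j)))); last by move=> v w [].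
  apply: eq_card => -[v i].
  rewrite [LHS]unfold_in /= inE /= andbT; apply/idP/imsetP => [/andP[Q /eqP jE]|[w + [-> ->]]].
    by rewrite jE in Q *; exists v; rewrite ?inE.
  by rewrite inE eqxx andbT.
rewrite (slots _ p) // (slots _ (fun=> c)); last first.
  by move=> vj; rewrite ffunE live_slot owner_slot.
by apply: eq_bigr => j _; rewrite (hclassP _ _ _ (pP j)).
Qed.

(** With at most beta mismatches, some colouring within distance beta is compatible.  The
    union bound over this ball costs [ball_bound] squared, since probabilities appear
    squared, and comparing the classes by [card_hclass_ball] costs it once more. *)
Lemma Pr_mismatches c (beta l B : R) : 0 <= l -> 0 <= B ->
  (forall s a, mu s != 0 -> (differ (on_half_edges c) a)%:R <= beta -> few_profiles (phi s) a B) ->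
  Pr (fun s => #|mismatches (phi s) tau (on_half_edges c)|%:R <= beta) ^+ 2
    * #|hclass (@block_of R M) c|%:R ^+ 3 <= ball_bound T #|H| beta l ^+ 3 * B.
Proof.
move=> l0 B0 few; set P := Pr _; set w := #|_|%:R; set bl := ball_bound _ _ _ _.
have bl0 : 0 < bl by apply: expR_gt0.
have w0 : 0 < w by rewrite ltr0n; apply/card_gt0P; exists c; apply: mem_hclass.
have each a : (differ (on_half_edges c) a)%:R <= beta ->
    Pr (fun s => compatible (phi s) tau a) <= Num.sqrt (B * bl / w ^+ 3).
  move=> da; have := Pr_compatible (fun s mus => few s a mus da).
  set Pa := Pr _ => PaB.
  apply: le_sqrt_sqr.
  rewrite ler_pdivlMr ?exprn_gt0 //.
  apply: le_trans (_ : Pa ^+ 2 * (bl * #|hclass half_edge_key a|%:R) <= _).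
    rewrite ler_wpM2l ?sqr_ge0 //.
    apply: le_trans (card_hclass_ball half_edge_key l0 da).
    by rewrite -natrX ler_nat cube_hclass_on_half_edges.
  by rewrite mulrCA mulrC ler_wpM2r // ltW.
have PB : P <= bl * Num.sqrt (B * bl / w ^+ 3).
  have sub s : mu s != 0 -> #|mismatches (phi s) tau (on_half_edges c)|%:R <= beta ->
      [exists a, (a \in ball_of (on_half_edges c) beta) && compatible (phi s) tau a].
    move=> mus mis; apply/existsP; exists (recolour (phi s) tau (on_half_edges c)).
    rewrite inE recolour_compatible ?andbT //; last exact: phiK.
    by apply: le_trans mis; rewrite ler_nat differ_recolour.
  apply: le_trans (Pr_le sub) _; apply: le_trans (Pr_union _ _) _.
  apply: le_trans (_ : #|ball_of (on_half_edges c) beta|%:R * Num.sqrt (B * bl / w ^+ 3) <= _).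
    rewrite mulr_natl -sumr_const; apply: ler_sum => a; rewrite inE; exact: each.
  by rewrite ler_wpM2r ?sqrtr_ge0 // card_ball_of.
have P0 : 0 <= P by apply: Pr_ge0.
rewrite -ler_pdivlMr ?exprn_gt0 //.
apply: le_trans (_ : (bl * Num.sqrt (B * bl / w ^+ 3)) ^+ 2 <= _).
  by rewrite ler_pXn2r ?nnegrE // mulr_ge0 ?sqrtr_ge0 // ltW.
rewrite exprMn sqr_sqrtr ?divr_ge0 ?mulr_ge0 ?exprn_ge0 ?(ltW bl0) ?(ltW w0) //.
by apply: le_of_eq; ring.
Qed.

End Pairing.
End RandomPairing.

(** * Union bounds over colourings *)

(** Each value of k is taken on at most one class, over which the inverse class sizes
    add up to at most 1. *)
Lemma sum_inv_card_hclass (R : realType) (X K T F : finType) (key : X -> K)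
    (S : pred {ffun X -> T}) (k : {ffun X -> T} -> F) :
  (forall c c', S c -> S c' -> k c = k c' -> c' \in hclass key c) ->
  \sum_(c | S c) (#|hclass key c|%:R)^-1 <= #|F|%:R :> R.
Proof.
move=> kP; rewrite (partition_big k predT) //= -sum1_card natr_sum.
apply: ler_sum => i _; have [c0 /andP[S0 /eqP k0]|none] := pickP (fun c => S c && (k c == i)).
  have w0 : 0 < #|hclass key c0|%:R :> R.
    by rewrite ltr0n; apply/card_gt0P; exists c0; apply: mem_hclass.
  rewrite (eq_bigr (fun=> (#|hclass key c0|%:R)^-1)); last first.
    move=> c /andP[Sc /eqP kc]; have := kP _ _ S0 Sc; rewrite k0 kc inE => /(_ erefl) /eqP E.
    by rewrite /hclass E.
  rewrite sumr_const -[_ *+ _]mulr_natl ler_pdivrMr // mul1r ler_nat.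
  apply/subset_leq_card/fintype.subsetP => c; rewrite unfold_in /= => /andP[Sc /eqP kc].
  by apply: kP; rewrite // k0 kc.
by rewrite big_pred0.
Qed.

(** With w the size of the class of c, P c <= exp (g / 2) w ^ (- 3 / 2): a factor w ^ (- 1 / 2)
    is bounded by exp (- h / 2), and the remaining 1 / w is summed by
    [sum_inv_card_hclass]. *)
Lemma sum_prob_colourings (R : realType) (X K T F : finType) (key : X -> K)
    (S : pred {ffun X -> T}) (k : {ffun X -> T} -> F) (P : {ffun X -> T} -> R) (g h : R) :
  (forall c c', S c -> S c' -> k c = k c' -> c' \in hclass key c) ->
  (forall c, 0 <= P c) ->
  (forall c, S c -> P c ^+ 2 * #|hclass key c|%:R ^+ 3 <= expR g) ->
  (forall c, S c -> expR h <= #|hclass key c|%:R) ->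
  \sum_(c | S c) P c <= #|F|%:R * expR ((g - h) / 2).
Proof.
move=> kP P0 Pg hw.
apply: le_trans (_ : \sum_(c | S c) expR ((g - h) / 2) * (#|hclass key c|%:R)^-1 <= _).
  apply: ler_sum => c Sc; set w := #|_|%:R.
  have w0 : 0 < w by apply: lt_le_trans (expR_gt0 h) (hw c Sc).
  rewrite ler_pdivlMr // -[leLHS]ger0_norm ?mulr_ge0 ?(ltW w0) // -sqrtr_sqr.
  have -> : expR ((g - h) / 2) = Num.sqrt (expR (g - h)).
    rewrite -[LHS]ger0_norm ?expR_ge0 // -sqrtr_sqr -expRM_natl.
    by congr (Num.sqrt (expR _)); field.
  rewrite ler_sqrt ?expR_ge0 // expRD expRN ler_pdivlMr ?expR_gt0 //.
  apply: le_trans (Pg c Sc); rewrite exprMn -mulrA ler_wpM2l ?sqr_ge0 //.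
  by rewrite [leRHS]exprSr ler_wpM2l ?sqr_ge0 //; apply: hw.
by rewrite -mulr_sumr mulrC ler_wpM2r ?expR_ge0 //; apply: sum_inv_card_hclass kP.
Qed.

Lemma exp2_le_bin n k : (2 * k <= n)%N -> (2 ^ k <= 'C(n, k))%N.
Proof.
elim: k n => [|k IH] [|n] // kn.
rewrite -(leq_pmul2l (ltn0Sn k)) -mul_bin_diag /= expnS mulnA.
by apply: leq_mul; [rewrite mulnC; exact: kn|apply: IH; lia].
Qed.

Lemma bin_ge_ratio n k : (k <= n)%N -> (n ^ k <= 'C(n, k) * k ^ k)%N.
Proof.
elim: k n => [|k IH] [|n] // kn.
rewrite -(leq_pmul2l (ltn0Sn k)) [leqRHS]mulnA -mul_bin_diag /=.
have := IH n kn; set B := 'C(n, k) => IHB.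
have main : (n.+1 ^ k * k ^ k <= n ^ k * k.+1 ^ k)%N.
  by have [->//|k0] := posnP k; rewrite -!expnMn leq_exp2r //; nia.
have kk0 : (0 < k ^ k)%N by rewrite expn_gt0; case: (k).
rewrite -(leq_pmul2r kk0) !expnS.
have : (n.+1 ^ k * k ^ k <= B * k ^ k * k.+1 ^ k)%N.
  by apply: leq_trans main _; rewrite leq_mul2r IHB orbT.
move: (n.+1 ^ k)%N (k ^ k)%N (k.+1 ^ k)%N => x y z.
move=> /(leq_mul (leqnn (k.+1 * n.+1))); lia.
Qed.

Lemma exp2_le_expR (R : realType) (n : nat) : 2 ^+ n <= expR n%:R :> R.
Proof.
rewrite -[n%:R]mulr1 expRM_natl; apply: lerXn2r; rewrite ?nnegrE ?expR_ge0 //.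
by have := expR_ge1Dx (1 : R).
Qed.

Lemma expR_half_le_exp2 (R : realType) (n : nat) : expR (n%:R / 2) <= 2 ^+ n :> R.
Proof.
rewrite expRM_natl; apply: lerXn2r; rewrite ?nnegrE ?expR_ge0 // -[_^-1]opprK expRN.
rewrite -[leRHS]invrK lef_pV2 ?posrE ?expR_gt0 //.
by apply: le_trans (expR_ge1Dx _); lra.
Qed.

(** The graph of ln lies below its tangent at 1 / t. *)
Lemma ln_le_linear (R : realType) (t y : R) : 0 < t -> 0 < y -> ln y <= t * y - 1 - ln t.
Proof.
move=> t0 y0; rewrite lerBrDr -lnM ?posrE // mulrC.
have := @le_ln1Dx R (t * y - 1); rewrite addrCA subrr addr0; apply.
by rewrite ltrBrDr addNr mulr_gt0.
Qed.

Section FewProfiles.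

Variables (R : realType) (M : random_pairing R).
Local Notation V := (vertex M).
Local Notation H := (half_edge M).
Local Notation K := (block M * bool)%type.

(** Without fixed points the histogram of the lower halves is a profile. *)
Lemma few_profiles_fixfree (T : finType) (tau : T -> T) (f : H -> H)
    (a : {ffun H -> T}) :
  (forall h, f h != h) ->
  few_profiles tau f a ((#|H|.+1 ^ #|{: K * T}|)%:R : R).
Proof.
move=> ff.
pose cnt (b : {ffun H -> T}) (kt : K * T) :=
  #|[set h | lower_half f h && ((half_edge_key h == kt.1) && (b h == kt.2))]|.
exists {ffun K * T -> 'I_(#|H|.+1)}, (fun b => [ffun kt => inord (cnt b kt)]).
split; last first.
  by rewrite ler_nat; apply: leq_trans (max_card _) _; rewrite card_ffun card_ord.
move=> b b' /ffunP E; split=> [k t|h fh]; last by have := ff h; rewrite fh eqxx.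
have /(congr1 (@nat_of_ord _)) := E (k, t); rewrite !ffunE !inordK //; exact: max_card.
Qed.

(** The number of half-edges coloured true is constant on a class.  When it is small, so
    are the entries of the histograms; the factor 2 ^ Q counts the colours of the fixed
    points. *)
Lemma few_profiles_bool (f : H -> H) (a : {ffun H -> bool}) (m Q : nat) :
  (#|[set h | a h]| <= m)%N -> (#|[set h | f h == h]| <= Q)%N ->
  few_profiles id f a ((m.+1 ^ #|{: K}| * 2 ^ Q)%:R : R).
Proof.
move=> am fixQ.
pose cnt (b : {ffun H -> bool}) (k : K) :=
  #|[set h | lower_half f h && ((half_edge_key h == k) && b h)]|.
pose prof (b : {ffun H -> bool}) : {ffun K -> 'I_(#|H|.+1)} * {set H} :=
  ([ffun k => inord (cnt b k)], [set h | (f h == h) && b h]).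
exists ({ffun K -> 'I_(#|H|.+1)} * {set H})%type, prof; split; last first.
  pose small : {set {ffun K -> 'I_(#|H|.+1)}} :=
    [set q in ffun_on (fun i : 'I_(#|H|.+1) => i < m.+1)%N].
  rewrite ler_nat; apply: (@leq_trans #|finset.setX small (powerset [set h | f h == h])|).
    apply/subset_leq_card/fintype.subsetP => _ /imsetP[b bY ->].
    rewrite finset.in_setX; apply/andP; split; last first.
      by rewrite inE; apply/fintype.subsetP => h; rewrite !inE => /andP[].
    rewrite inE; apply/ffun_onP => k; rewrite ffunE unfold_in /= inordK; last first.
      by rewrite ltnS; apply: max_card.
    rewrite ltnS; apply: leq_trans am.
    have [+ _] : b \in hclass (@half_edge_key R M) a /\ compatible f id b.
      by move: bY; rewrite 2!inE => /andP[bcl bc]; split=> //; rewrite inE.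
    move/hclass_permuted => [g gk ->].
    apply: (@leq_trans #|[set h | permuted g a h]|).
      by apply/subset_leq_card/fintype.subsetP => h; rewrite !inE => /and3P[].
    rewrite -(card_imset _ (@perm_inj _ g)).
    apply/subset_leq_card/fintype.subsetP => _ /imsetP[h + ->].
    by rewrite !inE ffunE.
  rewrite cardsX card_powerset; apply: leq_mul; last by rewrite leq_exp2l.
  rewrite cardsE card_ffun_on; have [->//|K0] := posnP #|{: K}|.
  rewrite leq_exp2r //.
  rewrite -[leqRHS]card_ord.
  rewrite -(@card_in_imset _ _ (fun i : 'I_(#|H|.+1) => inord i : 'I_m.+1)); first exact: max_card.
  move=> i j; rewrite !unfold_in /= => im jm /(congr1 (@nat_of_ord _)).
  by rewrite !inordK // => /ord_inj.
move=> b b' [/ffunP E1 /setP E2]; split=> [k t|h fh]; last first.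
  by have := E2 h; rewrite !inE fh eqxx.
have Ek : cnt b k = cnt b' k.
  by have /(congr1 (@nat_of_ord _)) := E1 k; rewrite !ffunE !inordK // ltnS; apply: max_card.
have tot (q : {ffun H -> bool}) :
    (#|[set h | lower_half f h && ((half_edge_key h == k) && (q h == false))]| + cnt q k)%N
    = #|[set h | lower_half f h && (half_edge_key h == k)]|.
  rewrite -(cardsID [set h | q h] [set h | lower_half f h && (half_edge_key h == k)]) addnC.
  by congr (_ + _)%N; apply: eq_card => h; rewrite !inE; case: lower_half; case: (q h);
     rewrite ?andbT ?andbF.
case: t.
  by move: Ek; rewrite /cnt; under eq_finset do rewrite -[b _]eqb_id;
     move=> ->; apply: eq_card => h; rewrite !inE eqb_id.
by apply/eqP; rewrite -(eqn_add2r (cnt b k)) tot Ek tot.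
Qed.

End FewProfiles.

(** * Sizes of histogram classes *)

Section ClassSizes.

Variables (X K : finType) (key : X -> K).

Definition fiber (k : K) : {set X} := [set x | key x == k].

Lemma sum_card_fiber (R : realType) : \sum_k #|fiber k|%:R = #|X|%:R :> R.
Proof.
rewrite -natr_sum -cardsT -[in RHS]sum1_card (partition_big key predT) //=.
congr (_%:R); apply: eq_bigr => i _; rewrite sum1_card.
by apply: eq_card => v; rewrite !inE unfold_in /= inE.
Qed.

(** Every subset of the fibre that has as many elements as the colour t is the set of
    points coloured t by some member of the class. *)
Lemma bin_le_card_hclass (T : finType) (c : {ffun X -> T}) (k : K) (t : T) :
  ('C(#|fiber k|, #|[set x in fiber k | c x == t]|) <= #|hclass key c|)%N.
Proof.
set A := [set x in fiber k | c x == t]; rewrite -cards_draws.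
pose trace (c' : {ffun X -> T}) := [set x in fiber k | c' x == t].
apply: leq_trans (leq_imset_card trace (hclass key c)).
apply/subset_leq_card/fintype.subsetP => B; rewrite inE => /andP[/fintype.subsetP Bk /eqP BA].
have Ak x : x \in A -> key x == k by rewrite !inE => /andP[].
have {}Bk x : x \in B -> key x == k by move=> /Bk; rewrite inE.
have [|s sE] := @perm_of_fibers _ _ (fun x => (key x, x \in A)) (fun x => (key x, x \in B)).
  have tt (C : {set X}) : (forall x, x \in C -> key x == k) ->
      #|[set x | (key x, x \in C) == (k, true)]| = #|C|.
    move=> Ck; apply: eq_card => x; rewrite inE xpair_eqE eqb_id.
    by have [/Ck ->|] := boolP (x \in C); rewrite ?andbF.
  have tot (C : {set X}) : (#|[set x | (key x, x \in C) == (k, true)]| +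
      #|[set x | (key x, x \in C) == (k, false)]|)%N = #|fiber k| :> nat.
    rewrite -(cardsID C (fiber k)); congr (_ + _)%N; apply: eq_card => x.
      by rewrite !inE xpair_eqE eqb_id.
    by rewrite !inE xpair_eqE eqbF_neg andbC.
  move=> [j b]; have [->|jk] := eqVneq j k.
    case: b; first by rewrite !tt.
    apply/eqP; rewrite -(eqn_add2l #|B|) -[in X in _ == X](tt B Bk) (tot B).
    by rewrite BA -[in X in (X + _)%N](tt A Ak) (tot A).
  apply: eq_card => x; rewrite !inE !xpair_eqE; have [xj|//] := eqVneq (key x) j.
  have [/Ak|_] := boolP (x \in A); first by rewrite xj (negbTE jk).
  by have [/Bk|//] := boolP (x \in B); rewrite xj (negbTE jk).
apply/imsetP; exists (permuted s c).
  by apply: permuted_hclass => x; case: (sE x) => ->.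
apply/setP => x; rewrite !inE ffunE; case: (sE x) => kE ->.
by rewrite !inE -kE.
Qed.

(** The most frequent colour of the fibre fills between eps and 1 - eps of it, so the
    binomial coefficient of [bin_le_card_hclass] is at least 2 ^ (eps #|fiber k|). *)
Lemma exp_le_card_hclass (R : realType) (T : finType) (t0 : T) (c : {ffun X -> T}) (k : K)
    (eps : R) : 0 <= eps -> eps * #|T|%:R <= 1 ->
  (forall t, #|[set x in fiber k | c x == t]|%:R <= (1 - eps) * #|fiber k|%:R) ->
  expR (eps * #|fiber k|%:R / 2) <= #|hclass key c|%:R.
Proof.
move=> e0 epsT small; pose cnt t := #|[set x in fiber k | c x == t]|.
have [t _ tmax] := @arg_maxnP _ t0 predT cnt isT.
have T0 : (0 < #|T|%:R :> R) by rewrite ltr0n; apply/card_gt0P; exists t0.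
have cnt_ge : eps * #|fiber k|%:R <= (cnt t)%:R.
  have tot : (#|fiber k| <= #|T| * cnt t)%N.
    rewrite -sum1_card (partition_big c predT) //= mulnC -[(_ * #|T|)%N]mulnC -sum_nat_const.
    apply: leq_sum => u _; apply: leq_trans (tmax u isT); rewrite /cnt -sum1_card.
    by apply: eq_leq; apply: eq_bigl => x; rewrite !inE.
  apply: le_trans (_ : eps * (#|T|%:R * (cnt t)%:R) <= _).
    by rewrite ler_wpM2l // -natrM ler_nat.
  by rewrite mulrA ler_piMl.
have le_cnt : (cnt t <= #|fiber k|)%N.
  by apply/subset_leq_card/fintype.subsetP => x; rewrite inE => /andP[].
apply: le_trans (_ : 'C(#|fiber k|, cnt t)%:R <= _); last by rewrite ler_nat bin_le_card_hclass.
have half_le (j : nat) : (2 * j <= #|fiber k|)%N -> eps * #|fiber k|%:R <= j%:R ->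
    expR (eps * #|fiber k|%:R / 2) <= 'C(#|fiber k|, j)%:R.
  move=> j2 je; apply: le_trans (_ : (2 ^ j)%:R <= _); last by rewrite ler_nat exp2_le_bin.
  rewrite natrX; apply: le_trans (expR_half_le_exp2 _ _).
  by rewrite ler_expR ler_wpM2r.
have [h|h] := leqP (2 * cnt t) #|fiber k|; first exact: half_le.
rewrite -bin_sub //; apply: half_le; first by lia.
rewrite natrB //; have := small t; rewrite -/(cnt t); lra.
Qed.

End ClassSizes.

(** * Expansion for colourings without a dominant colour *)

Section LargeColourings.

Variable (R : realType).

Record tame (m D : nat) (rho : R) (M : random_pairing R) : Prop := Tame {
  tame_block : (#|block M| <= m)%N;
  tame_degree : forall v : vertex M, (#|[set h | owner h == v]| <= D)%N;
  tame_ratio : forall i : block M,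
    rho * #|vertex M|%:R <= #|fiber (@block_of R M) i|%:R
}.

Lemma card_owned m D rho (M : random_pairing R) (A : {set vertex M}) : tame m D rho M ->
  (#|[set h | owner h \in A]| <= D * #|A|)%N.
Proof. by move=> [_ deg _]; apply: card_preim_le. Qed.

Lemma card_half_edge m D rho (M : random_pairing R) : tame m D rho M ->
  (#|half_edge M| <= D * #|vertex M|)%N.
Proof.
move=> tm; rewrite -cardsT; have := card_owned [set: vertex M] tm.
by rewrite cardsT; apply: leq_trans; apply/subset_leq_card/fintype.subsetP => h; rewrite !inE.
Qed.

(** Pairs of booleans treat cuts and near-bipartite structure together.  The colouring
    (1_A, 1_A) is mismatched exactly along the cut of A.  For a function f, the colouring
    (t < f, t < - f) is not mismatched where f takes opposite values at the ends of an
    edge. *)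
Definition swap (p : bool * bool) := (p.2, p.1).

Lemma swapK : involutive swap.
Proof. by case. Qed.

Definition spread (M : random_pairing R) (eps : R) (c : {ffun vertex M -> bool * bool}) :=
  [exists i, forall t, #|[set v in fiber (@block_of R M) i | c v == t]|%:R
                         <= (1 - eps) * #|fiber (@block_of R M) i|%:R].

Definition large_expansion (M : random_pairing R) (eps delta : R)
    (s : {perm half_edge M}) :=
  [forall c, spread eps c ==>
     (delta * #|vertex M|%:R <= #|mismatches s swap (on_half_edges (false, false) c)|%:R)].

(** The logarithm is bounded by a line of slope small enough to be absorbed by k. *)
Lemma exponent_small (A b k eta : R) : 0 < eta -> 0 < k -> 0 <= A -> 0 < b ->
  exists n0 : nat, forall n : nat, (n0 <= n)%N ->
    expR (A * ln (b * n%:R + 1) - k * n%:R) <= eta.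
Proof.
move=> eta0 k0 A0 b0.
pose t := k / (2 * (A + 1) * b).
have t0 : 0 < t by rewrite divr_gt0 // !mulr_gt0 //; lra.
pose C := A * (t - 1 - ln t).
pose n0 := Num.truncn ((C - ln eta) / (k / 2)).
exists n0.+1 => n n0n; rewrite -[leRHS]lnK ?posrE // ler_expR.
have n_ge : (C - ln eta) / (k / 2) <= n%:R.
  apply: le_trans (_ : n0.+1%:R <= _); last by rewrite ler_nat.
  by rewrite ltW // truncnS_gt.
rewrite ler_pdivrMr in n_ge; last lra.
have y0 : 0 < b * n%:R + 1 by rewrite ltr_pwDr // mulr_ge0 // ltW.
have := ler_wpM2l A0 (ln_le_linear t0 y0).
have : A * (t * (b * n%:R)) <= k / 2 * n%:R.
  rewrite /t; have -> : A * (k / (2 * (A + 1) * b) * (b * n%:R)) = A / (A + 1) * (k / 2 * n%:R).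
    by field; rewrite !gt_eqF //; lra.
  rewrite ler_piMl //; first by rewrite !mulr_ge0 // ltW.
  by rewrite ler_pdivrMr; lra.
move: n_ge; rewrite /C; lra.
Qed.

(** By [exp_le_card_hclass] the class of a spread colouring has size at least
    exp (kap n), whereas classes and profiles are polynomially many.  For delta small the
    ball factors stay below exp (kap n / 2), so the union bound decays exponentially. *)
Theorem large_expansion_whp (m D : nat) (rho eps : R) :
  0 < rho -> 0 < eps -> eps <= 1 / 4 -> (0 < D)%N ->
  exists2 delta : R, 0 < delta & forall eta : R, 0 < eta -> exists n0 : nat,
    forall M : random_pairing R, tame m D rho M -> (n0 <= #|vertex M|)%N ->
      Pr (fun s => ~~ @large_expansion M eps delta s) <= eta.
Proof.
move=> rho0 eps0 eps4 D0; pose kap := eps * rho / 2.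
have kap0 : 0 < kap by rewrite divr_gt0 // mulr_gt0.
have D0r : 0 < D%:R :> R by rewrite ltr0n.
(* l and delta make each of the two terms of the ball exponent cost at most kap / 4. *)
pose l := Num.max 0 (ln (48 * D%:R / kap)).
have l0 : 0 <= l by rewrite le_max lexx.
have lP : 12 * D%:R * expR (- l) <= kap / 4.
  have : ln (48 * D%:R / kap) <= l by rewrite le_max lexx orbT.
  rewrite -ler_expR lnK ?posrE ?divr_gt0 ?mulr_gt0 //.
  rewrite ler_pdivrMr // => h; rewrite expRN ler_pdivrMr ?expR_gt0 //; lra.
pose delta := kap / (12 * (l + 1)).
have delta0 : 0 < delta by rewrite divr_gt0 // mulr_gt0 // ltr_wpDl.
have deltaP : 3 * (delta * l) <= kap / 4.
  have -> : 3 * (delta * l) = kap / 4 * (l / (l + 1)).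
    by rewrite /delta; field; rewrite gt_eqF // ltr_wpDl.
  by rewrite ler_piMr //; [lra|rewrite ler_pdivrMr; lra].
exists delta => // eta eta0.
pose J := (m * 2 * 4)%N; pose F := (m * 4)%N.
have [n0 n0P] := @exponent_small (F%:R + J%:R / 2) D%:R (kap / 4) eta eta0 ltac:(lra)
  ltac:(by rewrite addr_ge0 // divr_ge0) D0r.
exists n0 => M tm n0n; set n := #|vertex M|; set N := #|half_edge M|.
have N_le : (N <= D * n)%N by apply: card_half_edge tm.
have Kc : (#|block M| <= m)%N by case: tm.
apply: le_trans (n0P n n0n).
pose bad (c : {ffun vertex M -> bool * bool}) (s : {perm half_edge M}) :=
  #|mismatches s swap (on_half_edges (false, false) c)|%:R <= delta * n%:R.
apply: le_trans (_ : Pr (fun s => [exists c, spread eps c && bad c s]) <= _).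
  apply: Pr_le => s _; rewrite negb_forall => /existsP[c]; rewrite negb_imply => /andP[sc h].
  by apply/existsP; exists c; rewrite sc /= /bad ltW // ltNge.
apply: le_trans (Pr_union _ _) _.
pose key (c : {ffun vertex M -> bool * bool}) : {ffun block M * (bool * bool) -> 'I_n.+1} :=
  [ffun kt => inord #|[set v | (block_of v == kt.1) && (c v == kt.2)]|].
pose g := 3 * (delta * n%:R * l + #|{: bool * bool}|%:R * N%:R * expR (- l))
          + ln ((N.+1 ^ #|{: (block M * bool) * (bool * bool)}|)%:R).
pose hh := kap * n%:R.
apply: le_trans (sum_prob_colourings (key := @block_of R M) (k := key) (g := g) (h := hh)
  _ _ _ _) _.
- move=> c c' _ _ /ffunP E; apply/hclassP => k t.
  have /(congr1 (@nat_of_ord _)) := E (k, t); rewrite !ffunE !inordK //.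
    by rewrite ltnS max_card.
  by rewrite ltnS max_card.
- by move=> c; apply: Pr_ge0.
- move=> c _; rewrite /g expRD lnK; last by rewrite posrE ltr0n expn_gt0.
  rewrite expRM_natl -/(ball_bound _ N (delta * n%:R) l).
  apply: Pr_mismatches => //.
  + exact: swapK.
  + by move=> s mus h; have /forallP/(_ h)/andP[_ /eqP] := law_matching mus.
  + by move=> gg s h _; rewrite conjgE !permM permK.
  + move=> s a mus _; apply: few_profiles_fixfree => h.
    by have /forallP/(_ h)/andP[] := law_matching mus.
- move=> c /existsP[i /forallP si].
  apply: le_trans (exp_le_card_hclass (false, false) (ltW eps0) _ si); last first.
    by rewrite card_prod card_bool; lra.
  rewrite ler_expR /hh /kap; case: tm => _ _ /(_ i) ri.
  have := ler_wpM2l (ltW eps0) ri; rewrite -/n; lra.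
have bn : 1 <= D%:R * n%:R + 1 :> R by rewrite lerDr mulr_ge0.
have Nb : N.+1%:R <= D%:R * n%:R + 1 :> R by rewrite -natrM natr1 ler_nat ltnS.
have nb : n.+1%:R <= D%:R * n%:R + 1 :> R.
  by rewrite -natrM natr1 ler_nat ltnS leq_pmull.
have lnb : 0 <= ln (D%:R * n%:R + 1 : R) by apply: ln_ge0.
have keyE : #|{ffun block M * (bool * bool) -> 'I_n.+1}|%:R
    <= expR (F%:R * ln (D%:R * n%:R + 1)) :> R.
  rewrite card_ffun card_ord !card_prod card_bool.
  apply: le_trans (_ : n.+1%:R ^+ F <= _).
    by rewrite natrX ler_weXn2l ?ler1n // /F leq_mul.
  rewrite expRM_natl lnK ?posrE; last lra.
  by apply: lerXn2r; rewrite ?nnegrE //; lra.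
have profE : ln (N.+1 ^ #|{: (block M * bool) * (bool * bool)}|)%:R
    <= J%:R * ln (D%:R * n%:R + 1) :> R.
  rewrite !card_prod card_bool natrX lnXn ?ltr0n // -[_ *+ _]mulr_natl.
  apply: ler_pM => //; first by apply: ln_ge0; rewrite ler1n.
    by rewrite ler_nat /J !leq_mul.
  by rewrite ler_ln ?posrE ?ltr0n //; lra.
apply: le_trans (ler_wpM2r (expR_ge0 _) keyE) _; rewrite -expRD ler_expR.
rewrite /g /hh card_prod card_bool.
have := ler_wpM2r (ler0n R n) lP; have := ler_wpM2r (ler0n R n) deltaP.
have : (2 * 2)%:R * N%:R * expR (- l) <= 4 * (D%:R * n%:R) * expR (- l).
  rewrite ler_wpM2r ?expR_ge0 // ler_wpM2l // -natrM ler_nat //.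
move: profE; rewrite -[(2 * 2)%:R]/(4%:R).
set q := ln _; set y := expR (- l); set z := ln _; lra.
Qed.

End LargeColourings.

(** * Expansion of small sets *)

Section SmallSets.

Variable (R : realType).

(** Subsets of the fibres can be chosen independently for distinct keys. *)
Lemma prod_bin_le_card_hclass (X K : finType) (key : X -> K) (c : {ffun X -> bool}) :
  (\prod_k 'C(#|fiber key k|, #|[set x in fiber key k | c x]|) <= #|hclass key c|)%N.
Proof.
pose Q (k : K) : {set {set X}} :=
  [set B : {set X} | B \subset fiber key k & #|B| == #|[set x in fiber key k | c x]|].
have -> : (\prod_k 'C(#|fiber key k|, #|[set x in fiber key k | c x]|))%N
          = #|[set f : {ffun K -> {set X}} | f \in family Q]|.
  rewrite -[RHS]sum1_card; under [RHS]eq_bigl do rewrite inE.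
  rewrite (eq_bigr (fun k => \sum_(B in Q k) 1)%N); last first.
    by move=> k _; rewrite sum1_card cards_draws.
  by rewrite bigA_distr_big_dep; apply: eq_bigr => f _; rewrite big1_eq.
pose glue (f : {ffun K -> {set X}}) : {ffun X -> bool} := [ffun x => x \in f (key x)].
have glue_inj : {in [set f : {ffun K -> {set X}} | f \in family Q] &, injective glue}.
  move=> f f'; rewrite !inE => /familyP fQ /familyP fQ' /ffunP E.
  apply/ffunP => k; apply/setP => x; have := E x; rewrite !ffunE.
  have [->//|xk _] := eqVneq (key x) k.
  have out (q : {ffun K -> {set X}}) : q k \in Q k -> (x \in q k) = false.
    rewrite inE => /andP[/fintype.subsetP qk _]; apply/negbTE; apply: contra xk => /qk.
    by rewrite inE.
  by rewrite !out.
rewrite -(card_in_imset glue_inj); apply/subset_leq_card/fintype.subsetP.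
move=> _ /imsetP[f + ->]; rewrite inE => /familyP fQ; apply/hclassP => k t.
have fk : #|[set x in fiber key k | glue f x]| = #|[set x in fiber key k | c x]|.
  have := fQ k; rewrite inE => /andP[/fintype.subsetP fk /eqP <-].
  apply: eq_card => x; rewrite !inE ffunE; have [->//|xk] := eqVneq (key x) k.
  by apply/esym/negbTE; apply: contra xk => /fk; rewrite inE.
have tot (q : {ffun X -> bool}) :
    (#|[set x in fiber key k | q x]| + #|[set x | (key x == k) && (q x == false)]|)%N
    = #|fiber key k|.
  rewrite -(cardsID [set x | q x] (fiber key k)).
  by congr (_ + _)%N; apply: eq_card => x; rewrite !inE; case: (q x); rewrite ?andbT ?andbF.
case: t; last by apply/eqP; rewrite -(eqn_add2l #|[set x in fiber key k | glue f x]|) tot fk tot.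
transitivity #|[set x in fiber key k | glue f x]|.
  by apply: eq_card => x; rewrite !inE eqb_id.
by rewrite fk; apply: eq_card => x; rewrite !inE eqb_id.
Qed.

(** With s_k points coloured true in a fibre of size n_k, the fibre contributes at least
    (n_k / s_k) ^ s_k >= (rho #|X| / s) ^ s_k, and the s_k add up to s. *)
Lemma exp_le_card_hclass_bool (X K : finType) (key : X -> K) (c : {ffun X -> bool})
    (rho : R) : 0 < rho ->
  (forall k, rho * #|X|%:R <= #|fiber key k|%:R) ->
  let s := #|[set x | c x]| in (0 < s)%N ->
  expR (s%:R * (ln rho + ln (#|X|%:R / s%:R))) <= #|hclass key c|%:R.
Proof.
move=> rho0 ratio s s0; pose sk k := #|[set x in fiber key k | c x]|.
have X0 : (0 < #|X|)%N by apply: leq_trans s0 (max_card _).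
have s0r : 0 < s%:R :> R by rewrite ltr0n.
pose r := rho * #|X|%:R / s%:R.
have r0 : 0 < r by rewrite divr_gt0 ?mulr_gt0 ?ltr0n.
have -> : expR (s%:R * (ln rho + ln (#|X|%:R / s%:R))) = \prod_k r ^+ sk k.
  rewrite expRM_natl expRD !lnK ?posrE ?divr_gt0 ?ltr0n // mulrA -/r.
  rewrite prodrXr; congr (_ ^+ _).
  rewrite /s -sum1_card (partition_big key predT) //=; apply: eq_bigr => k _.
  by rewrite sum1_card; apply: eq_card => x; rewrite !inE unfold_in /= inE andbC.
apply: le_trans (_ : (\prod_k 'C(#|fiber key k|, sk k))%:R <= _).
  rewrite natr_prod; apply: ler_prod => k _; rewrite exprn_ge0 ?(ltW r0) //=.
  have sks : (sk k <= s)%N by apply/subset_leq_card/fintype.subsetP => x; rewrite !inE => /andP[].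
  have skf : (sk k <= #|fiber key k|)%N.
    by apply/subset_leq_card/fintype.subsetP => x; rewrite !inE => /andP[].
  have [->|sk0] := posnP (sk k); first by rewrite expr0 bin0.
  have sk0r : 0 < (sk k)%:R :> R by rewrite ltr0n.
  apply: le_trans (_ : (#|fiber key k|%:R / (sk k)%:R) ^+ sk k <= _).
    apply: lerXn2r; rewrite ?nnegrE ?(ltW r0) ?divr_ge0 //.
    rewrite /r ler_pdivrMr // mulrAC ler_pdivlMr //.
    by apply: ler_pM; rewrite ?mulr_ge0 ?(ltW rho0) ?ratio ?ler_nat.
  rewrite expr_div_n ler_pdivrMr ?exprn_gt0 // -!natrX -natrM ler_nat.
  exact: bin_ge_ratio.
by rewrite ler_nat; apply: prod_bin_le_card_hclass.
Qed.

(** Sets must have at least Q / Kp vertices.  This makes the factor 2 ^ Q, due to the at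
    most Q fixed points of phi s, exponential in the size of the set only. *)
Definition small_expansion (M : random_pairing R)
    (phi : {perm half_edge M} -> half_edge M -> half_edge M) (eps delta : R) (Kp Q : nat)
    (s : {perm half_edge M}) :=
  [forall c : {ffun vertex M -> bool},
     [&& (0 < #|[set v | c v]|)%N, #|[set v | c v]|%:R <= eps * #|vertex M|%:R
       & (Q <= Kp * #|[set v | c v]|)%N] ==>
     (delta * #|[set v | c v]|%:R <= #|mismatches (phi s) id (on_half_edges false c)|%:R)].

Lemma sum_expN_half (n : nat) : \sum_(i < n) expR (- (i%:R / 2)) <= 3 :> R.
Proof.
have e32 : expR (- (1 / 2)) <= 2 / 3 :> R.
  have := expR_ge1Dx (1 / 2 : R); rewrite expRN => h.
  by rewrite -[2 / 3]invrK lef_pV2 ?posrE ?expR_gt0 //; lra.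
apply: le_trans (_ : \sum_(i < n) (2 / 3) ^+ i <= _).
  apply: ler_sum => i _; have -> : - (i%:R / 2) = i%:R * (- (1 / 2)) :> R by field.
  by rewrite expRM_natl; apply: lerXn2r; rewrite ?nnegrE ?expR_ge0 //; lra.
have := subrX1 (2 / 3 : R) n; have : 0 <= (2 / 3) ^+ n :> R by apply: exprn_ge0; lra.
set S := \sum_(i < n) _; lra.
Qed.

(** For sets of k vertices put L = ln (n / k).  The classes have size at least
    (rho n / k) ^ k, which yields a factor exp (- k L / 2).  Balls of radius k / 6 with the
    parameter L give back exp (k L / 4 + O(k)), and classes and profiles give exp (O(k)).
    What remains is exp (- k L / 4 + C k), which is summable over k and tends to 0 as soon
    as L exceeds a constant L0, that is, for k <= exp (- L0) n. *)
Theorem small_expansion_whp (m D Kp : nat) (rho : R) : 0 < rho ->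
  exists2 eps : R, 0 < eps & forall eta : R, 0 < eta -> exists n0 : nat,
    forall (M : random_pairing R) (phi : {perm half_edge M} -> half_edge M -> half_edge M)
      (Q : nat),
      tame m D rho M -> (n0 <= #|vertex M|)%N ->
      (forall s, law s != 0 -> involutive (phi s)) ->
      (forall g s h, preserves_key (@half_edge_key R M) g ->
         phi (s ^ g)%g (g h) = g (phi s h)) ->
      (forall s, law s != 0 -> (#|[set h | phi s h == h]| <= Q)%N) ->
      Pr (M := M) (fun s => ~~ small_expansion phi eps (1 / 6) Kp Q s) <= eta.
Proof.
move=> rho0.
pose J : R := ((D.+1 * (m * 2)) + Kp)%:R.
(* J bounds the number of profiles by exp (k J), and C is the constant in front of k above. *)
pose C : R := m%:R + 3 * D%:R + J / 2 - ln rho / 2.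
pose L0 : R := 8 * (`|C| + 1).
exists (expR (- L0)); first exact: expR_gt0.
move=> eta eta0.
have [n0 n0P] : exists n0 : nat, forall n, (n0 <= n)%N -> (0 < n)%N -> 3 * expR (- ln n%:R / 8) <= eta.
  pose y := expR (8 * ln (3 / eta)); exists (Num.truncn y).+1 => n yn n0.
  have : y <= n%:R.
    by apply: le_trans (_ : (Num.truncn y).+1%:R <= _); rewrite ?ler_nat // ltW // truncnS_gt.
  rewrite -ler_ln ?posrE ?expR_gt0 ?ltr0n // expRK => h.
  rewrite -ler_pdivlMl // -[leRHS]lnK ?posrE ?mulr_gt0 ?invr_gt0 // ler_expR.
  have -> : 3^-1 * eta = (3 / eta)^-1 by rewrite invf_div mulrC.
  by rewrite lnV ?posrE ?divr_gt0 //; lra.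
exists n0 => M phi Q tm n0n phiK phi_conj fixQ; set n := #|vertex M|; set N := #|half_edge M|.
have N_le : (N <= D * n)%N by apply: card_half_edge tm.
pose size (c : {ffun vertex M -> bool}) := #|[set v | c v]|.
pose bad (c : {ffun vertex M -> bool}) (s : {perm half_edge M}) :=
  #|mismatches (phi s) id (on_half_edges false c)|%:R <= 1 / 6 * (size c)%:R :> R.
pose ok (k : nat) := [&& (0 < k)%N, k%:R <= expR (- L0) * n%:R & (Q <= Kp * k)%N].
apply: le_trans (_ : Pr (fun s => [exists k : 'I_n.+1, ok k &&
    [exists c, (size c == k) && bad c s]]) <= _).
  apply: Pr_le => s _; rewrite negb_forall => /existsP[c]; rewrite negb_imply => /andP[sc h].
  have cn : (size c < n.+1)%N by rewrite ltnS max_card.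
  apply/existsP; exists (Ordinal cn); rewrite [ok _]sc /=.
  by apply/existsP; exists c; rewrite eqxx /= /bad ltW // ltNge.
apply: le_trans (Pr_union _ _) _.
have [n_0|n_pos] := posnP n.
  rewrite big1 ?(ltW eta0) // => k /and3P[k0 _ _].
  by have : (k <= 0)%N by [rewrite -n_0 -ltnS]; rewrite leqNgt k0.
have n0r : 0 < n%:R :> R by rewrite ltr0n.
apply: le_trans (_ : \sum_(k < n.+1) expR (- (k%:R / 2)) * expR (- ln n%:R / 8) <= _); last first.
  rewrite -mulr_suml; apply: le_trans (n0P n n0n n_pos).
  by rewrite ler_wpM2r ?expR_ge0 // sum_expN_half.
rewrite big_mkcond /=; apply: ler_sum => k _; case: ifP => [|_]; last by rewrite mulr_ge0 ?expR_ge0.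
move=> /and3P[k0 kn Qk].
have k0r : 0 < k%:R :> R by rewrite ltr0n.
pose L : R := ln (n%:R / k%:R).
have LL0 : L0 <= L.
  rewrite /L -ler_expR lnK ?posrE ?divr_gt0 // ler_pdivlMr // -ler_pdivlMl ?expR_gt0 //.
  by rewrite -expRN.
have L0_0 : 0 < L0 by rewrite /L0 mulr_gt0 // ltr_wpDl.
have L_0 : 0 <= L by lra.
apply: le_trans (Pr_union _ _) _.
pose key (c : {ffun vertex M -> bool}) : {ffun block M -> 'I_k.+1} :=
  [ffun i => inord #|[set v in fiber (@block_of R M) i | c v]|].
pose g : R := 3 * (1 / 6 * k%:R * L + 2 * N%:R * expR (- L)) + k%:R * J.
pose hh : R := k%:R * (ln rho + L).
have sub_size (c : {ffun vertex M -> bool}) i : (#|[set v in fiber (@block_of R M) i | c v]| <= size c)%N.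
  by apply/subset_leq_card/fintype.subsetP => v; rewrite !inE => /andP[].
apply: le_trans (sum_prob_colourings (key := @block_of R M) (k := key) (g := g) (h := hh)
  _ _ _ _) _.
- move=> c c' /eqP sc /eqP sc' /ffunP E; apply/hclassP => i t.
  have Ei : #|[set v in fiber (@block_of R M) i | c v]| = #|[set v in fiber (@block_of R M) i | c' v]|.
    have /(congr1 (@nat_of_ord _)) := E i; rewrite !ffunE !inordK // ltnS.
      by rewrite -sc'.
    by rewrite -sc.
  have tot (q : {ffun vertex M -> bool}) :
      (#|[set v in fiber (@block_of R M) i | q v]| + #|[set v | (block_of v == i) && (q v == false)]|)%N
      = #|fiber (@block_of R M) i|.
    rewrite -(cardsID [set v | q v] (fiber _ i)).
    by congr (_ + _)%N; apply: eq_card => x; rewrite !inE; case: (q x); rewrite ?andbT ?andbF.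
  case: t; last by apply/eqP; rewrite -(eqn_add2l #|[set v in fiber (@block_of R M) i | c' v]|) tot -Ei tot.
  transitivity #|[set v in fiber (@block_of R M) i | c' v]|.
    by apply: eq_card => v; rewrite !inE eqb_id.
  by rewrite -Ei; apply: eq_card => v; rewrite !inE eqb_id.
- by move=> c; apply: Pr_ge0.
- move=> c /eqP sc; rewrite /g expRD [expR (3 * _)]expRM_natl.
  have -> : expR (1 / 6 * k%:R * L + 2 * N%:R * expR (- L)) =
            ball_bound bool #|half_edge M| (1 / 6 * k%:R) L.
    by rewrite /ball_bound card_bool.
  rewrite /bad sc; apply: Pr_mismatches; [by []|exact: phiK|exact: phi_conj|by []|exact: expR_ge0|].
  move=> s a mus da.
  have am : (#|[set h | a h]| <= D.+1 * k)%N.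
    have -> : (D.+1 * k = D * k + k)%N by rewrite mulSn addnC.
    apply: (@leq_trans (#|[set h | owner h \in [set v | c v]]| + differ (on_half_edges false c) a)).
      rewrite /differ; apply: leq_trans (leq_card_setU _ _).
      apply/subset_leq_card/fintype.subsetP => h; rewrite !inE ffunE.
      by case: (a h); case: (live h); case: (c _).
    apply: leq_add; first by apply: leq_trans (card_owned _ tm) _; rewrite -sc.
    rewrite -(ler_nat R); apply: le_trans da _; lra.
  have [F [p [pP pB]]] :=
    @few_profiles_bool R M (phi s) a _ Q am (fixQ s mus).
  exists F, p; split=> //; apply: le_trans pB _.
  have -> : J = ((D.+1 * (m * 2)) + Kp)%:R by [].
  rewrite -natrM; apply: le_trans (exp2_le_expR _ _); rewrite -natrX ler_nat.
  apply: (@leq_trans ((2 ^ (D.+1 * k)) ^ (m * 2) * 2 ^ (Kp * k))%N); last first.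
    rewrite -expnM -expnD leq_exp2l // mulnDr [(k * Kp)%N]mulnC leq_add2r.
    by rewrite mulnAC mulnC.
  apply: leq_mul; last by rewrite leq_exp2l.
  apply: (@leq_trans ((2 ^ (D.+1 * k)) ^ #|{: block M * bool}|)%N).
    have [->//|K0] := posnP #|{: block M * bool}|.
    by rewrite leq_exp2r // ltn_expl.
  rewrite leq_pexp2l ?expn_gt0 // card_prod card_bool leq_mul //; by case: tm.
- move=> c /eqP sc; rewrite /hh /L; have := exp_le_card_hclass_bool rho0 (tame_ratio tm).
  by move=> /(_ c) /=; rewrite -/(size c) sc; apply.
have keyE : #|{ffun block M -> 'I_k.+1}|%:R <= expR (k%:R * m%:R) :> R.
  rewrite card_ffun card_ord -natrM; apply: le_trans (exp2_le_expR _ _).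
  rewrite -natrX ler_nat expnM.
  apply: (@leq_trans ((2 ^ k) ^ #|block M|)%N).
    have [->//|K0] := posnP #|block M|.
    by rewrite leq_exp2r // ltn_expl.
  by rewrite leq_pexp2l ?expn_gt0 //; case: tm.
apply: le_trans (ler_wpM2r (expR_ge0 _) keyE) _; rewrite -!expRD ler_expR.
have expL : expR (- L) = k%:R / n%:R.
  by rewrite expRN /L lnK ?posrE ?divr_gt0 // invf_div.
have NL : N%:R * expR (- L) <= D%:R * k%:R.
  by rewrite expL mulrA ler_pdivrMr // [leRHS]mulrAC ler_wpM2r // -natrM ler_nat.
have lnE : ln n%:R = L + ln k%:R :> R.
  by rewrite /L ln_div ?posrE // subrK.
have lnk : ln k%:R <= k%:R :> R.
  have := ln_le_linear (t := 1 : R) ltr01 k0r; rewrite ln1; lra.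
have k1 : 1 <= k%:R :> R by rewrite ler1n.
(* Half of k L / 4 pays for C k and leaves exp (- k); the other half gives the decay in n. *)
have CL : C <= L / 8 - 1.
  by have := ler_norm C; move: LL0; rewrite /L0; lra.
have CLk := ler_wpM2l (ltW k0r) CL.
have Lk := ler_wpM2r L_0 k1.
rewrite lnE /g /hh.
have gE : k%:R * m%:R + (3 * (1 / 6 * k%:R * L + 2 * (D%:R * k%:R)) + k%:R * J -
    k%:R * (ln rho + L)) / 2 = k%:R * C - k%:R * L / 4 by rewrite /C; field.
move: CLk gE NL Lk lnk; move: (expR (- L)) (ln k%:R) => eL lk; lra.
Qed.

End SmallSets.

(** * Level sets and Dirichlet energy *)

Section LevelSets.

Variables (R : realType) (V H : finType) (e1 e2 : H -> V) (P : pred H).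
Implicit Types (f g : V -> R) (t : R).

Definition level_cut f t : {set H} := [set h | [&& P h, t < f (e1 h) & f (e2 h) <= t]].

(** The discrete coarea inequality, by induction on the size of the support: subtract
    from f its least positive value. *)
Lemma weighted_sum_le_variation f (w : V -> R) : (forall v, 0 <= f v) ->
  (forall t, 0 <= t -> (exists v, t < f v) ->
     \sum_(v | t < f v) w v <= #|level_cut f t|%:R) ->
  \sum_v w v * f v <= \sum_(h | P h) Num.max 0 (f (e1 h) - f (e2 h)).
Proof.
have [k] := ubnP #|[set v | 0 < f v]|; elim: k f => // k IH f fk f0 cut.
have [v0 v00|f_0] := pickP (fun v => 0 < f v); last first.
  rewrite big1 => [|v _]; first by apply: sumr_ge0 => h _; rewrite le_max lexx.
  by have := f_0 v; rewrite lt0r f0 andbT => /negbFE/eqP ->; rewrite mulr0.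
have [a a0 amin] := @arg_minP _ _ _ v0 (fun v => 0 < f v) f v00.
have a_min v : 0 < f v -> f a <= f v by apply: amin.
pose f' v := Num.max 0 (f v - f a).
have f'E v t : 0 <= t -> (t < f' v) = (t + f a < f v).
  by move=> t0; rewrite /f' lt_max ltNge t0 /= ltrBrDr.
have IHf' : \sum_v w v * f' v <= \sum_(h | P h) Num.max 0 (f' (e1 h) - f' (e2 h)).
  apply: IH.
  - rewrite -ltnS; apply: leq_trans fk; apply: proper_card; apply/fintype.properP; split.
      apply/fintype.subsetP => v; rewrite !inE f'E // add0r; exact: lt_trans.
    by exists a; rewrite !inE // f'E // add0r ltxx.
  - by move=> v; rewrite le_max lexx.
  - move=> t t0 [v]; rewrite f'E // => tv.
    rewrite (eq_bigl (fun v => t + f a < f v)); last by move=> ?; rewrite f'E.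
    apply: le_trans (cut _ _ _) _; first by rewrite addr_ge0.
      by exists v.
    rewrite ler_nat; apply/subset_leq_card/fintype.subsetP => h; rewrite !inE.
    by rewrite f'E // [f' _ <= t]leNgt f'E // -leNgt.
have base : \sum_(v | 0 < f v) w v <= #|level_cut f 0|%:R.
  by apply: cut => //; exists v0.
have -> : \sum_v w v * f v = f a * (\sum_(v | 0 < f v) w v) + \sum_v w v * f' v.
  rewrite mulr_sumr [X in _ = X + _]big_mkcond -big_split /=; apply: eq_bigr => v _.
  rewrite /f'; case: ltP => [v1|v1].
    by rewrite max_r ?subr_ge0 ?a_min // [f a * _]mulrC -mulrDr addrC subrK.
  have -> : f v = 0 by apply/eqP; rewrite eq_le v1 f0.
  by rewrite max_l ?mulr0 ?addr0 // sub0r oppr_le0 ltW.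
have -> : \sum_(h | P h) Num.max 0 (f (e1 h) - f (e2 h)) =
    f a * #|level_cut f 0|%:R + \sum_(h | P h) Num.max 0 (f' (e1 h) - f' (e2 h)).
  rewrite -sum1_card natr_sum mulr_sumr.
  have -> : \sum_(h in level_cut f 0) f a * 1 =
      \sum_(h | P h) if (0 < f (e1 h)) && (f (e2 h) <= 0) then f a else 0.
    rewrite big_mkcond [RHS]big_mkcond; apply: eq_bigr => h _; rewrite inE mulr1.
    by case: (P h).
  rewrite -big_split /=; apply: eq_bigr => h _; rewrite /f'.
  have pos v : (0 < f v) = false -> f v = 0.
    by rewrite lt0r f0 andbT => /negbFE/eqP.
  have maxN0 x : 0 <= x -> Num.max 0 (- x) = 0 :> R by move=> ?; rewrite max_l ?oppr_le0.
  have am := a_min.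
  case E1: (0 < f (e1 h)); case E2: (0 < f (e2 h)); rewrite leNgt E2 /=.
  - have := am _ E1; have := am _ E2; move=> q1 q2.
    rewrite [Num.max 0 (f (e1 h) - f a)]max_r ?subr_ge0 //.
    rewrite [Num.max 0 (f (e2 h) - f a)]max_r ?subr_ge0 //.
    by rewrite add0r; congr (Num.max 0 _); ring.
  - have := am _ E1; rewrite (pos _ E2) subr0 sub0r => q1.
    rewrite [Num.max 0 (- f a)]max_l ?oppr_le0 ?(ltW a0) // subr0.
    rewrite [Num.max 0 (f (e1 h) - f a)]max_r ?subr_ge0 // [Num.max 0 (f _)]max_r ?f0 //.
    by rewrite [Num.max 0 (f (e1 h) - f a)]max_r ?subr_ge0 //; ring.
  - rewrite (pos _ E1) !sub0r [Num.max 0 (- f a)]max_l ?oppr_le0 ?(ltW a0) // sub0r.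
    by rewrite !maxN0 ?add0r // le_max lexx.
  - by rewrite (pos _ E1) (pos _ E2) !subrr add0r.
by apply: lerD => //; rewrite ler_wpM2l // f0.
Qed.

Definition energy f : R := \sum_(h | P h) (f (e1 h) - f (e2 h)) ^+ 2.

Lemma energy_ge0 f : 0 <= energy f.
Proof. by apply: sumr_ge0 => h _; apply: sqr_ge0. Qed.

Lemma mul_le_weighted_squares (x y l : R) : 0 < l -> x * y <= l / 2 * x ^+ 2 + y ^+ 2 / (2 * l).
Proof.
move=> l0; rewrite -subr_ge0.
have -> : l / 2 * x ^+ 2 + y ^+ 2 / (2 * l) - x * y = (l * x - y) ^+ 2 / (2 * l).
  by field; rewrite gt_eqF.
by rewrite divr_ge0 ?sqr_ge0 // mulr_ge0 // ltW.
Qed.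

Lemma sum_fibers_le (e : H -> V) f (D : nat) : (forall v, 0 <= f v) ->
  (forall v, (#|[set h | e h == v]| <= D)%N) ->
  \sum_(h | P h) f (e h) <= D%:R * \sum_v f v.
Proof.
move=> f0 deg; apply: le_trans (_ : \sum_h f (e h) <= _).
  by rewrite [leRHS](bigID P) /= lerDl; apply: sumr_ge0.
rewrite (partition_big e predT) //= mulr_sumr; apply: ler_sum => v _.
rewrite (eq_bigr (fun=> f v)) => [|h /eqP -> //].
rewrite sumr_const -[_ *+ _]mulr_natl ler_wpM2r // ler_nat.
by apply: leq_trans (deg v); apply/subset_leq_card/fintype.subsetP => h; rewrite inE.
Qed.

(** The argument of Cheeger: apply the coarea inequality to f ^ 2, and split its variation
    (f x - f y) (f x + f y) by the weighted arithmetic-geometric mean inequality. *)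
Lemma sum_square_le_energy f (D : nat) (delta : R) : 0 < delta -> (0 < D)%N ->
  (forall v, (#|[set h | e1 h == v]| <= D)%N) ->
  (forall v, (#|[set h | e2 h == v]| <= D)%N) ->
  (forall v, 0 <= f v) ->
  (forall t, 0 <= t -> (exists v, t < f v) ->
     delta * #|[set v | t < f v]|%:R <= #|level_cut f t|%:R) ->
  \sum_v f v ^+ 2 <= 4 * D%:R / delta ^+ 2 * energy f.
Proof.
move=> delta0 D0 deg1 deg2 f0 cut.
have D0r : 0 < D%:R :> R by rewrite ltr0n.
set S := \sum_v _; set E := energy f.
have sq2 t v : 0 <= t -> (t < f v ^+ 2) = (Num.sqrt t < f v).
  by move=> t0; rewrite -{1}(sqr_sqrtr t0) ltr_pXn2r ?nnegrE ?sqrtr_ge0.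
have LS : delta * S <= \sum_(h | P h) Num.max 0 (f (e1 h) ^+ 2 - f (e2 h) ^+ 2).
  rewrite /S mulr_sumr; apply: (@weighted_sum_le_variation (fun v => f v ^+ 2)).
    by move=> v; apply: sqr_ge0.
  move=> t t0 [v tv]; rewrite sumr_const -[_ *+ _]mulr_natr.
  have -> : #|(fun v => t < f v ^+ 2)| = #|[set v | Num.sqrt t < f v]|.
    by apply: eq_card => u; rewrite !inE unfold_in /= sq2.
  apply: le_trans (cut _ (sqrtr_ge0 t) _) _; first by exists v; rewrite -sq2.
  rewrite ler_nat; apply/subset_leq_card/fintype.subsetP => h; rewrite !inE.
  by rewrite sq2 // [_ ^+ 2 <= t]leNgt sq2 // -leNgt.
pose l := 4 * D%:R / delta.
have l0 : 0 < l by rewrite divr_gt0 // mulr_gt0.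
have l2 : 0 < (2 * l)^-1 by rewrite invr_gt0 mulr_gt0.
have up : \sum_(h | P h) Num.max 0 (f (e1 h) ^+ 2 - f (e2 h) ^+ 2) <=
    l / 2 * E + 4 * D%:R * S / (2 * l).
  apply: le_trans (_ : \sum_(h | P h) (l / 2 * (f (e1 h) - f (e2 h)) ^+ 2 +
      (2 * f (e1 h) ^+ 2 + 2 * f (e2 h) ^+ 2) / (2 * l)) <= _).
    apply: ler_sum => h _; set x := f _; set y := f _.
    have x2 := sqr_ge0 x; have y2 := sqr_ge0 y; have xy2 := sqr_ge0 (x - y).
    rewrite ge_max; apply/andP; split.
      by rewrite addr_ge0 // mulr_ge0 ?(ltW l2) //; [rewrite divr_ge0 // ltW|lra].
    have -> : x ^+ 2 - y ^+ 2 = (x - y) * (x + y) by ring.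
    apply: le_trans (mul_le_weighted_squares (x - y) (x + y) l0) _.
    rewrite lerD2l (ler_pM2r l2).
    by rewrite -subr_ge0; apply: le_trans xy2 _; apply: le_of_eq; ring.
  rewrite big_split /= -mulr_sumr lerD2l -mulr_suml (ler_pM2r l2).
  rewrite big_split /= -!mulr_sumr.
  have q0 v : 0 <= f v ^+ 2 by apply: sqr_ge0.
  have := @sum_fibers_le e1 (fun v => f v ^+ 2) D q0 deg1.
  have := @sum_fibers_le e2 (fun v => f v ^+ 2) D q0 deg2.
  rewrite -/S; lra.
have fin : delta * S <= 2 * D%:R / delta * E + delta / 2 * S.
  apply: le_trans LS _; apply: le_trans up _; apply: le_of_eq.
  by rewrite /l; field; rewrite !gt_eqF.
have fin2 : S <= 2 / delta * (2 * D%:R / delta * E).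
  rewrite -ler_pdivrMl ?divr_gt0 // invf_div; lra.
apply: le_trans fin2 _; apply: le_of_eq.
by field; rewrite gt_eqF.
Qed.

(** The truncation of f between u and U has total variation at least beta (U - u), as all
    levels in between cut beta half-edges; the Cauchy-Schwarz inequality turns this into
    energy. *)
Lemma level_gap_le_energy f (u U beta : R) (v0 : V) : 0 < beta -> u <= U -> U <= f v0 ->
  (forall t, u <= t -> t < U -> beta <= #|level_cut f t|%:R) ->
  (beta * (U - u)) ^+ 2 <= #|H|%:R * energy f.
Proof.
move=> beta0; rewrite le_eqVlt => /orP[/eqP -> _ _|uU fv0 cut].
  by rewrite subrr mulr0 expr0n mulr_ge0 // energy_ge0.
have H0 : 0 < #|H|%:R :> R.
  rewrite ltr0n; apply: contraTltn (cut u (lexx u) uU); rewrite leqn0 -ltNge => H0.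
  apply: le_lt_trans beta0; rewrite (_ : _%:R = 0) //; apply/eqP.
  by rewrite pnatr_eq0 -leqn0 -(eqP H0) max_card.
pose g v := Num.max 0 (Num.min (f v) U - u).
have gE t v : 0 <= t -> t < U - u -> (t < g v) = (t + u < f v).
  move=> t0 tU; rewrite /g lt_max ltNge t0 /= ltrBrDr lt_min.
  by rewrite -[t + u < U]ltrBrDr tU andbT.
have g_le v : g v <= U - u.
  by rewrite /g ge_max subr_ge0 ltW //= lerD2r ge_min lexx orbT.
have LS : beta * (U - u) <= \sum_(h | P h) Num.max 0 (g (e1 h) - g (e2 h)).
  have gv0 : g v0 = U - u by rewrite /g min_r // max_r // subr_ge0 ltW.
  (* A weight beta at the single vertex v0 makes the coarea inequality a bound on the variation. *)
  have := @weighted_sum_le_variation g (fun v => if v == v0 then beta else 0).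
  rewrite (bigD1 v0) //= eqxx big1 => [|v /negbTE ->]; last by rewrite mul0r.
  rewrite addr0 gv0; apply => [v|t t0 [v tv]]; first by rewrite le_max lexx.
  have tU : t < U - u by apply: lt_le_trans tv (g_le v).
  apply: le_trans (_ : beta <= _).
    rewrite (bigD1 v0) /=; last by rewrite gv0.
    by rewrite eqxx big1 ?addr0 // => w /andP[_ /negbTE ->].
  apply: le_trans (cut (t + u) _ _) _; first by rewrite lerDr.
    by rewrite -ltrBrDr.
  rewrite ler_nat; apply/subset_leq_card/fintype.subsetP => h; rewrite !inE.
  by rewrite gE // [g _ <= t]leNgt gE // -leNgt.
pose b := beta * (U - u); have b0 : 0 < b by rewrite mulr_gt0 // subr_gt0.
pose l := #|H|%:R / b; have l0 : 0 < l by rewrite divr_gt0.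
have l2 : 0 < (2 * l)^-1 by rewrite invr_gt0 mulr_gt0.
have up : \sum_(h | P h) Num.max 0 (g (e1 h) - g (e2 h)) <= l / 2 * energy f + #|H|%:R / (2 * l).
  apply: le_trans (_ : \sum_(h | P h) (l / 2 * (f (e1 h) - f (e2 h)) ^+ 2 + 1 / (2 * l)) <= _).
    apply: ler_sum => h _; set x := f _; set y := f _.
    apply: le_trans (_ : `|x - y| * 1 <= _); last first.
      by have := mul_le_weighted_squares `|x - y| 1 l0; rewrite expr1n real_normK // num_real.
    rewrite mulr1 ge_max normr_ge0 /= /g -/x -/y.
    by case: (lerP x U) => ?; case: (lerP y U) => ?; rewrite /Num.max;
       case: ltP => ?; case: ltP => ?; have := ler_norm (x - y); have := normr_ge0 (x - y); lra.
  rewrite big_split /= -mulr_sumr lerD2l sumr_const -[_ *+ _]mulr_natl mul1r.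
  by rewrite (ler_pM2r l2) ler_nat max_card.
have fin : b <= #|H|%:R / b / 2 * energy f + b / 2.
  apply: le_trans LS _; apply: le_trans up _; apply: le_of_eq.
  by rewrite /l; field; rewrite !gt_eqF.
rewrite -/b expr2 -ler_pdivlMr //; have -> : #|H|%:R * energy f / b = 2 * (#|H|%:R / b / 2 * energy f).
  by field; rewrite gt_eqF.
lra.
Qed.

End LevelSets.

(** * Quantiles of functions on expanding graphs *)

Definition cutset (V H : finType) (src : H -> V) (s : H -> H) (P : pred H) (A : V -> bool) :
    {set H} :=
  [set h | [&& P h, A (src h) & ~~ A (src (s h))]].

Lemma bichromatic_le_cutset (V H : finType) (src : H -> V) (s : H -> H) (P : pred H)
    (A : V -> bool) : involutive s -> (forall h, P (s h) = P h) ->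
  (#|[set h | P h && (A (src (s h)) != A (src h))]| <= 2 * #|cutset src s P A|)%N.
Proof.
move=> sK Ps.
rewrite mul2n -addnn -{2}(card_imset (cutset src s P A) (inv_inj sK)).
apply: leq_trans (leq_card_setU _ _); apply/subset_leq_card/fintype.subsetP => h.
rewrite !inE => /andP[Ph AA]; case Ah: (A (src h)) in AA *; rewrite Ph /=.
  by move: AA; case: (A _).
apply/imsetP; exists (s h); rewrite ?sK // inE sK Ps Ph Ah /=.
by move: AA; case: (A _).
Qed.

(** What random matchings provide with high probability; everything deduced from it is
    deterministic.  P selects the half-edges whose cuts are counted. *)
Record expanding (R : realType) (V I H : finType) (comm : V -> I) (src : H -> V)
    (s : H -> H) (P : pred H) (D : nat) (eps dL dS : R) : Prop := Expanding {
  expanding_inv : involutive s;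
  expanding_stable : forall h, P (s h) = P h;
  expanding_degree : forall v, (#|[set h | src h == v]| <= D)%N;
  expanding_D : (0 < D)%N;
  expanding_eps : 0 < eps;
  expanding_eps_half : eps < 1 / 2;
  expanding_dL : 0 < dL;
  expanding_dS : 0 < dS;
  expanding_fiber : forall i, (0 < #|fiber comm i|)%N;
  expanding_large : forall c : {ffun V -> bool * bool},
    (exists i, forall t,
       #|[set v in fiber comm i | c v == t]|%:R <= (1 - eps) * #|fiber comm i|%:R) ->
    dL * #|V|%:R <= #|[set h | P h && (c (src (s h)) != swap (c (src h)))]|%:R;
  expanding_small : forall c : {ffun V -> bool},
    #|[set v | c v]|%:R <= eps * #|V|%:R ->
    dS * #|[set v | c v]|%:R <= #|cutset src s P c|%:R
}.

Section ExpandingGraph.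

Variables (R : realType) (V I H : finType) (comm : V -> I) (src : H -> V) (s : H -> H).
Variables (P : pred H) (D : nat) (eps dL dS : R).
Hypothesis G : expanding comm src s P D eps dL dS.
Let sK := expanding_inv G.
Let Ps := expanding_stable G.
Let degree := expanding_degree G.
Let D0 := expanding_D G.
Let eps0 := expanding_eps G.
Let eps2 := expanding_eps_half G.
Let dL0 := expanding_dL G.
Let dS0 := expanding_dS G.
Let fiber_gt0 := expanding_fiber G.
Let large := expanding_large G.
Let small := expanding_small G.

Local Notation cutset := (cutset src s P).

Local Notation E := (energy src (src \o s) P).

(** An eps-quantile of g in community i.  Opposites of quantiles of - g play the role of
    the upper quantiles of g. *)
Definition quantile (g : V -> R) (i : I) (u : R) : Prop :=
  #|[set v in fiber comm i | g v < u]|%:R <= eps * #|fiber comm i|%:R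
  /\ eps * #|fiber comm i|%:R < #|[set v in fiber comm i | g v <= u]|%:R.

Lemma quantile_exists (g : V -> R) (i : I) : exists u, quantile g i u.
Proof.
have n0 : 0 < #|fiber comm i|%:R :> R by rewrite ltr0n.
pose big v := (v \in fiber comm i) &&
  (eps * #|fiber comm i|%:R < #|[set w in fiber comm i | g w <= g v]|%:R).
have [v1 v1i] : exists v, v \in fiber comm i by apply/card_gt0P.
have [vM vMi vMmax] := @Order.TotalTheory.arg_maxP _ _ _ v1 (fun v => v \in fiber comm i) g v1i.
have bigM : big vM.
  rewrite /big vMi /=; have -> : [set w in fiber comm i | g w <= g vM] = fiber comm i.
    by apply/setP => w; rewrite inE; case: (boolP (w \in _)) => //= wi; apply: vMmax.
  have e1 : eps < 1 by have := eps2; lra.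
  by rewrite -subr_gt0 -[X in X - _]mul1r -mulrBl mulr_gt0 // subr_gt0.
have [v /andP[vi vbig] vmin] := @Order.TotalTheory.arg_minP _ _ _ vM big g bigM.
exists (g v); split=> //; rewrite leNgt; apply/negP => many.
have [w0 w0P] : exists w, w \in [set v0 in fiber comm i | g v0 < g v].
  apply/card_gt0P; rewrite -(ltr_nat R); apply: le_lt_trans many.
  by rewrite mulr_ge0 // ltW.
have [w wP wmax] := @Order.TotalTheory.arg_maxP _ _ _ w0
  (fun w => w \in [set v0 in fiber comm i | g v0 < g v]) g w0P.
move: wP; rewrite inE => /andP[wi wv].
suff /vmin : big w by rewrite leNgt wv.
rewrite /big wi /=; apply: lt_le_trans many _; rewrite ler_nat.
apply/subset_leq_card/fintype.subsetP => x xP; have := wmax x xP.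
by move: xP; rewrite !inE => /andP[-> _].
Qed.

(** Every level between a lower and an upper quantile splits the community into
    two substantial parts, hence cuts linearly many half-edges. *)
Lemma quantile_gap (g : V -> R) (i : I) (u U : R) :
  quantile g i u -> quantile (fun v => - g v) i (- U) ->
  u <= U /\ #|V|%:R * (U - u) ^+ 2 <= 4 * D%:R / dL ^+ 2 * E g.
Proof.
move=> [ulow uhigh] [].
have -> : [set v in fiber comm i | - g v < - U] = [set v in fiber comm i | U < g v].
  by apply/setP => v; rewrite !inE ltrN2.
have -> : [set v in fiber comm i | - g v <= - U] = [set v in fiber comm i | U <= g v].
  by apply/setP => v; rewrite !inE lerN2.
move=> Ulow Uhigh; have e0 := eps0; have e2 := eps2.
have n0 : 0 < #|fiber comm i|%:R :> R by rewrite ltr0n.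
have tot (t : R) : (#|[set v in fiber comm i | (t < g v)%R]| + #|[set v in fiber comm i | (g v <= t)%R]|)%N
    = #|fiber comm i|.
  rewrite -(cardsID [set v | t < g v] (fiber comm i)); congr (_ + _)%N; apply: eq_card => v.
    by rewrite !inE.
  by rewrite !inE -leNgt andbC.
have uU : u <= U.
  rewrite leNgt; apply/negP => Uu.
  have : #|[set v in fiber comm i | g v <= U]|%:R <= eps * #|fiber comm i|%:R.
    apply: le_trans ulow; rewrite ler_nat; apply/subset_leq_card/fintype.subsetP => v.
    by rewrite !inE => /andP[-> /le_lt_trans/(_ Uu)].
  have := congr1 (fun k => k%:R : R) (tot U); rewrite natrD; nra.
split=> //.
have [v0 v0P] : exists v, v \in [set v in fiber comm i | U <= g v].
  apply/card_gt0P; rewrite -(ltr_nat R); apply: le_lt_trans Uhigh.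
  by rewrite mulr_ge0 // ltW.
have Uv0 : U <= g v0 by move: v0P; rewrite inE => /andP[].
have V0 : 0 < #|V|%:R :> R by rewrite ltr0n; apply/card_gt0P; exists v0.
have beta0 : 0 < dL * #|V|%:R / 2 by rewrite divr_gt0 // mulr_gt0.
have cut t : u <= t -> t < U -> dL * #|V|%:R / 2 <= #|level_cut src (src \o s) P g t|%:R.
  move=> ut tU; pose c : {ffun V -> bool * bool} := [ffun v => (t < g v, t < g v)].
  have hi : #|[set v in fiber comm i | U <= g v]|%:R <= #|[set v in fiber comm i | t < g v]|%:R :> R.
    rewrite ler_nat; apply/subset_leq_card/fintype.subsetP => v.
    by rewrite !inE => /andP[-> /(lt_le_trans tU)].
  have lo : #|[set v in fiber comm i | g v <= u]|%:R <= #|[set v in fiber comm i | g v <= t]|%:R :> R.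
    rewrite ler_nat; apply/subset_leq_card/fintype.subsetP => v.
    by rewrite !inE => /andP[-> /le_trans/(_ ut)].
  have total := congr1 (fun k => k%:R : R) (tot t); rewrite natrD in total.
  have cP : dL * #|V|%:R <= #|[set h | P h && (c (src (s h)) != swap (c (src h)))]|%:R.
    apply: large; exists i => -[b1 b2].
    have [->|bb] := eqVneq b2 b1; last first.
      have -> : [set v in fiber comm i | c v == (b1, b2)] = finset.set0.
        apply/setP => v; rewrite !inE ffunE xpair_eqE.
        by case: b1 b2 bb => -[] //; case: (t < g v); rewrite ?andbF.
      by rewrite cards0 mulr_ge0 ?subr_ge0 //; lra.
    case: b1 => {b2}; last first.
      have -> : [set v in fiber comm i | c v == (false, false)] = [set v in fiber comm i | g v <= t].
        by apply/setP => v; rewrite !inE ffunE xpair_eqE andbb eqbF_neg -leNgt.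
      lra.
    have -> : [set v in fiber comm i | c v == (true, true)] = [set v in fiber comm i | t < g v].
      by apply/setP => v; rewrite !inE ffunE xpair_eqE andbb eqb_id.
    lra.
  rewrite ler_pdivrMr //; apply: le_trans cP _.
  have -> : [set h | P h && (c (src (s h)) != swap (c (src h)))] =
            [set h | P h && ((t < g (src (s h))) != (t < g (src h)))].
    by apply/setP => h; rewrite !inE !ffunE xpair_eqE andbb.
  rewrite -natrM ler_nat mulnC; apply: leq_trans (@bichromatic_le_cutset _ _ src s P (fun v => t < g v) sK Ps) _.
  rewrite leq_mul2l /=; apply/subset_leq_card/fintype.subsetP => h.
  by rewrite !inE /= -leNgt.
have := level_gap_le_energy beta0 uU Uv0 cut.
have N_le : #|H|%:R <= D%:R * #|V|%:R :> R.
  have := @sum_fibers_le R V H predT src (fun=> 1) D (fun=> ler01) degree.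
  by rewrite !sumr_const.
move=> gap.
have : (dL * #|V|%:R / 2 * (U - u)) ^+ 2 <= D%:R * #|V|%:R * E g.
  by apply: le_trans gap _; rewrite ler_wpM2r // energy_ge0.
have -> : (dL * #|V|%:R / 2 * (U - u)) ^+ 2
        = #|V|%:R * (dL ^+ 2 / 4) * (#|V|%:R * (U - u) ^+ 2) by field.
have -> : D%:R * #|V|%:R * E g = #|V|%:R * (dL ^+ 2 / 4) * (4 * D%:R / dL ^+ 2 * E g).
  by field; rewrite gt_eqF.
by rewrite ler_pM2l // mulr_gt0 // divr_gt0 // exprn_gt0.
Qed.

(** All level sets of g above a are small, so they expand and
    [sum_square_le_energy] applies. *)
Lemma tail_le_energy (g : V -> R) (a : R) :
  #|[set v | a < g v]|%:R <= eps * #|V|%:R ->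
  \sum_v Num.max 0 (g v - a) ^+ 2 <= 4 * D%:R / dS ^+ 2 * E g.
Proof.
move=> few; pose f v := Num.max 0 (g v - a).
have fE v t : 0 <= t -> (t < f v) = (t + a < g v).
  by move=> t0; rewrite /f lt_max ltNge t0 /= ltrBrDr.
apply: le_trans (_ : 4 * D%:R / dS ^+ 2 * E f <= _).
  apply: sum_square_le_energy => //.
  - move=> v; rewrite -(card_imset _ (inv_inj sK)); apply: leq_trans (degree v).
    by apply/subset_leq_card/fintype.subsetP => _ /imsetP[h + ->]; rewrite !inE.
  - by move=> v; rewrite le_max lexx.
  - move=> t t0 _; pose c : {ffun V -> bool} := [ffun v => t < f v].
    have cE : [set v | t < f v] = [set v | c v] by apply/setP => v; rewrite !inE ffunE.
    rewrite cE; apply: le_trans (small _) _.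
      rewrite -cE; apply: le_trans few; rewrite ler_nat.
      apply/subset_leq_card/fintype.subsetP => v; rewrite !inE fE //.
      by apply: le_lt_trans; rewrite lerDr.
    rewrite ler_nat; apply/subset_leq_card/fintype.subsetP => h.
    by rewrite !inE !ffunE -leNgt.
rewrite ler_wpM2l //; first by rewrite divr_ge0 ?sqr_ge0 // mulr_ge0.
apply: ler_sum => h _; rewrite /f /=; set x := g _; set y := g _.
rewrite -[leLHS]real_normK ?num_real // -[leRHS]real_normK ?num_real //.
apply: lerXn2r; rewrite ?nnegrE ?normr_ge0 //.
rewrite /Num.max; case: ltP => ?; case: ltP => ?; rewrite ler_norml; apply/andP; split;
  have := ler_norm (x - y); have := ler_norm (y - x); rewrite (distrC y x); lra.
Qed.

(** Take a such that all lower quantiles are at least - a and all upper ones at most a.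
    The parts of g above a and below - a are bounded by their energy, the rest by a.  By
    [quantile_gap] upper quantiles are close to lower ones, so a ^ 2 is bounded by the
    energy and the squares of the u i. *)
Lemma sum_square_le_quantiles (g : V -> R) (u : I -> R) :
  (forall i, quantile g i (u i)) ->
  \sum_v g v ^+ 2 <= (24 * D%:R / dS ^+ 2 + 24 * #|I|%:R * D%:R / dL ^+ 2 + 6)
     * (E g + #|V|%:R * \sum_i u i ^+ 2).
Proof.
move=> qu.
have E0 : 0 <= E g by apply: energy_ge0.
have [w wP] : exists w : I -> R, forall i, quantile (fun v => - g v) i (- w i).
  suff /boolp.choice[w wP] : forall i, exists w, quantile (fun v => - g v) i (- w) by exists w.
  by move=> i; have [x xP] := quantile_exists (fun v => - g v) i; exists (- x); rewrite opprK.
pose S := \sum_i (2 * u i ^+ 2 + 2 * (w i - u i) ^+ 2).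
have term0 i : 0 <= 2 * u i ^+ 2 + 2 * (w i - u i) ^+ 2.
  by have := sqr_ge0 (u i); have := sqr_ge0 (w i - u i); lra.
have S0 : 0 <= S by apply: sumr_ge0.
pose a := Num.sqrt S.
have a0 : 0 <= a by apply: sqrtr_ge0.
have termS i : 2 * u i ^+ 2 + 2 * (w i - u i) ^+ 2 <= S.
  by rewrite /S (bigD1 i) //= lerDl sumr_ge0.
have wa i : w i <= a.
  apply: le_sqrt_sqr; apply: le_trans (termS i).
  rewrite -subr_ge0; have -> : 2 * u i ^+ 2 + 2 * (w i - u i) ^+ 2 - w i ^+ 2
    = (2 * u i - w i) ^+ 2 by ring.
  exact: sqr_ge0.
have ua i : - a <= u i.
  rewrite lerNl; apply: le_sqrt_sqr; apply: le_trans (termS i); rewrite sqrrN.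
  by have := sqr_ge0 (u i); have := sqr_ge0 (w i - u i); lra.
have tail (f : V -> R) : (forall i, #|[set v in fiber comm i | a < f v]|%:R
    <= eps * #|fiber comm i|%:R) -> #|[set v | a < f v]|%:R <= eps * #|V|%:R.
  move=> few; rewrite -(sum_card_fiber comm R) mulr_sumr.
  rewrite -sum1_card (partition_big comm predT) //= natr_sum; apply: ler_sum => i _.
  apply: le_trans (few i); rewrite sum1_card ler_nat; apply/subset_leq_card/fintype.subsetP => v.
  by rewrite unfold_in /= !inE andbC.
have up := @tail_le_energy g a (tail _ _).
have down := @tail_le_energy (fun v => - g v) a (tail _ _).
have {}up : \sum_v Num.max 0 (g v - a) ^+ 2 <= 4 * D%:R / dS ^+ 2 * E g.
  apply: up => i; have [h _] := wP i; apply: le_trans h; rewrite ler_nat.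
  apply/subset_leq_card/fintype.subsetP => v; rewrite !inE ltrN2 => /andP[-> /=].
  exact: le_lt_trans.
have {}down : \sum_v Num.max 0 (- g v - a) ^+ 2 <= 4 * D%:R / dS ^+ 2 * E g.
  have -> : E g = E (fun v => - g v).
    by apply: eq_bigr => h _; rewrite -opprD sqrrN.
  apply: down => i; have [h _] := qu i; apply: le_trans h; rewrite ler_nat.
  apply/subset_leq_card/fintype.subsetP => v; rewrite !inE => /andP[-> /=]; rewrite ltrNr => h.
  exact: lt_le_trans (ua i).
have Sn : #|V|%:R * S <= 2 * (#|V|%:R * \sum_i u i ^+ 2) + #|I|%:R * (8 * D%:R / dL ^+ 2 * E g).
  set X := 8 * D%:R / dL ^+ 2 * E g.
  rewrite /S big_split /= -!mulr_sumr mulrDr mulrCA lerD2l mulrCA !mulr_sumr.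
  apply: le_trans (_ : \sum_(i : I) X <= _); last by rewrite sumr_const mulr_natl.
  apply: ler_sum => i _.
  have [_] := quantile_gap (qu i) (wP i).
  have -> : X = 2 * (4 * D%:R / dL ^+ 2 * E g) by rewrite /X; ring.
  lra.
have point v : g v ^+ 2 <= 3 * Num.max 0 (g v - a) ^+ 2 + 3 * Num.max 0 (- g v - a) ^+ 2 + 3 * S.
  have aS : a ^+ 2 = S by rewrite sqr_sqrtr.
  rewrite -aS /Num.max.
  have := sqr_ge0 (g v - 2 * a); have := sqr_ge0 (g v + 2 * a).
  have := sqr_ge0 (g v - a); have := sqr_ge0 (- g v - a); have := sqr_ge0 a.
  case: ltP => [ga|ga]; case: ltP => [ga'|ga']; try lra.
  have : 0 <= (a - g v) * (a + g v) by apply: mulr_ge0; lra.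
  lra.
have : \sum_v g v ^+ 2 <= 3 * (4 * D%:R / dS ^+ 2 * E g) + 3 * (4 * D%:R / dS ^+ 2 * E g)
    + 3 * (#|V|%:R * S).
  apply: le_trans (ler_sum _ (fun v _ => point v)) _.
  rewrite big_split /=; have -> : \sum_(v : V) 3 * S = 3 * (#|V|%:R * S).
    by rewrite sumr_const -[LHS]mulr_natl mulrCA.
  by rewrite lerD2r big_split /= lerD // -mulr_sumr ler_wpM2l.
have c1 : 0 <= D%:R / dS ^+ 2 by rewrite divr_ge0 ?sqr_ge0.
have c2 : 0 <= #|I|%:R * (D%:R / dL ^+ 2) by rewrite mulr_ge0 // divr_ge0 ?sqr_ge0.
have u0 : 0 <= #|V|%:R * \sum_i u i ^+ 2.
  by rewrite mulr_ge0 // sumr_ge0 // => i _; apply: sqr_ge0.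
move: Sn; set U := #|V|%:R * \sum_i _.
rewrite -!mulrA; move: c1 c2; rewrite -/U in u0 *.
set x := D%:R / dS ^+ 2; set y := D%:R / dL ^+ 2.
move=> c1 c2 Sn h.
have := mulr_ge0 c1 u0; have := mulr_ge0 c2 u0; have := mulr_ge0 c1 E0.
move: h Sn; rewrite ![D%:R * (_ * E g)]mulrA -/x -/y.
move: (#|V|%:R * S) (#|I|%:R) E0 => nS i E0; nra.
Qed.

(** This keeps the eigenvalues away from - 1.  The positive parts of f and - f form a
    function F on the double cover V * bool, whose energy is at most twice the signless
    energy of f, so it suffices that the level sets of F expand.  At level t let
    c v = (t < f v, t < - f v), and let A be the set where c is not (false, false).  If A
    is small, it expands as a small set.  If in some community no colour of c dominates,
    there are linearly many mismatches.  Otherwise some community is almost entirely of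
    one colour u other than (false, false); as u cannot be (true, true), it differs from
    swap u, and all half-edges internal to this community, except those at the few
    vertices coloured otherwise, are mismatched. *)
Lemma sum_square_le_signless_energy (f : V -> R) (kap dD : R) :
  (forall i, kap * #|V|%:R <=
     #|[set h | [&& P h, comm (src h) == i & comm (src (s h)) == i]]|%:R) ->
  eps <= kap / (4 * D%:R) -> 0 < dD -> dD <= dS -> dD <= dL / 2 -> dD <= kap / 4 ->
  \sum_v f v ^+ 2 <= 8 * D%:R / dD ^+ 2 * \sum_(h | P h) (f (src h) + f (src (s h))) ^+ 2.
Proof.
move=> mono epskap dD0 dDS dDL dDk; have e0 := eps0.
pose F (p : V * bool) : R := Num.max 0 (if p.2 then f p.1 else - f p.1).
pose E1 (q : H * bool) := (src q.1, q.2).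
pose E2 (q : H * bool) := (src (s q.1), ~~ q.2).
pose P' (q : H * bool) := P q.1.
have F0 p : 0 <= F p by rewrite le_max lexx.
have Fpos v b t : 0 <= t -> (t < F (v, b)) = (t < if b then f v else - f v).
  by move=> t0; rewrite /F lt_max ltNge t0.
have sumF : \sum_p F p ^+ 2 = \sum_v f v ^+ 2.
  rewrite -(pair_big predT predT (fun v b => F (v, b) ^+ 2)) /=; apply: eq_bigr => v _.
  rewrite big_bool /F /= /Num.max; case: ltP => ?; case: ltP => ?; rewrite ?sqrrN ?expr0n /=; try lra.
  have -> : f v = 0 by apply/eqP; rewrite eq_le; apply/andP; split; lra.
  by rewrite expr0n addr0.
have energyF : energy E1 E2 P' F <= 2 * \sum_(h | P h) (f (src h) + f (src (s h))) ^+ 2.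
  have -> : energy E1 E2 P' F = \sum_(h | P h) \sum_b (F (E1 (h, b)) - F (E2 (h, b))) ^+ 2.
    by rewrite pair_big /=; apply: eq_big => [[h b]|[h b] _] //=; rewrite andbT.
  rewrite mulr_sumr; apply: ler_sum => h _; rewrite big_bool /F /=.
  set x := f _; set y := f _.
  have lip (b : bool) : (Num.max 0 (if b then x else - x) - Num.max 0 (if ~~ b then y else - y)) ^+ 2
      <= (x + y) ^+ 2.
    rewrite -[leLHS]real_normK ?num_real // -[leRHS]real_normK ?num_real //.
    apply: lerXn2r; rewrite ?nnegrE ?normr_ge0 // ler_norml.
    have n1 := ler_norm (x + y); have n2 := ler_norm (- (x + y)); rewrite normrN in n2.
    by case: b => /=; rewrite /Num.max; case: ltP => ?; case: ltP => ?; apply/andP; split; lra.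
  by have := lip true; have := lip false => /=; lra.
have degE1 v : (#|[set q | E1 q == v]| <= D)%N.
  apply: leq_trans (degree v.1); rewrite -(card_imset _ (_ : injective (fun h : H => (h, v.2)))).
    apply/subset_leq_card/fintype.subsetP => -[h b]; rewrite inE => /eqP <-.
    by apply: imset_f; rewrite inE.
  by move=> h h' [].
have degE2 v : (#|[set q | E2 q == v]| <= D)%N.
  apply: leq_trans (degree v.1); rewrite -(card_imset _ (_ : injective (fun h : H => (s h, ~~ v.2)))).
    apply/subset_leq_card/fintype.subsetP => -[h b]; rewrite inE => /eqP <-.
    by apply/imsetP; exists (s h); rewrite ?inE //= sK negbK.
  by move=> h h' [] /(inv_inj sK).
have cut t : 0 <= t -> (exists p, t < F p) ->
    dD * #|[set p | t < F p]|%:R <= #|level_cut E1 E2 P' F t|%:R.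
  move=> t0 _; pose c : {ffun V -> bool * bool} := [ffun v => (t < F (v, true), t < F (v, false))].
  have cE v : c v = (t < f v, t < - f v) by rewrite ffunE !Fpos.
  pose A : {ffun V -> bool} := [ffun v => c v != (false, false)].
  have AE v : A v = (t < f v) || (t < - f v) by rewrite ffunE cE; case: (t < f v); case: (t < - f v).
  have cardA : (#|[set p | (t < F p)%R]| <= #|[set v | A v]|)%N.
    have inj : {in [set p | t < F p] &, injective (fun p => p.1)}.
      move=> [v b] [w b']; rewrite !inE !Fpos //= => h1 h2 vw; move: h1 h2; rewrite vw.
      by case: b; case: b' => //= h1 h2; exfalso; lra.
    rewrite -(card_in_imset inj); apply/subset_leq_card/fintype.subsetP => _ /imsetP[[v b] + ->].
    by rewrite !inE AE Fpos //=; case: b => ->; rewrite ?orbT.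
  apply: le_trans (_ : dD * #|[set v | A v]|%:R <= _); first by rewrite ler_pM2l // ler_nat.
  have misP : (#|[set h | P h && (c (src (s h)) != swap (c (src h)))]|
      <= 2 * #|level_cut E1 E2 P' F t|)%N.
    pose flip (q : H * bool) := (s q.1, ~~ q.2).
    have flipK : involutive flip by case=> h b; rewrite /flip /= sK negbK.
    rewrite mul2n -addnn -{2}(card_imset (level_cut E1 E2 P' F t) (inv_inj flipK)).
    apply: leq_trans (leq_card_setU _ _).
    have inj1 : {in [set h | P h && (c (src (s h)) != swap (c (src h)))] &, injective
        (fun h => (h, (t < f (src h)) != (t < - f (src (s h)))))}.
      by move=> h h' _ _ [].
    rewrite -(card_in_imset inj1); apply/subset_leq_card/fintype.subsetP => _ /imsetP[h + ->].
    rewrite inE !cE /swap /= xpair_eqE => /andP[Ph].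
    set x := f (src h); set y := f (src (s h)).
    rewrite inE; set b := (_ != _) => mis.
    have flipin (q : H * bool) : flip q \in level_cut E1 E2 P' F t ->
        q \in [set flip x | x in level_cut E1 E2 P' F t].
      by move=> qi; rewrite -[q]flipK; apply: imset_f.
    have lev h0 b0 : (h0, b0) \in level_cut E1 E2 P' F t = [&& P h0, t < (if b0 then f (src h0) else - f (src h0))
        & ~~ (t < (if ~~ b0 then f (src (s h0)) else - f (src (s h0))))].
      by rewrite inE /P' /E1 /E2 /= leNgt !Fpos.
    have [c1|c1] := boolP ((h, b) \in level_cut E1 E2 P' F t); first by [].
    apply: flipin; move: c1; rewrite !lev /= negbK Ps Ph sK -/x -/y /=.
    move: mis; rewrite /b -/x -/y.
    have nx : ~~ ((t < x) && (t < - x)) by apply/negP => /andP[]; lra.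
    have ny : ~~ ((t < y) && (t < - y)) by apply/negP => /andP[]; lra.
    rewrite !(fun_if (fun z => t < z)).
    by move: nx ny; case: (t < x); case: (t < y); case: (t < - x); case: (t < - y).
  have large_case : dL * #|V|%:R <= #|[set h | P h && (c (src (s h)) != swap (c (src h)))]|%:R ->
      dD * #|[set v | A v]|%:R <= #|level_cut E1 E2 P' F t|%:R.
    move=> mis; have : dL * #|V|%:R <= 2 * #|level_cut E1 E2 P' F t|%:R.
      by apply: le_trans mis _; rewrite -natrM ler_nat.
    have : dD * #|[set v | A v]|%:R <= dL / 2 * #|V|%:R.
      by apply: ler_pM; rewrite ?(ltW dD0) // ler_nat max_card.
    lra.
  have [few|many] := leP #|[set v | A v]|%:R (eps * #|V|%:R).
    apply: le_trans (_ : dS * #|[set v | A v]|%:R <= _); first by rewrite ler_wpM2r.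
    apply: le_trans (small few) _; rewrite ler_nat.
    have inj1 : injective (fun h => (h, t < f (src h))) by move=> h h' [].
    rewrite -(card_imset _ inj1); apply/subset_leq_card/fintype.subsetP => _ /imsetP[h + ->].
    rewrite !inE /P' /E1 /E2 /= !AE leNgt !Fpos // => /and3P[-> + +].
    rewrite !(fun_if (fun z => t < z)); case: (t < f (src h)); case: (t < - f (src h));
    by case: (t < f (src (s h))); case: (t < - f (src (s h))).
  have [sp|nsp] := boolp.EM (exists i, forall u, #|[set v in fiber comm i | c v == u]|%:R
      <= (1 - eps) * #|fiber comm i|%:R); first by apply: large_case; apply: large.
  have dom i : exists u, (1 - eps) * #|fiber comm i|%:R < #|[set v in fiber comm i | c v == u]|%:R.
    apply: boolp.contrapT => nu; apply: nsp; exists i => u; rewrite leNgt; apply/negP => h.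
    by apply: nu; exists u.
  have compl i u : (#|[set v in fiber comm i | c v == u]| + #|[set v in fiber comm i | c v != u]|)%N
      = #|fiber comm i|.
    rewrite -(cardsID [set v | c v == u] (fiber comm i)); congr (_ + _)%N; apply: eq_card => v.
      by rewrite !inE.
    by rewrite !inE andbC.
  have [i [u ut udom]] : exists i, exists2 u, u != (false, false) &
      (1 - eps) * #|fiber comm i|%:R < #|[set v in fiber comm i | c v == u]|%:R.
    apply: boolp.contrapT => none; move: many; rewrite ltNge => /negP; apply.
    rewrite -(sum_card_fiber comm R) mulr_sumr -sum1_card (partition_big comm predT) //= natr_sum; apply: ler_sum => i _.
    have [u udom] := dom i; have u0 : u = (false, false).
      by apply/eqP/negPn/negP => u0; apply: none; exists i, u.
    rewrite sum1_card; have := congr1 (fun k => k%:R : R) (compl i u); rewrite natrD => tot.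
    apply: le_trans (_ : #|[set v in fiber comm i | c v != u]|%:R <= _); last by lra.
    rewrite ler_nat; apply/subset_leq_card/fintype.subsetP => v.
    by rewrite unfold_in /= !inE ffunE u0 andbC.
  have utt : u != (true, true).
    have [v] : exists v, v \in [set v in fiber comm i | c v == u].
      apply/card_gt0P; rewrite -(ltr_nat R); apply: le_lt_trans udom.
      by rewrite mulr_ge0 // subr_ge0; have := eps2; lra.
    rewrite inE => /andP[_ /eqP <-]; rewrite cE xpair_eqE !eqb_id.
    by apply/negP => /andP[]; lra.
  (* X is the set of exceptional vertices of the community. *)
  pose X := [set v in fiber comm i | c v != u].
  have X_le : #|X|%:R <= eps * #|V|%:R :> R.
    have := congr1 (fun k => k%:R : R) (compl i u); rewrite natrD -/X => tot.
    apply: le_trans (_ : eps * #|fiber comm i|%:R <= _); first by lra.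
    by rewrite ler_wpM2l ?(ltW e0) // ler_nat max_card.
  have mis_ge : (#|[set h | [&& P h, comm (src h) == i & comm (src (s h)) == i]]| <=
      #|[set h | P h && (c (src (s h)) != swap (c (src h)))]| + 2 * (D * #|X|))%N.
    pose Y := [set h | src h \in X].
    have YX : (#|Y| <= D * #|X|)%N by apply: card_preim_le.
    apply: (@leq_trans (#|[set h | P h && (c (src (s h)) != swap (c (src h)))]| + (#|Y| + #|s @: Y|))); last first.
      by rewrite leq_add2l mul2n -addnn card_imset; [rewrite leq_add|exact: inv_inj].
    apply: leq_trans (leq_add (leqnn _) (leq_card_setU _ _)).
    apply: leq_trans (leq_card_setU _ _); apply/subset_leq_card/fintype.subsetP => h.
    rewrite inE => /and3P[Ph hi shi]; rewrite !finset.in_setU.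
    have [hX|hX] := boolP (src h \in X); first by rewrite [h \in Y]inE hX !orbT.
    have [shX|shX] := boolP (src (s h) \in X).
      by apply/orP; right; apply/orP; right; apply/imsetP; exists (s h); rewrite ?sK // inE.
    move: hX shX; rewrite !inE hi shi Ph /= !negbK => /eqP -> /eqP ->.
    by move: ut utt; case: (u) => -[] [].
  have := mono i; have : 2 * (D%:R * #|X|%:R) <= kap / 2 * #|V|%:R.
    have D0r : 0 < D%:R :> R by rewrite ltr0n.
    move: epskap; rewrite ler_pdivlMr ?mulr_gt0 // => epskap.
    apply: le_trans (_ : 2 * (D%:R * (eps * #|V|%:R)) <= _).
      by rewrite ler_pM2l // ler_pM2l.
    have := ler_wpM2r (ler0n R #|V|) epskap; lra.
  move: misP; rewrite -(ler_nat R) natrM; move: mis_ge; rewrite -(ler_nat R) natrD !natrM.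
  have : dD * #|[set v | A v]|%:R <= kap / 4 * #|V|%:R.
    by apply: ler_pM; rewrite ?(ltW dD0) // ler_nat max_card.
  lra.
have := sum_square_le_energy dD0 D0 degE1 degE2 F0 cut.
rewrite sumF => h; apply: le_trans h _.
have -> : 8 * D%:R / dD ^+ 2 = 4 * D%:R / dD ^+ 2 * 2 by field; rewrite gt_eqF.
by rewrite -[leRHS]mulrA ler_wpM2l // divr_ge0 ?sqr_ge0 // mulr_ge0.
Qed.

End ExpandingGraph.

(** * Poincare inequality for two communities *)

Section TwoBlocks.

Variables (R : realType) (V H : finType) (comm : V -> 'I_2) (src : H -> V) (s : H -> H).
Variables (D p : nat) (eps dL dS : R).
Hypothesis G : expanding comm src s predT D eps dL dS.
Let sK := expanding_inv G.
Let degree := expanding_degree G.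
Let D0 := expanding_D G.
Let eps0 := expanding_eps G.
Let dS0 := expanding_dS G.

Definition within (h : H) := comm (src (s h)) == comm (src h).

(* Crossing half-edges are not counted in these cuts, so a function supported in one
   community is controlled by the energy inside that community. *)
Hypothesis small_within : forall c : {ffun V -> bool},
  #|[set v | c v]|%:R <= eps * #|V|%:R -> (p <= 4 * D * #|[set v | c v]|)%N ->
  dS * #|[set v | c v]|%:R <= #|cutset src s within c|%:R.

Local Notation E := (energy src (src \o s) predT).

(** The truncation f of u - g to [0, d], restricted to community i, vanishes on all but an
    eps-fraction of the community, while each of its level sets below d contains the
    owners of all half-edges of B, hence at least p / (4 D) vertices.  So its level sets expand,
    and the sum of its squares is at least (p / (4 D)) d ^ 2. *)
Lemma crossing_below_le_energy (g : V -> R) (i : 'I_2) (u d : R) (B : {set H}) : 0 < d ->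
  #|[set v in fiber comm i | g v < u]|%:R <= eps * #|fiber comm i|%:R ->
  (forall h, h \in B -> comm (src h) = i /\ g (src h) < u - d) -> (p <= 4 * #|B|)%N ->
  p%:R * d ^+ 2 <= 16 * D%:R ^+ 2 / dS ^+ 2 * E g.
Proof.
move=> d0 few BP pB; have D0r : 0 < D%:R :> R by rewrite ltr0n.
pose f v := if comm v == i then Num.min d (Num.max 0 (u - g v)) else 0.
have f0 v : 0 <= f v by rewrite /f; case: ifP => // _; rewrite le_min ltW //= le_max lexx.
have f_gt t v : 0 <= t -> t < f v -> [/\ comm v = i, t < d & g v < u - t].
  move=> t0; rewrite /f; case: eqP => [-> |_]; last by rewrite ltNge t0.
  by rewrite lt_min lt_max [t < 0]ltNge t0 /= => /andP[-> ?]; split=> //; lra.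
have level_f v : comm v = i -> g v < u - d -> f v = d.
  move=> vi gv; rewrite /f vi eqxx max_r; last lra.
  by rewrite min_l //; lra.
have big (A : {set V}) : (forall v, comm v = i -> g v < u - d -> v \in A) -> (p <= 4 * D * #|A|)%N.
  move=> AP; apply: leq_trans pB _; rewrite -mulnA leq_mul2l /=.
  apply: (@leq_trans #|[set h | src h \in A]|).
    apply/subset_leq_card/fintype.subsetP => h /BP[hi gh]; rewrite inE; exact: AP.
  exact: card_preim_le.
have S_le : \sum_v f v ^+ 2 <= 4 * D%:R / dS ^+ 2 * E g.
  apply: le_trans (_ : 4 * D%:R / dS ^+ 2 * energy src (src \o s) within f <= _).
    apply: sum_square_le_energy => //.
    - move=> v; rewrite -(card_imset _ (inv_inj sK)); apply: leq_trans (degree v).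
      by apply/subset_leq_card/fintype.subsetP => _ /imsetP[h + ->]; rewrite !inE.
    - move=> t t0 [v tv]; have [_ td _] := f_gt t v t0 tv.
      pose c : {ffun V -> bool} := [ffun v => t < f v].
      have cE : [set v | t < f v] = [set v | c v] by apply/setP => w; rewrite !inE ffunE.
      rewrite cE; apply: le_trans (small_within _ _) _; rewrite -?cE.
      + apply: le_trans (_ : eps * #|fiber comm i|%:R <= _); last first.
          by rewrite ler_wpM2l ?(ltW eps0) // ler_nat max_card.
        apply: le_trans few; rewrite ler_nat; apply/subset_leq_card/fintype.subsetP => w.
        rewrite !inE => /(f_gt t _ t0)[-> _ gw]; rewrite eqxx /=; lra.
      + by apply: big => w wi gw; rewrite inE level_f.
      + rewrite ler_nat; apply/subset_leq_card/fintype.subsetP => h.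
        by rewrite !inE !ffunE -leNgt.
  rewrite ler_wpM2l //; first by rewrite divr_ge0 ?sqr_ge0 // mulr_ge0.
  rewrite /energy big_mkcond /=; apply: ler_sum => h _; rewrite /within /= /f.
  case: eqP => [->|_]; last exact: sqr_ge0.
  case: eqP => _; last by rewrite subrr expr0n sqr_ge0.
  set x := g (src h); set y := g _.
  rewrite -[leLHS]real_normK ?num_real // -[leRHS]real_normK ?num_real //.
  apply: lerXn2r; rewrite ?nnegrE ?normr_ge0 // ler_norml.
  have n1 := ler_norm (x - y); have n2 := ler_norm (y - x); rewrite distrC in n2.
  rewrite /Num.max; case: ltP => ?; case: ltP => ?; rewrite /Num.min; case: ltP => ?;
    case: ltP => ?; apply/andP; split; lra.
pose A := [set v | (comm v == i) && (g v < u - d)].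
have pA : (p <= 4 * D * #|A|)%N by apply: big => v vi gv; rewrite inE vi eqxx.
have SA : #|A|%:R * d ^+ 2 <= \sum_v f v ^+ 2.
  rewrite -sum1_card natr_sum mulr_suml big_mkcond /=; apply: ler_sum => v _.
  rewrite inE; case: ifP => [/andP[/eqP vi gv]|_]; last exact: sqr_ge0.
  by rewrite level_f // mul1r.
apply: le_trans (_ : 4 * D%:R * (#|A|%:R * d ^+ 2) <= _).
  by rewrite mulrA ler_wpM2r ?sqr_ge0 // -!natrM ler_nat.
have -> : 16 * D%:R ^+ 2 / dS ^+ 2 * E g = 4 * D%:R * (4 * D%:R / dS ^+ 2 * E g).
  by field; rewrite gt_eqF.
by rewrite ler_pM2l ?mulr_gt0 //; apply: le_trans SA S_le.
Qed.

(** With d = (u - w) / 3, a crossing half-edge starts d below u, or ends d above w, or g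
    drops by d along it, and at least a quarter of them share the same behaviour.  In the
    first two cases [crossing_below_le_energy] applies to g or - g, in the third the
    energy is large by definition. *)
Lemma crossing_gap_le_energy (g : V -> R) (i j : 'I_2) (u w : R) : i != j -> w < u ->
  #|[set v in fiber comm i | g v < u]|%:R <= eps * #|fiber comm i|%:R ->
  #|[set v in fiber comm j | w < g v]|%:R <= eps * #|fiber comm j|%:R ->
  #|[set h | (comm (src h) == i) && ~~ within h]| = p ->
  p%:R * (u - w) ^+ 2 <= (144 * D%:R ^+ 2 / dS ^+ 2 + 36) * E g.
Proof.
move=> ij wu lowi highj cardX; pose d := (u - w) / 3; have d0 : 0 < d by rewrite divr_gt0 // subr_gt0.
set X := [set h | _] in cardX.
have Xj h : h \in X -> comm (src h) = i /\ comm (src (s h)) = j.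
  rewrite inE /within => /andP[/eqP -> ne]; split=> //.
  by move: ij ne; case: (i) => -[|[|//]] ?; case: (j) => -[|[|//]] ? //; case: (comm _) => -[|[|//]] ? // _ _; apply/val_inj.
pose B1 := [set h in X | g (src h) < u - d].
pose B2 := [set h in X | w + d < g (src (s h))].
pose B3 := [set h in X | d <= g (src h) - g (src (s h))].
have E0 : 0 <= E g by apply: energy_ge0.
have C0 : 0 <= 16 * D%:R ^+ 2 / dS ^+ 2 * E g by rewrite mulr_ge0 // divr_ge0 ?sqr_ge0 // mulr_ge0 // sqr_ge0.
have goal_of : p%:R * d ^+ 2 <= 16 * D%:R ^+ 2 / dS ^+ 2 * E g + 4 * E g ->
    p%:R * (u - w) ^+ 2 <= (144 * D%:R ^+ 2 / dS ^+ 2 + 36) * E g.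
  have -> : p%:R * (u - w) ^+ 2 = 9 * (p%:R * d ^+ 2) by rewrite /d; field.
  move=> h; apply: le_trans (ler_wpM2l _ h) _ => //.
  by apply: le_of_eq; field; rewrite gt_eqF.
apply: goal_of.
have cover : (p <= #|B1| + (#|B2| + #|B3|))%N.
  rewrite -cardX; apply: leq_trans (leq_add (leqnn _) (leq_card_setU _ _)).
  apply: leq_trans (leq_card_setU _ _); apply/subset_leq_card/fintype.subsetP => h hX.
  rewrite !finset.in_setU ![h \in [set _ in X | _]]inE hX /=.
  case: ltP => //= h1; case: ltP => //= h2; rewrite /d in h1 h2 *; lra.
have [b1|b1] := leqP p (4 * #|B1|).
  apply: le_trans (crossing_below_le_energy d0 lowi _ b1) _; last by rewrite lerDl mulr_ge0.
  by move=> h; rewrite inE => /andP[/Xj[]].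
have [b2|b2] := leqP p (4 * #|B2|).
  have Eopp : E g = E (fun v => - g v) by apply: eq_bigr => h _; rewrite -opprD sqrrN.
  apply: le_trans (_ : 16 * D%:R ^+ 2 / dS ^+ 2 * E (fun v => - g v) <= _); last first.
    by rewrite -Eopp lerDl mulr_ge0.
  apply: (@crossing_below_le_energy _ j (- w) d (s @: B2)) => //.
  - apply: le_trans highj; rewrite ler_nat; apply/subset_leq_card/fintype.subsetP => v.
    by rewrite !inE ltrN2.
  - by move=> _ /imsetP[h + ->]; rewrite inE => /andP[/Xj[_ ->]] ?; split=> //; lra.
  - by rewrite card_imset //; apply: inv_inj.
have b3 : (p <= 4 * #|B3|)%N by lia.
apply: le_trans (_ : 4 * E g <= _); last by rewrite lerDr.
apply: le_trans (_ : 4 * (#|B3|%:R * d ^+ 2) <= _).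
  by rewrite mulrA ler_wpM2r ?sqr_ge0 // -natrM ler_nat.
rewrite ler_pM2l // -sum1_card natr_sum mulr_suml big_mkcond /=; apply: ler_sum => h _.
rewrite inE mul1r; case: ifP => [/andP[_ h3]|_]; last exact: sqr_ge0.
by apply: lerXn2r; rewrite ?nnegrE ?(ltW d0) //=; lra.
Qed.

Hypothesis crossing : forall i, #|[set h | (comm (src h) == i) && ~~ within h]| = p.

(** Centre g at a quantile of one community.  What remains is the square of the difference
    between the quantiles of the two communities: [crossing_gap_le_energy] bounds it across
    the communities and [quantile_gap] inside one of them.  The factor #|V| / p is of
    order 1 / alpha. *)
Lemma two_blocks_poincare (g : V -> R) : (0 < p)%N -> exists a : R,
  p%:R * \sum_v (g v - a) ^+ 2 <=
    (24 * D%:R / dS ^+ 2 + 48 * D%:R / dL ^+ 2 + 6) *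
    (D%:R + (288 * D%:R ^+ 2 / dS ^+ 2 + 72 + 8 * D%:R ^+ 2 / dL ^+ 2)) *
    #|V|%:R * E g.
Proof.
move=> p0; have e0 := eps0; have dL0 := expanding_dL G.
have D0r : 0 < D%:R :> R by rewrite ltr0n.
have qex := quantile_exists G.
have E0 : 0 <= E g by apply: energy_ge0.
have N_le : #|H|%:R <= D%:R * #|V|%:R :> R.
  have := @sum_fibers_le R V H predT src (fun=> 1) D (fun=> ler01) degree.
  by rewrite !sumr_const.
have pn : p%:R <= D%:R * #|V|%:R :> R.
  by apply: le_trans N_le; rewrite ler_nat -(crossing ord0) max_card.
have V0 : 0 < #|V|%:R :> R.
  by rewrite -(pmulr_rgt0 _ D0r); apply: lt_le_trans pn; rewrite ltr0n.
pose K : R := 288 * D%:R ^+ 2 / dS ^+ 2 + 72 + 8 * D%:R ^+ 2 / dL ^+ 2.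
have gap i j (u u' : R) : i != j -> u' <= u -> quantile comm eps g i u -> quantile comm eps g j u' ->
    p%:R * (u - u') ^+ 2 <= K * E g.
  move=> ij uu qi qj; have [w' qw'] := qex (fun v => - g v) j.
  have [w qw] : exists w, quantile comm eps (fun v => - g v) j (- w).
    by exists (- w'); rewrite opprK.
  have [u'w] := quantile_gap G qj qw.
  set x := #|V|%:R * _ => gapw.
  have pw : p%:R * (w - u') ^+ 2 <= 4 * D%:R ^+ 2 / dL ^+ 2 * E g.
    apply: le_trans (_ : D%:R * x <= _).
      by rewrite /x mulrA ler_wpM2r ?sqr_ge0.
    apply: le_trans (ler_wpM2l (ltW D0r) gapw) _.
    by apply: le_of_eq; field; rewrite gt_eqF.
  have c1 : 0 <= D%:R ^+ 2 / dS ^+ 2 * E g by rewrite mulr_ge0 // divr_ge0 ?sqr_ge0.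
  have KE : K * E g = 2 * ((144 * D%:R ^+ 2 / dS ^+ 2 + 36) * E g) + 2 * (4 * D%:R ^+ 2 / dL ^+ 2 * E g).
    by rewrite /K; field; rewrite !gt_eqF.
  have [wu|uw] := ltP w u; last first.
    apply: le_trans (_ : p%:R * (w - u') ^+ 2 <= _).
      by rewrite ler_wpM2l // lerXn2r ?nnegrE ?subr_ge0 // lerD2r.
    apply: le_trans pw _; rewrite KE; have := c1.
    have := mulr_ge0 (ler0n R 1) E0.
    have : 0 <= 4 * D%:R ^+ 2 / dL ^+ 2 * E g by rewrite mulr_ge0 // divr_ge0 ?sqr_ge0 // mulr_ge0 ?sqr_ge0.
    have -> : (144 * D%:R ^+ 2 / dS ^+ 2 + 36) * E g = 144 * (D%:R ^+ 2 / dS ^+ 2 * E g) + 36 * E g.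
      by field; rewrite gt_eqF.
    move: (4 * _ / _ * _) (D%:R ^+ 2 / dS ^+ 2 * E g) E0 => X Y; lra.
  have high : #|[set v in fiber comm j | w < g v]|%:R <= eps * #|fiber comm j|%:R.
    case: qw => + _; apply: le_trans; rewrite ler_nat.
    by apply/subset_leq_card/fintype.subsetP => v; rewrite !inE ltrN2.
  have [low _] := qi.
  have := crossing_gap_le_energy ij wu low high (crossing i).
  rewrite KE; move: pw; move: (_ * E g) (_ * E g) => X Y h1 h2.
  have -> : p%:R * (u - u') ^+ 2 = 2 * (p%:R * (u - w) ^+ 2) + 2 * (p%:R * (w - u') ^+ 2)
      - p%:R * ((u - w) - (w - u')) ^+ 2 by ring.
  have : 0 <= p%:R * ((u - w) - (w - u')) ^+ 2 by rewrite mulr_ge0 ?sqr_ge0.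
  lra.
have [u0 q0] := qex g ord0; have [u1 q1] := qex g ord_max.
have gap01 : p%:R * (u0 - u1) ^+ 2 <= K * E g.
  have [le10|le01] := leP u1 u0; first exact: (gap ord0 ord_max).
  have -> : (u0 - u1) ^+ 2 = (u1 - u0) ^+ 2 by ring.
  by apply: (gap ord_max ord0) => //; apply: ltW.
exists u1; pose g' v := g v - u1.
have shift i u : quantile comm eps g i u -> quantile comm eps g' i (u - u1).
  move=> [h1 h2]; split.
    by move: h1; under eq_finset do rewrite -(ltrD2r (- u1)).
  by move: h2; under eq_finset do rewrite -(lerD2r (- u1)).
pose uu (i : 'I_2) := if i == ord0 then u0 - u1 else 0.
have q' i : quantile comm eps g' i (uu i).
  rewrite /uu; case: eqP => [->|i0]; first exact: shift.
  have -> : i = ord_max by apply/val_inj => /=; case: i i0 => -[|[|//]] ? // i0; case: i0; apply/val_inj.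
  by rewrite -[0](subrr u1); apply: shift.
have := sum_square_le_quantiles G q'.
have -> : E g' = E g by apply: eq_bigr => h _; rewrite /g' /=; congr (_ ^+ 2); ring.
rewrite card_ord big_ord_recl big_ord1 /uu /= expr0n addr0.
have -> : 24 * 2 * D%:R / dL ^+ 2 = 48 * D%:R / dL ^+ 2 :> R by congr (_ / _); ring.
set C := _ + 6; have C0 : 0 <= C.
  rewrite /C !addr_ge0 // ?divr_ge0 ?sqr_ge0 ?mulr_ge0 //.
move=> main; apply: le_trans (ler_wpM2l (ler0n R p) main) _.
rewrite mulrCA -!mulrA ler_wpM2l // mulrDr mulrDl lerD //.
  by rewrite mulrA ler_wpM2r.
apply: le_trans (_ : #|V|%:R * (K * E g) <= _); first by rewrite mulrCA ler_wpM2l.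
by apply: le_of_eq; rewrite /K; field; rewrite !gt_eqF.
Qed.

End TwoBlocks.

(** * Rayleigh quotients *)

Section Rayleigh.

Variables (R : realType) (n : nat).
Implicit Types (u v : 'rV[R]_n) (S : 'M[R]_n).

Definition dotr u v : R := \sum_i u 0 i * v 0 i.

Lemma cauchy_schwarz_sum (I : finType) (a b : I -> R) :
  (\sum_i a i * b i) ^+ 2 <= (\sum_i a i ^+ 2) * (\sum_i b i ^+ 2).
Proof.
set A := \sum_i a i ^+ 2; set B := \sum_i b i ^+ 2; set C := \sum_i _.
have B0 : 0 <= B by apply: sumr_ge0 => i _; apply: sqr_ge0.
have : 0 <= \sum_i (a i * B - b i * C) ^+ 2 by apply: sumr_ge0 => i _; apply: sqr_ge0.
have -> : \sum_i (a i * B - b i * C) ^+ 2 = B * (A * B - C ^+ 2).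
  have eA : B ^+ 2 * A = \sum_i B ^+ 2 * a i ^+ 2 by rewrite mulr_sumr.
  have eC : - (2 * B * C) * C = \sum_i - (2 * B * C) * (a i * b i) by rewrite -mulr_sumr.
  have eB : C ^+ 2 * B = \sum_i C ^+ 2 * b i ^+ 2 by rewrite mulr_sumr.
  have -> : B * (A * B - C ^+ 2) = B ^+ 2 * A + - (2 * B * C) * C + C ^+ 2 * B by ring.
  by rewrite eA eC eB -!big_split /=; apply: eq_bigr => i _; ring.
move: B0; rewrite le_eqVlt => /orP[/eqP B0 _|B0]; last by rewrite pmulr_rge0 // subr_ge0.
have b0 i : b i = 0.
  apply/eqP; rewrite -sqrf_eq0; apply/eqP/(psumr_eq0P _ (esym B0)) => // j _; exact: sqr_ge0.
have -> : C = 0 by rewrite /C big1 // => i _; rewrite b0 mulr0.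
by rewrite expr0n -B0 mulr0.
Qed.

Lemma dotrC u v : dotr u v = dotr v u.
Proof. by apply: eq_bigr => i _; rewrite mulrC. Qed.

Lemma dotr_ge0 v : 0 <= dotr v v.
Proof. by apply: sumr_ge0 => i _; rewrite -expr2 sqr_ge0. Qed.

Lemma dotr_eq0 v : dotr v v = 0 -> v = 0.
Proof.
move=> v0; apply/rowP => i; rewrite mxE; apply/eqP; rewrite -sqrf_eq0 expr2; apply/eqP.
by apply: (psumr_eq0P _ v0) => // j _; rewrite -expr2 sqr_ge0.
Qed.

Lemma dotrDl u v w : dotr (u + v) w = dotr u w + dotr v w.
Proof. by rewrite -big_split; apply: eq_bigr => i _; rewrite mxE mulrDl. Qed.

Lemma dotrZl a u v : dotr (a *: u) v = a * dotr u v.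
Proof. by rewrite mulr_sumr; apply: eq_bigr => i _; rewrite mxE mulrA. Qed.

Lemma dotrNl u v : dotr (- u) v = - dotr u v.
Proof. by rewrite -scaleN1r dotrZl mulN1r. Qed.

Lemma dotr_mulmx_sym S u v : S^T = S -> dotr (u *m S) v = dotr (v *m S) u.
Proof.
move=> sS; rewrite /dotr.
under eq_bigr do rewrite mxE mulr_suml; under [RHS]eq_bigr do rewrite mxE mulr_suml.
rewrite exchange_big; apply: eq_bigr => i _; apply: eq_bigr => j _.
by rewrite -{1}sS mxE; ring.
Qed.

Lemma dotr_mulmx_bounded S : exists2 C, 0 < C & forall v, dotr (v *m S) (v *m S) <= C * dotr v v.
Proof.
pose C := 1 + \sum_j \sum_i S i j ^+ 2.
have S0 : 0 <= \sum_j \sum_i S i j ^+ 2.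
  by apply: sumr_ge0 => j _; apply: sumr_ge0 => i _; apply: sqr_ge0.
exists C => [|v]; first by rewrite /C; lra.
apply: le_trans (_ : (\sum_j \sum_i S i j ^+ 2) * dotr v v <= _); last first.
  by rewrite ler_wpM2r ?dotr_ge0 // /C; lra.
rewrite mulr_suml; apply: ler_sum => j _; rewrite mxE -expr2 mulrC.
have -> : dotr v v = \sum_i v 0 i ^+ 2 by apply: eq_bigr => i _; rewrite expr2.
exact: cauchy_schwarz_sum.
Qed.

(** The eigenvalue is the supremum beta of the Rayleigh quotient.  The form
    q v = beta |v| ^ 2 - (v S, v) is nonnegative and takes arbitrarily small values on
    unit vectors.  If B = S - beta were invertible, then |v| ^ 2 would be at most a
    constant times |v B| ^ 2, hence a constant times q v, a contradiction. *)
Lemma rayleigh_sup_eigenvalue S (b : R) v0 : S^T = S ->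
  (forall v, dotr (v *m S) v <= b * dotr v v) -> v0 != 0 ->
  exists2 beta, eigenvalue S beta & dotr (v0 *m S) v0 <= beta * dotr v0 v0.
Proof.
move=> sS Sb v0n.
have pos v : v != 0 -> 0 < dotr v v.
  by move=> vn; rewrite lt0r dotr_ge0 andbT; apply: contra vn => /eqP/dotr_eq0 ->.
pose X := [set r | exists2 v, v != 0 & r = dotr (v *m S) v / dotr v v]%classic.
have Xsup : has_sup X.
  split; first by exists (dotr (v0 *m S) v0 / dotr v0 v0), v0.
  by exists b => _ [v vn ->]; rewrite ler_pdivrMr ?pos.
pose beta := sup X.
have up v : dotr (v *m S) v <= beta * dotr v v.
  have [->|vn] := eqVneq v 0; first by rewrite mul0mx /dotr !big1 ?mulr0 // => i _; rewrite mxE mul0r.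
  by rewrite -ler_pdivrMr ?pos //; apply: sup_upper_bound => //; exists v.
exists beta; last exact: up.
have [//|neig] := boolP (eigenvalue S beta); exfalso; pose B := S - beta%:M.
have Bu : B \in unitmx.
  by move: neig; rewrite negbK -row_free_unit -kermx_eq0.
have sB : B^T = B by rewrite /B linearB /= sS tr_scalar_mx.
pose q v := - dotr (v *m B) v.
have qE v : q v = beta * dotr v v - dotr (v *m S) v.
  rewrite /q /B mulmxBr mul_mx_scalar dotrDl dotrNl dotrZl; ring.
have q0 v : 0 <= q v by rewrite qE subr_ge0.
have [C C0 CP] := dotr_mulmx_bounded B.
have [C' C'0 C'P] := dotr_mulmx_bounded (invmx B).
(* Expand the inequality 0 <= q (v + t g) for g = v B and t = 1 / (C + 1). *)
have qg v : dotr (v *m B) (v *m B) <= (C + 1) * q v.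
  set g := v *m B; pose t := (C + 1)^-1.
  have t0 : 0 < t by rewrite invr_gt0; lra.
  have gg : - dotr (g *m B) g <= (C + 1) / 2 * dotr g g.
    have := dotr_ge0 (g *m B + g); rewrite dotrDl [dotr _ (_ + _)]dotrC dotrDl.
    rewrite [dotr g (_ + _)]dotrC dotrDl [dotr g (g *m B)]dotrC; have := CP g; lra.
  have := q0 (v + t *: g).
  have -> : q (v + t *: g) = q v - 2 * t * dotr g g + t ^+ 2 * (- dotr (g *m B) g).
    rewrite /q mulmxDl -scalemxAl -/g !dotrDl !dotrZl.
    rewrite [dotr g (v + _)]dotrC [dotr (g *m B) (v + _)]dotrC !dotrDl !dotrZl.
    rewrite [dotr v (g *m B)]dotrC [dotr (g *m B) v](dotr_mulmx_sym _ _ sB) -/g.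
    rewrite [dotr v g]dotrC [dotr g (g *m B)]dotrC; ring.
  have : t ^+ 2 * (- dotr (g *m B) g) <= t / 2 * dotr g g.
    apply: le_trans (ler_wpM2l (sqr_ge0 t) gg) _.
    have -> : t ^+ 2 * ((C + 1) / 2 * dotr g g) = t * (t * (C + 1)) / 2 * dotr g g by ring.
    by rewrite mulVf ?mulr1 // gt_eqF //; lra.
  have := mulr_ge0 (ltW t0) (dotr_ge0 g) => tg h1 h2.
  by rewrite -ler_pdivrMl -/t; lra.
have vq v : dotr v v <= C' * (C + 1) * q v.
  have {1 2}-> : v = (v *m B) *m invmx B by rewrite mulmxK.
  by apply: le_trans (C'P _) _; rewrite -mulrA ler_pM2l.
pose e := (C' * (C + 1))^-1.
have CC : 0 < C' * (C + 1) by rewrite mulr_gt0 //; lra.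
have e0 : 0 < e by rewrite invr_gt0.
have [_ [v vn ->]] := sup_adherent e0 Xsup; rewrite -/beta ltr_pdivlMr ?pos // => close.
have := vq v; rewrite leNgt => /negP; apply.
by rewrite -ltr_pdivlMl // -/e qE; lra.
Qed.

End Rayleigh.

(** * Spectrum of the simple random walk *)

Section SimpleRandomWalk.

Variables (R : realType) (n : nat) (H : finType) (src : H -> 'I_n) (s : {perm H}) (D : nat).
Hypothesis sK : involutive s.
Hypothesis degree_gt0 : forall v, (0 < #|[set h | src h == v]|)%N.
Hypothesis degree_le : forall v, (#|[set h | src h == v]| <= D)%N.

Definition deg (v : 'I_n) : R := #|[set h | src h == v]|%:R.
Local Notation E := (energy src (src \o s) predT).
Local Notation P := (srw R src s).

Lemma deg_gt0 v : 0 < deg v.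
Proof. by rewrite ltr0n. Qed.

Lemma sum_half_edges (F : 'I_n -> R) : \sum_h F (src h) = \sum_v deg v * F v.
Proof.
rewrite (partition_big src predT) //=; apply: eq_bigr => v _.
rewrite (eq_bigr (fun=> F v)) => [|h /eqP -> //].
by rewrite sumr_const mulr_natl; congr (_ *+ _); apply: eq_card => h; rewrite inE.
Qed.

Lemma sum_partner (F : H -> R) : \sum_h F (s h) = \sum_h F h.
Proof. by rewrite [RHS](reindex_inj (@perm_inj _ s)). Qed.

Lemma sum_srw_row (f : 'I_n -> R) y :
  \sum_x f x * #|[set h | (src h == x) && (src (s h) == y)]|%:R
  = \sum_(h | src h == y) f (src (s h)).
Proof.
rewrite [RHS](reindex_inj (@perm_inj _ s)) /=.
rewrite (partition_big src predT) //=; apply: eq_bigr => x _.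
rewrite (eq_bigr (fun=> f x)) => [|h /andP[_ /eqP <-]]; last by rewrite sK.
rewrite sumr_const mulr_natr; congr (_ *+ _); apply: eq_card => h.
by rewrite [RHS]unfold_in /= inE andbC.
Qed.

(** Dividing a left eigenvector by the degrees gives an eigenfunction, by reversibility. *)
Lemma eigenvalue_srwP lam :
  (exists f : 'I_n -> R, (exists v, f v != 0) /\
     forall y, \sum_(h | src h == y) f (src (s h)) = lam * (deg y * f y))
  <-> eigenvalue P lam.
Proof.
have rowE (v : 'rV[R]_n) y :
    (v *m P) 0 y = \sum_(h | src h == y) v 0 (src (s h)) / deg (src (s h)).
  rewrite mxE -(sum_srw_row (fun x => v 0 x / deg x)); apply: eq_bigr => x _.
  by rewrite mxE -/(deg x) mulrA mulrAC.
split=> [[f [[v0 fv0] fP]]|/eigenvalueP[v vP vn]].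
  apply/eigenvalueP; exists (\row_x (deg x * f x)).
    apply/rowP => y; rewrite rowE !mxE -fP; apply: eq_bigr => h _.
    by rewrite mxE mulrC mulKf // gt_eqF // deg_gt0.
  apply: contra fv0 => /eqP /rowP/(_ v0); rewrite !mxE => /eqP.
  by rewrite mulf_eq0 gt_eqF ?deg_gt0.
exists (fun x => v 0 x / deg x); split.
  have [y yP|none] := pickP (fun y => v 0 y != 0).
    by exists y; rewrite mulf_neq0 // invr_neq0 // gt_eqF ?deg_gt0.
  case/eqP: vn; apply/rowP => y; rewrite mxE; apply/eqP; exact: negbFE (none y).
move=> y; rewrite -rowE vP mxE; congr (_ * _).
by rewrite mulrC divfK // gt_eqF ?deg_gt0.
Qed.

(** The quadratic form (f, P f) in the inner product weighted by the degrees, whose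
    squared norm is [deg_norm]. *)
Definition pairing_form (f : 'I_n -> R) := \sum_h f (src h) * f (src (s h)).
Definition deg_norm (f : 'I_n -> R) := \sum_v deg v * f v ^+ 2.

Lemma energyE f : E f = 2 * (deg_norm f - pairing_form f).
Proof.
have -> : E f = \sum_h f (src h) ^+ 2 + \sum_h f (src (s h)) ^+ 2 - 2 * pairing_form f.
  rewrite /pairing_form mulr_sumr -big_split /= -sumrB; apply: eq_bigr => h _ /=; ring.
rewrite (sum_partner (fun h => f (src h) ^+ 2)) (sum_half_edges (fun v => f v ^+ 2)).
by rewrite -/(deg_norm f); ring.
Qed.

Lemma signless_energyE f :
  \sum_h (f (src h) + f (src (s h))) ^+ 2 = 2 * (deg_norm f + pairing_form f).
Proof.
transitivity (\sum_h f (src h) ^+ 2 + \sum_h f (src (s h)) ^+ 2 + 2 * pairing_form f).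
  rewrite /pairing_form mulr_sumr -!big_split /=; apply: eq_bigr => h _; ring.
rewrite (sum_partner (fun h => f (src h) ^+ 2)) (sum_half_edges (fun v => f v ^+ 2)).
by rewrite -/(deg_norm f); ring.
Qed.

Lemma pairing_form_eigen f lam :
  (forall y, \sum_(h | src h == y) f (src (s h)) = lam * (deg y * f y)) ->
  pairing_form f = lam * deg_norm f.
Proof.
move=> fP; rewrite /pairing_form (partition_big src predT) //= mulr_sumr.
apply: eq_bigr => y _; rewrite (eq_bigr (fun h => f y * f (src (s h)))) => [|h /eqP -> //].
by rewrite -mulr_sumr fP; ring.
Qed.

Lemma deg_sum_eigen f lam : lam != 1 ->
  (forall y, \sum_(h | src h == y) f (src (s h)) = lam * (deg y * f y)) ->
  \sum_v deg v * f v = 0.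
Proof.
move=> lam1 fP; set m := \sum_v _.
have : m = lam * m.
  rewrite /m mulr_sumr -(eq_bigr _ (fun y _ => fP y)) -sum_half_edges.
  by rewrite -(sum_partner (fun h => f (src h))) (partition_big src predT).
move=> /eqP; rewrite -subr_eq0 -{1}[m]mul1r -mulrBl mulf_eq0 subr_eq0 => /orP[/eqP l1|/eqP //].
by rewrite -l1 eqxx in lam1.
Qed.

Lemma deg_norm_le_shift f a : \sum_v deg v * f v = 0 ->
  deg_norm f <= D%:R * \sum_v (f v - a) ^+ 2.
Proof.
move=> f0; apply: le_trans (_ : \sum_v deg v * (f v - a) ^+ 2 <= _).
  have -> : \sum_v deg v * (f v - a) ^+ 2 =
      deg_norm f - 2 * a * (\sum_v deg v * f v) + \sum_v deg v * a ^+ 2.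
    by rewrite /deg_norm mulr_sumr -sumrB -big_split /=; apply: eq_bigr => v _; ring.
  rewrite f0 mulr0 subr0 lerDl; apply: sumr_ge0 => v _.
  by rewrite mulr_ge0 ?sqr_ge0 // ltW ?deg_gt0.
by rewrite mulr_sumr; apply: ler_sum => v _; rewrite ler_wpM2r ?sqr_ge0 // ler_nat.
Qed.

Lemma deg_norm_gt0 f v : f v != 0 -> 0 < deg_norm f.
Proof.
move=> fv; rewrite /deg_norm (bigD1 v) //=; apply: ltr_pwDl.
  by rewrite mulr_gt0 ?deg_gt0 // lt0r sqr_ge0 sqrf_eq0 fv.
by apply: sumr_ge0 => w _; rewrite mulr_ge0 ?sqr_ge0 // ltW ?deg_gt0.
Qed.

Lemma pairing_form_le f : pairing_form f <= deg_norm f.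
Proof. by have := energyE f; have := @energy_ge0 _ _ _ src (src \o s) predT f; lra. Qed.

Lemma pairing_form_ge f : - deg_norm f <= pairing_form f.
Proof.
have := signless_energyE f; have : 0 <= \sum_h (f (src h) + f (src (s h))) ^+ 2.
  by apply: sumr_ge0 => h _; apply: sqr_ge0.
lra.
Qed.

Variables (K K' : R).
Hypothesis K_gt0 : 0 < K.
Hypothesis K'_gt0 : 0 < K'.
Hypothesis poincare : forall g : 'I_n -> R, exists a, \sum_v (g v - a) ^+ 2 <= K * E g.
Hypothesis signless : forall f : 'I_n -> R,
  \sum_v f v ^+ 2 <= K' * \sum_h (f (src h) + f (src (s h))) ^+ 2.

Lemma constant_of_energy0 (f : 'I_n -> R) : E f = 0 -> forall v w, f v = f w.
Proof.
move=> f0; have [a] := poincare f; rewrite f0 mulr0 => fa.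
suff fE v : f v = a by move=> v w; rewrite !fE.
have : \sum_v (f v - a) ^+ 2 = 0.
  by apply/eqP; rewrite eq_le fa sumr_ge0 // => w _; apply: sqr_ge0.
move/psumr_eq0P => /(_ (fun w _ => sqr_ge0 _)) /(_ v isT) /eqP.
by rewrite sqrf_eq0 subr_eq0 => /eqP.
Qed.

(** The indicator of the set reachable from x has no energy, so it is constant by the
    Poincare inequality. *)
Lemma srw_irreducible : irreducible P.
Proof.
have Pge0 x y : 0 <= P x y by rewrite mxE divr_ge0.
have Pt_ge0 t x y : 0 <= (P ^+ t) x y.
  elim: t x y => [|t IH] x y; first by rewrite expr0 mxE ler0n.
  by rewrite exprSr mxE sumr_ge0 // => z _; rewrite mulr_ge0.
move=> x y; pose reach z := `[< exists t : nat, 0 < (P ^+ t) x z >].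
pose f z : R := (reach z)%:R.
have step h : reach (src h) -> reach (src (s h)).
  move=> /asboolP[t Pt]; apply/asboolP; exists t.+1; rewrite exprSr mxE.
  rewrite (bigD1 (src h)) //= ltr_pwDl //.
    rewrite mulr_gt0 // mxE divr_gt0 ?deg_gt0 // ltr0n; apply/card_gt0P; exists h.
    by rewrite inE !eqxx.
  by apply: sumr_ge0 => z _; rewrite mulr_ge0.
have E0 : E f = 0.
  rewrite /energy big1 // => h _; rewrite /f /=.
  suff -> : reach (src (s h)) = reach (src h) by rewrite subrr expr0n.
  by apply/idP/idP => [/step|/step //]; rewrite sK.
have := constant_of_energy0 E0 x y; rewrite /f.
have -> : reach x by apply/asboolP; exists 0; rewrite expr0 mxE eqxx ltr01.
by case rE: (reach y); [move/asboolP: rE|move/eqP; rewrite oner_eq0].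
Qed.

(** An eigenfunction for lam other than 1 has mean zero, and its two energies are
    2 (1 - lam) and 2 (1 + lam) times its squared norm. *)
Lemma eigenvalue_bounds lam : eigenvalue P lam -> lam != 1 ->
  1 <= 2 * D%:R * K * (1 - lam) /\ 1 <= 2 * D%:R * K' * (1 + lam).
Proof.
move/eigenvalue_srwP => [f [[v fv] fP]] lam1.
have N0 := deg_norm_gt0 fv; have AE := pairing_form_eigen fP.
have mean := deg_sum_eigen lam1 fP.
split.
  have [a fa] := poincare f; rewrite -(ler_pM2r N0) mul1r.
  apply: le_trans (deg_norm_le_shift a mean) _.
  apply: le_trans (ler_wpM2l (ler0n R D) fa) _; rewrite energyE AE.
  by apply: le_of_eq; ring.
rewrite -(ler_pM2r N0) mul1r; have := deg_norm_le_shift 0 mean.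
under eq_bigr do rewrite subr0.
move=> h; apply: le_trans h _; apply: le_trans (ler_wpM2l (ler0n R D) (signless f)) _.
by rewrite signless_energyE AE; apply: le_of_eq; ring.
Qed.

(** Conjugating P by the square roots of the degrees makes it symmetric.  Subtracting three
    times the projection to the constants moves the eigenvalue 1 to - 2, below all the
    others, so the eigenvector of [rayleigh_sup_eigenvalue] is orthogonal to the constants
    and belongs to P itself. *)
Lemma eigenvalue_ge_test (g : 'I_n -> R) v : g v != 0 -> \sum_v deg v * g v = 0 ->
  exists2 lam, eigenvalue P lam /\ lam != 1 & pairing_form g <= lam * deg_norm g.
Proof.
move=> gv mg; pose r x := Num.sqrt (deg x); pose N := \sum_v deg v.
have r0 x : 0 < r x by rewrite sqrtr_gt0 deg_gt0.
have rn x : r x != 0 by rewrite gt_eqF.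
have rr x : r x * r x = deg x by rewrite -expr2 sqr_sqrtr // ltW // deg_gt0.
have N0 : 0 < N.
  rewrite /N (bigD1 v) //= ltr_pwDl ?deg_gt0 //.
  by apply: sumr_ge0 => w _; rewrite ltW ?deg_gt0.
pose e x y : R := #|[set h | (src h == x) && (src (s h) == y)]|%:R.
have eC x y : e x y = e y x.
  rewrite /e -(card_imset _ (@perm_inj _ s)); congr (_%:R); apply: eq_card => h.
  rewrite !inE; apply/imsetP/idP => [[k + ->]|hP].
    by rewrite inE sK andbC.
  by exists (s h); rewrite ?sK // inE sK andbC.
pose S : 'M[R]_n := \matrix_(x, y) (e x y / (r x * r y) - 3 * (r x * r y) / N).
have sS : S^T = S by apply/matrixP => x y; rewrite !mxE eC [r y * r x]mulrC.
pose vec (f : 'I_n -> R) : 'rV[R]_n := \row_x (r x * f x).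
pose tot f := \sum_v deg v * f v.
have vecS f y : (vec f *m S) 0 y
    = (\sum_(h | src h == y) f (src (s h))) / r y - 3 * r y * tot f / N.
  rewrite mxE -sum_srw_row mulr_suml /tot [_ * \sum_i _]mulr_sumr mulr_suml -sumrB.
  apply: eq_bigr => x _; rewrite !mxE -rr -/(e x y); field.
  by rewrite !rn gt_eqF.
have dotE f : dotr (vec f *m S) (vec f) = pairing_form f - 3 * tot f ^+ 2 / N.
  rewrite /dotr (eq_bigr (fun y => f y * (\sum_(h | src h == y) f (src (s h))) -
      3 * tot f / N * (deg y * f y))); last first.
    by move=> y _; rewrite vecS mxE -rr; field; rewrite rn gt_eqF.
  rewrite sumrB -mulr_sumr -/(tot f); congr (_ - _); last by rewrite expr2; ring.
  rewrite /pairing_form [RHS](partition_big src predT) //=; apply: eq_bigr => y _.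
  by rewrite mulr_sumr; apply: eq_bigr => h /eqP ->.
have normE f : dotr (vec f) (vec f) = deg_norm f.
  by apply: eq_bigr => y _; rewrite !mxE -rr; ring.
have vecP u : exists f, u = vec f.
  by exists (fun x => u 0 x / r x); apply/rowP => x; rewrite mxE mulrC divfK.
have Sb u : dotr (u *m S) u <= 1 * dotr u u.
  have [f ->] := vecP u; rewrite dotE normE mul1r; have := pairing_form_le f.
  have : 0 <= 3 * tot f ^+ 2 / N by rewrite divr_ge0 ?(ltW N0) // mulr_ge0 ?sqr_ge0.
  lra.
have gn : vec g != 0.
  apply: contra gv => /eqP/rowP/(_ v); rewrite !mxE => /eqP.
  by rewrite mulf_eq0 (negbTE (rn v)).
have [lam eig] := rayleigh_sup_eigenvalue sS Sb gn.
rewrite dotE normE /tot mg expr0n mulr0 mul0r subr0 => gl.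
have Ng := deg_norm_gt0 gv.
have lam_ge : -1 <= lam.
  rewrite -(ler_pM2r Ng); have := pairing_form_ge g; lra.
move/eigenvalueP: eig => [u uP un]; have [f uf] := vecP u.
have fE y : \sum_(h | src h == y) f (src (s h)) - 3 * deg y * tot f / N = lam * (deg y * f y).
  have := congr1 (fun w : 'rV_n => r y * w 0 y) uP; rewrite uf vecS !mxE.
  have -> : r y * ((\sum_(h | src h == y) f (src (s h))) / r y - 3 * r y * tot f / N)
      = \sum_(h | src h == y) f (src (s h)) - 3 * deg y * tot f / N.
    by rewrite -rr; field; rewrite rn gt_eqF.
  by move=> ->; rewrite -rr; ring.
have tot0 : tot f = 0.
  have : \sum_y (\sum_(h | src h == y) f (src (s h)) - 3 * deg y * tot f / N) = lam * tot f.
    by rewrite (eq_bigr _ (fun y _ => fE y)) -mulr_sumr.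
  have part : \sum_y \sum_(h | src h == y) f (src (s h)) = \sum_h f (src (s h)).
    by rewrite [RHS](partition_big src predT).
  rewrite sumrB part.
  rewrite (sum_partner (fun h => f (src h))) sum_half_edges -/(tot f).
  have -> : \sum_y 3 * deg y * tot f / N = 3 * tot f.
    rewrite (eq_bigr (fun y => 3 * tot f / N * deg y)); last by move=> y _; ring.
    by rewrite -mulr_sumr -/N; field; rewrite gt_eqF.
  move=> h; apply/eqP; have : (lam + 2) * tot f = 0 by lra.
  by move/eqP; rewrite mulf_eq0 gt_eqF //; lra.
have fP y : \sum_(h | src h == y) f (src (s h)) = lam * (deg y * f y).
  by rewrite -fE tot0 mulr0 mul0r subr0.
have [w fw] : exists w, f w != 0.
  have [w fw|none] := pickP (fun w => f w != 0); first by exists w.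
  by case/eqP: un; rewrite uf; apply/rowP => x; rewrite !mxE (eqP (negbFE (none x))) mulr0.
exists lam => //; split; first by apply/eigenvalue_srwP; exists f; split=> //; exists w.
apply/eqP => lam1; have := pairing_form_eigen fP; rewrite lam1 mul1r => AE.
have E0 : E f = 0 by rewrite energyE AE subrr mulr0.
have fc x : f x = f w by apply: constant_of_energy0 E0 _ _.
move: tot0; rewrite /tot (eq_bigr (fun y => deg y * f w)) => [|x _]; last by rewrite fc.
by rewrite -mulr_suml -/N => /eqP; rewrite mulf_eq0 (negbTE fw) gt_eqF.
Qed.

(** The test function is b on A and - a on its complement, which has mean zero. *)
Lemma eigenvalue_ge_cut (A : {set 'I_n}) :
  let a := \sum_(v in A) deg v in let b := \sum_(v in ~: A) deg v in 0 < a -> 0 < b ->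
  exists2 lam, eigenvalue P lam /\ lam != 1 &
    1 - lam <= #|cutset src s predT (mem A)|%:R * (a + b) / (a * b).
Proof.
move=> a b a0 b0; set cut := #|_|%:R.
pose g v := if v \in A then b else - a.
have [v vA] : exists v, v \in A.
  have [v vA|none] := pickP (fun v => v \in A); first by exists v.
  by move: a0; rewrite /a big_pred0 ?ltxx.
have split (F : 'I_n -> R) : \sum_v F v = \sum_(v in A) F v + \sum_(v in ~: A) F v.
  by rewrite (bigID (mem A)) /=; congr (_ + _); apply: eq_bigl => w; rewrite inE.
have onA (F : 'I_n -> R -> R) : \sum_(v in A) F v (g v) = \sum_(v in A) F v b.
  by apply: eq_bigr => w wA; rewrite /g wA.
have offA (F : 'I_n -> R -> R) : \sum_(v in ~: A) F v (g v) = \sum_(v in ~: A) F v (- a).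
  by apply: eq_bigr => w; rewrite inE /g => /negbTE ->.
have mean : \sum_v deg v * g v = 0.
  rewrite split (onA (fun v x => deg v * x)) (offA (fun v x => deg v * x)) -!mulr_suml -/a -/b.
  ring.
have normg : deg_norm g = a * b * (a + b).
  rewrite /deg_norm split (onA (fun v x => deg v * x ^+ 2)) (offA (fun v x => deg v * x ^+ 2)).
  rewrite -!mulr_suml -/a -/b; ring.
have Eg : E g = 2 * (cut * (a + b) ^+ 2).
  pose ind h : R := (h \in cutset src s predT (mem A))%:R * (a + b) ^+ 2.
  have -> : E g = \sum_h ind h + \sum_h ind (s h).
    rewrite -big_split; apply: eq_bigr => h _; rewrite /ind /g !inE /= sK.
    by case: (src h \in A); case: (src (s h) \in A) => /=; ring.
  rewrite sum_partner -mulr_suml -natr_sum.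
  have -> : (\sum_h (h \in cutset src s predT (mem A)) = #|cutset src s predT (mem A)|)%N.
    by rewrite -sum1_card [RHS]big_mkcond; apply: eq_bigr => h _; case: (h \in _).
  by rewrite -/cut; ring.
have gv : g v != 0 by rewrite /g vA gt_eqF.
have [lam lamP lamg] := eigenvalue_ge_test gv mean; exists lam => //.
have ab0 : 0 < a * b by rewrite mulr_gt0.
have s0 : 0 < a + b by rewrite addr_gt0.
rewrite ler_pdivlMr // -(ler_pM2r s0).
have := energyE g; rewrite Eg normg => EE; move: lamg; rewrite normg => lamg.
have -> : (1 - lam) * (a * b) * (a + b) = a * b * (a + b) - lam * (a * b * (a + b)) by ring.
have -> : cut * (a + b) * (a + b) = cut * (a + b) ^+ 2 by ring.
lra.
Qed.

Hypothesis n_gt1 : (1 < n)%N.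

(** The cut around a single vertex shows that 1 is not the only eigenvalue.  The suprema
    that define the gaps are then taken over nonempty sets, bounded by
    [eigenvalue_bounds]. *)
Theorem srw_relaxation : exists2 gap : R, 0 < gap &
  [/\ irreducible P, t_rel P = gap^-1, t_rel P <= abs_t_rel P,
      abs_t_rel P <= 2 * D%:R * Num.max K K' &
      forall A : {set 'I_n},
        let a := \sum_(v in A) deg v in let b := \sum_(v in ~: A) deg v in 0 < a -> 0 < b ->
        gap <= #|cutset src s predT (mem A)|%:R * (a + b) / (a * b)].
Proof.
pose v0 : 'I_n := Ordinal (ltnW n_gt1).
have D0 : 0 < D%:R :> R.
  by rewrite ltr0n; apply: leq_trans (degree_gt0 v0) (degree_le v0).
set M := Num.max K K'; have M0 : 0 < M by rewrite lt_max K_gt0.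
pose kap := (2 * D%:R * M)^-1.
have kap0 : 0 < kap by rewrite invr_gt0 !mulr_gt0.
have DM0 : 0 < 2 * D%:R * M by rewrite !mulr_gt0.
pose X := [set lam : R | eigenvalue P lam /\ lam <> 1]%classic.
have Xabs lam : X lam -> `|lam| <= 1 - kap.
  move=> [eig /eqP lam1]; have [h1 h2] := eigenvalue_bounds eig lam1.
  have le1 (k x : R) : 0 < k -> k <= M -> 1 <= 2 * D%:R * k * x -> kap <= x.
    move=> k0 kM h; rewrite /kap -[leLHS]mul1r ler_pdivrMr //.
    apply: le_trans (h) _; rewrite mulrC; have x0 : 0 <= x.
      by rewrite -(pmulr_rge0 _ (_ : 0 < 2 * D%:R * k)) ?mulr_gt0 // (le_trans ler01 h).
    by rewrite ler_wpM2l // ler_wpM2l // mulr_ge0 // ltW.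
  have := le1 K _ K_gt0 _ h1; have := le1 K' _ K'_gt0 _ h2.
  rewrite /M !le_max !lexx orbT => /(_ isT) q1 /(_ isT) q2.
  by rewrite ler_norml; apply/andP; split; lra.
have cut_eig A := @eigenvalue_ge_cut A.
have [lam0 X0] : exists lam, X lam.
  have := cut_eig [set v0]; case.
  - by rewrite big_set1 deg_gt0.
  - pose v1 : 'I_n := Ordinal n_gt1.
    rewrite (bigD1 v1) /=; last by rewrite !inE.
    by apply: ltr_pwDl; [apply: deg_gt0|apply: sumr_ge0 => w _; rewrite ltW ?deg_gt0].
  - by move=> lam [? /eqP ?] _; exists lam.
pose Y := [set `|lam| | lam in X]%classic.
have supY : has_sup Y.
  by split; [exists `|lam0|, lam0|exists (1 - kap) => _ [lam lX <-]; apply: Xabs].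
have supX : has_sup X.
  split; first by exists lam0.
  by exists (1 - kap) => lam /Xabs; apply: le_trans; apply: ler_norm.
have Yle : sup Y <= 1 - kap.
  by apply: ge_sup; [case: supY|move=> _ [lam lX <-]; apply: Xabs].
have XY : sup X <= sup Y.
  apply: ge_sup; first by case: supX.
  move=> lam lX; apply: le_trans (ler_norm _) _; apply: sup_upper_bound => //; exists lam => //.
have absE : abs_spectral_gap P = 1 - sup Y by [].
have gapE : spectral_gap P = 1 - sup X by [].
exists (1 - sup X); first lra.
split=> //; first exact: srw_irreducible.
- by rewrite /t_rel /abs_t_rel absE gapE lef_pV2 ?posrE; lra.
- rewrite /abs_t_rel absE -[leRHS]invrK lef_pV2 ?posrE ?invr_gt0 //; last lra.
  by rewrite -/kap; lra.
- move=> A a b a0 b0; have [lam [eig /eqP lam1] h] := cut_eig A a0 b0.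
  by apply: le_trans h; rewrite lerD2l lerN2; apply: sup_upper_bound.
Qed.

End SimpleRandomWalk.

(** * Uniform matchings drawn in two stages *)

Section MatchingExists.

Variables (H C : finType) (cls : H -> C) (tau : C -> C).
Hypothesis tauK : involutive tau.
Hypothesis balanced : forall k, #|[set h | cls h == tau k]| = #|[set h | cls h == k]|.
Hypothesis even_fixed : forall k, tau k = k -> ~~ odd #|[set h | cls h == k]|.

Let cell k := enum [set h | cls h == k].
Let flip i := if odd i then i.-1 else i.+1.
Let partner_index k i := if tau k == k then flip i else i.
Let partner h := nth h (cell (tau (cls h))) (partner_index (cls h) (index h (cell (cls h)))).

(** List the elements of every class.  Distinct classes k and tau k are matched position by
    position, and in a class fixed by tau the positions 2 i and 2 i + 1 are matched. *)
Lemma matching_exists :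
  exists2 s : {perm H}, perfect_matching s & forall h, cls (s h) = tau (cls h).
Proof.
have mem_cell k h : (h \in cell k) = (cls h == k) by rewrite mem_enum inE.
have size_cell k : size (cell k) = #|[set h | cls h == k]| by rewrite -cardE.
have uniq_cell k : uniq (cell k) by apply: enum_uniq.
have flipK i : flip (flip i) = i.
  rewrite /flip; case oi: (odd i) => /=; last by rewrite oi.
  by case: i oi => //= i /negbTE ->.
have flip_neq i : flip i != i.
  by rewrite /flip; case oi: (odd i); case: i oi => //= i _; lia.
have flip_lt i l : ~~ odd l -> (i < l)%N -> (flip i < l)%N.
  move=> ol il; rewrite /flip; case oi: (odd i); first exact: leq_ltn_trans (leq_pred _) il.
  by rewrite ltn_neqAle il andbT; apply: contra ol => /eqP <-; rewrite /= oi.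
have index_lt h : (index h (cell (cls h)) < size (cell (cls h)))%N by rewrite index_mem mem_cell.
have partner_lt h : (partner_index (cls h) (index h (cell (cls h))) < size (cell (tau (cls h))))%N.
  rewrite size_cell balanced -size_cell /partner_index; case: eqP => [fx|_]; last exact: index_lt.
  by apply: flip_lt => //; rewrite size_cell; apply: even_fixed.
have cls_partner h : cls (partner h) = tau (cls h).
  by apply/eqP; rewrite -mem_cell mem_nth // partner_lt.
have index_partner h : index (partner h) (cell (tau (cls h)))
    = partner_index (cls h) (index h (cell (cls h))).
  by rewrite index_uniq // partner_lt.
have partnerK : involutive partner.
  move=> h; rewrite {1}/partner cls_partner tauK index_partner /partner_index tauK [_ == tau _]eq_sym.
  by case: eqP => _; rewrite ?flipK nth_index // mem_cell.
have partner_neq h : partner h != h.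
  have [fx|nfx] := eqVneq (tau (cls h)) (cls h); last first.
    by apply: contra nfx => /eqP E; rewrite -cls_partner E.
  apply: contra (flip_neq (index h (cell (cls h)))) => /eqP E.
  by have := index_partner h; rewrite E fx /partner_index fx eqxx => <-.
exists (perm (inv_inj partnerK)) => [|h]; last by rewrite permE.
by apply/forallP => h; rewrite !permE partner_neq partnerK eqxx.
Qed.

End MatchingExists.

Section TwoStageLaw.

Variables (R : realType) (X H : finType) (A : {set X}) (M : X -> {set {perm H}}).

(** The law of s when x is uniform in A and s is uniform in M x. *)
Definition two_stage_law (s : {perm H}) : R :=
  \sum_(x in A) (s \in M x)%:R / (#|A|%:R * #|M x|%:R).

Lemma two_stage_law_ge0 s : 0 <= two_stage_law s.
Proof. by apply: sumr_ge0 => x _; rewrite divr_ge0 ?mulr_ge0. Qed.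

Lemma unif_mean_two_stage (ev : {perm H} -> Prop) :
  unif_mean A (fun x => unif_prob R (M x) ev) = \sum_(s | `[< ev s >]) two_stage_law s.
Proof.
rewrite /unif_mean /two_stage_law exchange_big /= mulr_suml; apply: eq_bigr => x _.
rewrite /unif_prob /unif_mean -mulrA -invfM [_ * #|A|%:R]mulrC -mulr_suml; congr (_ / _).
rewrite big_mkcond [RHS]big_mkcond; apply: eq_bigr => s _.
by case: (s \in M x); case: `[< ev s >].
Qed.

Lemma two_stage_law_total : (0 < #|A|)%N -> (forall x, x \in A -> (0 < #|M x|)%N) ->
  \sum_s two_stage_law s = 1.
Proof.
move=> A0 M0; rewrite /two_stage_law exchange_big /=.
rewrite (eq_bigr (fun=> (#|A|%:R)^-1)); last first.
  move=> x xA; rewrite -mulr_suml -natr_sum.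
  have -> : (\sum_s (s \in M x) = #|M x|)%N.
    by rewrite -sum1_card [RHS]big_mkcond; apply: eq_bigr => s _; case: (s \in _).
  by rewrite invfM mulrCA divff ?mulr1 // pnatr_eq0 -lt0n M0.
by rewrite sumr_const -[_ *+ _]mulr_natl divff // pnatr_eq0 -lt0n.
Qed.

Lemma two_stage_law_support s : two_stage_law s != 0 -> exists2 x, x \in A & s \in M x.
Proof.
move=> ls; have [x /andP[xA sx]|none] := pickP (fun x => (x \in A) && (s \in M x)).
  by exists x.
case/eqP: ls; apply: big1 => x xA; have := none x; rewrite xA /= => ->.
by rewrite mul0r.
Qed.

Lemma two_stage_law_conj (g : {perm H}) (act : X -> X) s : injective act ->
  (forall x, (act x \in A) = (x \in A)) ->
  (forall x t, ((t ^ g)%g \in M (act x)) = (t \in M x)) ->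
  two_stage_law (s ^ g)%g = two_stage_law s.
Proof.
move=> actI actA actM; rewrite /two_stage_law (reindex_inj actI) /=.
apply: eq_big => x; first exact: actA.
move=> _; rewrite actM; congr (_ / (_ * _%:R)).
rewrite -(card_imset (M x) (conjg_inj g)); apply: eq_card => t.
apply/idP/imsetP => [tM|[u uM ->]]; last by rewrite actM.
by exists (t ^ g^-1)%g; rewrite ?conjgKV // -(actM x) conjgKV.
Qed.

End TwoStageLaw.

(** * Two communities *)

Lemma card_tag_fiber (V : finType) (T : V -> finType) (v : V) (Q : pred (T v)) (S : pred {v & T v}) :
  (forall x : T v, S (Tagged T x) = Q x) ->
  #|[set h : {v & T v} | (tag h == v) && S h]| = #|[set x | Q x]|.
Proof.
move=> SQ; rewrite -(card_imset _ (_ : injective (fun x : T v => Tagged T x))); last first.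
  move=> x y E; apply/eqP.
  by move/eqP: E; rewrite (@eq_Tagged _ (fun v => T v : eqType) (Tagged (fun v => T v) x) y).
apply: eq_card => -[w x]; rewrite !inE /=; apply/andP/imsetP => [[/eqP wv Sx]|[y + E]].
  by subst w; exists x; rewrite ?inE -?SQ.
by rewrite inE => Qy; rewrite E SQ; split=> //; apply/eqP; exact: (congr1 tag E).
Qed.

Section GoodPairing.

Variables (R : realType) (M : random_pairing R) (m D : nat) (rho eps epsS dL : R).
Hypothesis M_tame : tame m D rho M.
Hypotheses (rho_gt0 : 0 < rho) (V_gt0 : (0 < #|vertex M|)%N) (D_gt0 : (0 < D)%N).
Hypotheses (eps_gt0 : 0 < eps) (eps_half : eps < 1 / 2) (eps_le : eps <= epsS) (dL_gt0 : 0 < dL).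

(** An edge leaving a set is mismatched at both of its half-edges, which halves the
    constant 1 / 6. *)
Lemma expanding_of_good (s : {perm half_edge M}) :
  law s != 0 -> (forall h, live (s h) = live h) ->
  large_expansion eps dL s ->
  small_expansion (fun s : {perm half_edge M} => s : half_edge M -> half_edge M)
    epsS (1 / 6) 0 0 s ->
  expanding (@block_of R M) (@owner R M) s (@live R M) D eps dL (1 / 12).
Proof.
move=> ls slive lg sm; have eS := eps_le.
have sK : involutive s.
  by move=> h; have /forallP/(_ h)/andP[_ /eqP] := law_matching ls.
split=> //; try lra.
- by case: M_tame.
- move=> i; rewrite -(ltr_nat R); case: M_tame => _ _ /(_ i); apply: lt_le_trans.
  by rewrite mulr_gt0 // ltr0n.
- move=> c [i ci]; have /forallP/(_ c)/implyP := lg.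
  have -> : spread eps c by apply/existsP; exists i; apply/forallP.
  move=> /(_ isT); congr (_ <= _%:R); apply: eq_card => h.
  rewrite !inE !ffunE slive; case: (live h) => //=; by rewrite eqxx.
- move=> c cn; have [->|c0] := posnP #|[set v | c v]|; first by rewrite mulr0.
  have /forallP/(_ c)/implyP := sm; rewrite c0 leq0n andbT /=.
  have -> : #|[set v | c v]|%:R <= epsS * #|vertex M|%:R.
    by apply: le_trans cn _; rewrite ler_wpM2r.
  move=> /(_ isT) mis; have := @bichromatic_le_cutset _ _ (@owner R M) s (@live R M) c sK slive.
  have -> : [set h | live h && (c (owner (s h)) != c (owner h))]
      = mismatches s id (on_half_edges false c).
    apply/setP => h; rewrite !inE !ffunE slive; by case: (live h).
  rewrite -(ler_nat R) natrM; lra.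
Qed.

End GoodPairing.

Section TwoCommunityPairing.

Variables (R : realType) (G : two_communities).
Hypothesis degree_ge3 : forall v : 'I_(tc_n G), (3 <= tc_deg v)%N.
Local Notation H := (tc_half_edge G).
Local Notation side := (@tc_side G).

Lemma card_tc_owner v : #|[set h : H | tc_src h == v]| = tc_deg v.
Proof.
have := @card_tag_fiber _ (fun v : 'I_(tc_n G) => 'I_(tc_deg v)) v predT predT (fun=> erefl).
rewrite cardsT card_ord => <-; apply: eq_card => h.
by rewrite !inE andbT.
Qed.

Lemma card_tc_side i : #|[set h : H | side h == i]| = tc_N G i.
Proof.
rewrite -sum1_card (partition_big (@tc_src G) (mem (community (@tc_comm G) i))) /=; last first.
  by move=> h; rewrite !inE.
apply: eq_bigr => v; rewrite inE => vi; rewrite -card_tc_owner sum1_card; apply: eq_card => h.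
by rewrite unfold_in /= !inE /tc_side; case: (tc_src h =P v) => [->|]; rewrite ?andbF // vi.
Qed.

Lemma tc_outgoing_gt0 : (0 < #|tc_outgoing G|)%N.
Proof.
have sub i : exists B : {set H}, B \subset [set h | side h == i] /\ #|B| = tc_p G.
  have : (0 < #|[set B : {set H} | B \subset [set h | side h == i] & #|B| == tc_p G]|)%N.
    by rewrite cards_draws bin_gt0 card_tc_side; apply: tc_p_le.
  by case/card_gt0P => B; rewrite inE => /andP[? /eqP]; exists B.
have [B BP] := boolp.choice sub.
apply/card_gt0P; exists [set h | h \in B (side h)]; rewrite inE; apply/forallP => i; apply/eqP.
have [/fintype.subsetP Bi <-] := BP i; apply: eq_card => h; rewrite !inE.
by apply/andP/idP => [[? /eqP <-]//|hB]; have := Bi h hB; rewrite inE => /eqP ->.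
Qed.

Lemma card_outgoing (O : {set H}) i b : O \in tc_outgoing G ->
  #|[set h | (side h, h \in O) == (i, b)]| = if b then tc_p G else (tc_N G i - tc_p G)%N.
Proof.
rewrite inE => /forallP/(_ i)/eqP Oi.
have outE : #|[set h | (side h, h \in O) == (i, true)]| = tc_p G.
  by rewrite -Oi; apply: eq_card => h; rewrite !inE xpair_eqE eqb_id andbC.
case: b => //; rewrite -card_tc_side -(cardsID O [set h | side h == i]) -outE.
have -> : [set h | side h == i] :&: O = [set h | (side h, h \in O) == (i, true)].
  by apply/setP => h; rewrite !inE xpair_eqE eqb_id.
rewrite addKn; apply: eq_card => h; rewrite !inE xpair_eqE eqbF_neg andbC //.
Qed.

Lemma tc_matchings_gt0 (O : {set H}) : O \in tc_outgoing G -> (0 < #|tc_matchings O|)%N.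
Proof.
move=> OO; pose tau (k : 'I_2 * bool) := (if k.2 then rev_ord k.1 else k.1, k.2).
have tauK : involutive tau by case=> i [] //=; rewrite /tau /= rev_ordK.
have [||s sm sP] := @matching_exists _ _ (fun h => (side h, h \in O)) tau tauK.
- by case=> i []; rewrite /tau !card_outgoing.
- case=> i [] _; rewrite card_outgoing //; first exact: tc_p_even.
  rewrite oddB ?negb_add; last exact: tc_p_le.
  by have /negbTE := @tc_even G i; rewrite -/(tc_N G i) => ->; rewrite (negbTE (tc_p_even G)).
apply/card_gt0P; exists s; rewrite inE sm /=; apply/forallP => h.
have [-> ->] := sP h; rewrite eqxx /=; case: (h \in O); last by rewrite eqxx.
by rewrite eqb_id; case: (side h) => -[|[|//]] ?.
Qed.

Lemma tc_matchings_conj (g t : {perm H}) (O : {set H}) :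
  (forall h, side (g h) = side h) ->
  ((t ^ g)%g \in tc_matchings (g @: O)) = (t \in tc_matchings O).
Proof.
move=> gs; have tg h : (t ^ g)%g (g h) = g (t h) by rewrite conjgE !permM permK.
have gO h : (g h \in g @: O) = (h \in O) by rewrite mem_imset //; apply: perm_inj.
rewrite !inE; congr andb.
  apply/forallP/forallP => E h; last first.
    by rewrite -(permKV g h); move: (g^-1 h)%g => k; rewrite !tg !(inj_eq perm_inj).
  by have := E (g h); rewrite !tg !(inj_eq perm_inj).
apply/forallP/forallP => E h; first by have := E (g h); rewrite !tg !gO !gs.
by rewrite -(permKV g h); move: (g^-1 h)%g => k; rewrite !tg !gO !gs.
Qed.

Definition tc_slot (p : 'I_(tc_n G) * 'I_3) : H :=
  Tagged (fun v : 'I_(tc_n G) => 'I_(tc_deg v)) (widen_ord (degree_ge3 p.1) p.2).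

Lemma tc_slot_inj : injective tc_slot.
Proof.
move=> [v j] [w k] E; have vw : v = w := congr1 tag E; subst w; congr (_, _).
have := @eq_Tagged _ (fun v : 'I_(tc_n G) => 'I_(tc_deg v) : eqType) (tc_slot (v, j)) (widen_ord (degree_ge3 v) k).
rewrite [X in X == _]E eqxx /tc_slot /= => /esym/eqP /(congr1 val) /= jk.
exact: val_inj.
Qed.

Lemma tc_law_conj (g s : {perm H}) : (forall h, side (g h) = side h) ->
  two_stage_law R (tc_outgoing G) (@tc_matchings G) (s ^ g)%g
  = two_stage_law R (tc_outgoing G) (@tc_matchings G) s.
Proof.
move=> gs; apply: (@two_stage_law_conj _ _ _ _ _ _ (fun O : {set H} => g @: O)).
- exact: imset_inj perm_inj.
- move=> O; rewrite !inE; apply: eq_forallb => i; congr (_ == _).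
  rewrite -[RHS](card_imset _ (@perm_inj _ g)); apply: eq_card => h.
  rewrite -(permKV g h); move: (g^-1 h)%g => k.
  by rewrite [RHS]mem_imset ?inE ?mem_imset ?gs //; apply: perm_inj.
- by move=> O t; apply: tc_matchings_conj.
Qed.

(** All half-edges are live: permuting the half-edges of a community permutes the
    admissible outgoing sets and their matchings. *)
Definition tc_pairing : random_pairing R.
Proof.
refine (@RandomPairing R 'I_(tc_n G) 'I_2 H (@tc_comm G) (@tc_src G) predT tc_slot tc_slot_inj
  (fun p => erefl) (fun p => isT) (two_stage_law R (tc_outgoing G) (@tc_matchings G)) _ _ _ _).
- exact: two_stage_law_ge0.
- by apply: two_stage_law_total; [exact: tc_outgoing_gt0|exact: tc_matchings_gt0].
- move=> g s gk; apply: tc_law_conj => h; have := gk h; by case.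
- by move=> s /two_stage_law_support[B _]; rewrite inE => /andP[].
Defined.

Lemma tc_crossing s i : two_stage_law R (tc_outgoing G) (@tc_matchings G) s != 0 ->
  #|[set h | (tc_comm (tc_src h) == i) && ~~ within (@tc_comm G) (@tc_src G) s h]| = tc_p G.
Proof.
move/two_stage_law_support => [B BO]; rewrite inE => /andP[_ /forallP sB].
rewrite -(card_outgoing i true BO); apply: eq_card => h; rewrite !inE xpair_eqE eqb_id.
by have /andP[_ /eqP <-] := sB h.
Qed.

Lemma tc_probE (ev : 'M[R]_(tc_n G) -> Prop) :
  tc_prob ev = Pr (M := tc_pairing) (fun s => `[< ev (srw R (@tc_src G) s) >]).
Proof. exact: unif_mean_two_stage. Qed.

End TwoCommunityPairing.

Lemma card_gt1_of_blocks (n m : nat) (comm : 'I_n -> 'I_m) (i j : 'I_m) : i != j ->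
  (0 < #|community comm i|)%N -> (0 < #|community comm j|)%N -> (1 < n)%N.
Proof.
move=> ij /card_gt0P[v vi] /card_gt0P[w wj]; rewrite -[n]card_ord (cardD1 v) inE (cardD1 w) !inE /=.
by case: eqP => [wv|]; first by move: vi wj ij; rewrite !inE wv => /eqP -> ->.
Qed.

(** A bound for 2 D (K + K') alpha, where K and K' are the constants of [srw_relaxation];
    the summand 1 makes it at least 1, for the lower bound. *)
Definition walk_constant (R : realType) (D : nat) (rho dL dS dD : R) : R :=
  2 * D%:R * (2 * ((24 * D%:R / dS ^+ 2 + 48 * D%:R / dL ^+ 2 + 6) *
      (D%:R + (288 * D%:R ^+ 2 / dS ^+ 2 + 72 + 8 * D%:R ^+ 2 / dL ^+ 2))) / rho
    + 8 * D%:R / dD ^+ 2) + 1.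

Lemma walk_constant_gt0 (R : realType) (D : nat) (rho dL dS dD : R) : 0 < rho ->
  0 < walk_constant D rho dL dS dD.
Proof.
move=> rho0; rewrite /walk_constant; have D0 : 0 <= D%:R :> R by [].
have q (k x y : R) : 0 <= k -> 0 <= x -> 0 <= k * x / y ^+ 2.
  by move=> k0 x0; rewrite divr_ge0 ?sqr_ge0 // mulr_ge0.
have q1 := q 24 D%:R dS (ler0n _ _) D0; have q2 := q 48 D%:R dL (ler0n _ _) D0.
have q3 := q 288 (D%:R ^+ 2) dS (ler0n _ _) (sqr_ge0 _).
have q4 := q 8 (D%:R ^+ 2) dL (ler0n _ _) (sqr_ge0 _).
have q5 := q 8 D%:R dD (ler0n _ _) D0.
move: q1 q2 q3 q4 q5.
move: (24 * _ / _) (48 * _ / _) (288 * _ / _) (8 * D%:R ^+ 2 / _) (8 * D%:R / _) => x1 x2 x3 x4 x5.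
move=> q1 q2 q3 q4 q5; have q6 : 0 <= (x1 + x2 + 6) * (D%:R + (x3 + 72 + x4)).
  by apply: mulr_ge0; lra.
have q7 : 0 <= 2 * ((x1 + x2 + 6) * (D%:R + (x3 + 72 + x4))) / rho.
  by rewrite divr_ge0 ?(ltW rho0) // mulr_ge0.
have : 0 <= 2 * D%:R * (2 * ((x1 + x2 + 6) * (D%:R + (x3 + 72 + x4))) / rho + x5).
  by apply: mulr_ge0; [rewrite mulr_ge0|rewrite addr_ge0].
lra.
Qed.

Section TwoCommunityWalk.

Variables (R : realType) (G : two_communities) (D : nat) (rho : R).
Hypothesis degree_ge3 : forall v : 'I_(tc_n G), (3 <= tc_deg v)%N.
Hypothesis degree_le : forall v : 'I_(tc_n G), (tc_deg v <= D)%N.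
Hypothesis alpha_le1 : tc_alpha R G <= 1.
Hypotheses (rho_gt0 : 0 < rho) (n_gt0 : (0 < tc_n G)%N).
Hypothesis ratio : forall i, rho * (tc_n G)%:R <= #|community (@tc_comm G) i|%:R.
Local Notation H := (tc_half_edge G).
Local Notation src := (@tc_src G).
Local Notation comm := (@tc_comm G).
Local Notation p := (tc_p G).
Local Notation n := (tc_n G).
Local Notation M := (tc_pairing R degree_ge3).

Lemma tc_tame : tame 2 D rho M.
Proof.
split; first by rewrite card_ord.
  by move=> v; apply: leq_trans (degree_le v); rewrite -card_tc_owner.
by move=> i; rewrite card_ord; apply: le_trans (ratio i) _.
Qed.

Lemma tc_N_ge i : rho * n%:R <= (tc_N G i)%:R.
Proof.
apply: le_trans (ratio i) _; rewrite ler_nat -sum1_card; apply: leq_sum => v _.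
exact: leq_trans (degree_ge3 v).
Qed.

Lemma tc_N_le i : (tc_N G i)%:R <= D%:R * n%:R :> R.
Proof.
rewrite -natrM ler_nat /tc_N; apply: (@leq_trans (\sum_(v in community comm i) D)%N).
  by apply: leq_sum => v _; apply: degree_le.
rewrite sum_nat_const mulnC leq_mul2l; apply/orP; right.
by rewrite -[leqRHS]card_ord max_card.
Qed.

Lemma tc_D_gt0 : (0 < D)%N.
Proof. by apply: leq_trans (degree_le (Ordinal n_gt0)); apply: leq_trans (degree_ge3 _). Qed.

Lemma tc_N_gt0 i : 0 < (tc_N G i)%:R :> R.
Proof. by apply: lt_le_trans (tc_N_ge i); rewrite mulr_gt0 // ltr0n. Qed.

Lemma tc_rho_le1 : rho <= 1.
Proof.
have n0 : 0 < n%:R :> R by rewrite ltr0n.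
rewrite -(ler_pM2r n0) mul1r; apply: le_trans (ratio ord0) _.
by rewrite ler_nat -[leqRHS]card_ord max_card.
Qed.

(** The inequality p / N_i + p / N_j <= 1 leaves N_i - p >= N_i p / N_j.  So N_i - p is at
    least half of N_i, or p exceeds half of N_i and the right-hand side is of order n. *)
Lemma tc_internal_many i : rho ^+ 2 / (2 * D%:R) * n%:R <= (tc_N G i - p)%:R.
Proof.
have D0 : 0 < D%:R :> R by rewrite ltr0n tc_D_gt0.
have D1 : 1 <= D%:R :> R by rewrite ler1n tc_D_gt0.
have n0 : 0 < n%:R :> R by rewrite ltr0n.
have rho1 := tc_rho_le1.
have p0 : 0 <= p%:R :> R by [].
have [j ij alphaE] : exists2 j, j != i & tc_alpha R G = p%:R / (tc_N G i)%:R + p%:R / (tc_N G j)%:R.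
  exists (rev_ord i); first by case: i => -[|[|//]] ?.
  rewrite /tc_alpha big_ord_recl big_ord1.
  by case: i => -[|[|//]] ?; [congr (_ / _%:R + _ / _%:R)|rewrite addrC; congr (_ / _%:R + _ / _%:R)];
     congr tc_N; apply/val_inj.
have := alpha_le1; rewrite alphaE natrB ?tc_p_le //.
have Ni0 := tc_N_gt0 i; have Nj0 := tc_N_gt0 j.
have Ni := tc_N_ge i; have Nj := tc_N_le j.
set a := (tc_N G i)%:R in Ni0 Ni *; set b := (tc_N G j)%:R in Nj0 Nj *; set x : R := p%:R in p0 *.
move=> h.
have key : a - x >= a * (x / b).
  have -> : a - x = a * (1 - x / a) by rewrite mulrBr mulr1 mulrCA divff ?mulr1 // gt_eqF.
  rewrite ler_pM2l //; lra.
have bound : rho ^+ 2 / (2 * D%:R) * n%:R <= rho / D%:R * a / 2.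
  have -> : rho ^+ 2 / (2 * D%:R) * n%:R = rho / D%:R * (rho * n%:R) / 2.
    by field; rewrite gt_eqF.
  by rewrite ler_pM2r ?invr_gt0 // ler_pM2l // divr_gt0.
apply: le_trans bound _; have [small|large] := leP x (a / 2).
  have rD : rho / D%:R <= 1 by rewrite ler_pdivrMr // mul1r; lra.
  have := ler_wpM2r (ltW Ni0) rD; lra.
apply: le_trans _ key; rewrite [_ / D%:R * a]mulrC -mulrA ler_pM2l //.
rewrite ler_pdivlMr //; apply: le_trans (ltW large).
rewrite mulrAC ler_pM2r ?invr_gt0 //; apply: le_trans Ni.
apply: le_trans (_ : rho / D%:R * (D%:R * n%:R) <= _); first by rewrite ler_pM2l // divr_gt0.
by rewrite mulrA divfK // gt_eqF.
Qed.

(** The spectral gap is at most alpha by the cut between the communities.  Conversely the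
    constant n / p of the Poincare inequality is of order 1 / alpha. *)
Lemma tc_relaxation (s : {perm H}) (eps dL dS dD : R) :
  two_stage_law R (tc_outgoing G) (@tc_matchings G) s != 0 ->
  expanding comm src s predT D eps dL dS ->
  (forall c : {ffun 'I_n -> bool}, #|[set v | c v]|%:R <= eps * #|'I_n|%:R ->
     (p <= 4 * D * #|[set v | c v]|)%N ->
     dS * #|[set v | c v]|%:R <= #|cutset src s (within comm src s) c|%:R) ->
  eps <= rho ^+ 2 / (2 * D%:R) / (4 * D%:R) ->
  0 < dD -> dD <= dS -> dD <= dL / 2 -> dD <= rho ^+ 2 / (2 * D%:R) / 4 ->
  relaxation_bounds (walk_constant D rho dL dS dD) (tc_alpha R G) (srw R src s).
Proof.
move=> ls ex sw eps_le dD0 dDS dDL dDk.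
have crossing i := tc_crossing i ls.
have sK := expanding_inv ex; have D0n := tc_D_gt0.
have D0 : 0 < D%:R :> R by rewrite ltr0n.
have n0 : 0 < n%:R :> R by rewrite ltr0n.
have p0n : (0 < p)%N by apply: leq_trans (tc_p_ge2 G).
have p0 : 0 < p%:R :> R by rewrite ltr0n.
have a0 : 0 < tc_alpha R G.
  by rewrite /tc_alpha big_ord_recl big_ord1 addr_gt0 // divr_gt0 // tc_N_gt0.
have dL0 := expanding_dL ex; have dS0 := expanding_dS ex.
have [K1 K1E K1_0] : exists2 k : R, k = (24 * D%:R / dS ^+ 2 + 48 * D%:R / dL ^+ 2 + 6) *
      (D%:R + (288 * D%:R ^+ 2 / dS ^+ 2 + 72 + 8 * D%:R ^+ 2 / dL ^+ 2)) & 0 < k.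
  have q (k x y : R) : 0 <= k -> 0 <= x -> 0 <= k * x / y ^+ 2.
    by move=> k0 x0; rewrite divr_ge0 ?sqr_ge0 // mulr_ge0.
  have q1 := q 24 D%:R dS (ler0n _ _) (ltW D0); have q2 := q 48 D%:R dL (ler0n _ _) (ltW D0).
  have q3 := q 288 (D%:R ^+ 2) dS (ler0n _ _) (sqr_ge0 _).
  have q4 := q 8 (D%:R ^+ 2) dL (ler0n _ _) (sqr_ge0 _).
  eexists; first by [].
  move: q1 q2 q3 q4; move: (24 * _ / _) (48 * _ / _) (288 * _ / _) (8 * _ / _) => x1 x2 x3 x4.
  by move=> q1 q2 q3 q4; apply: mulr_gt0; lra.
pose K := K1 * n%:R / p%:R; have K0 : 0 < K by rewrite divr_gt0 // mulr_gt0.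
have [K' K'E K'0] : exists2 k : R, k = 8 * D%:R / dD ^+ 2 & 0 < k.
  by eexists; first by []; rewrite divr_gt0 ?mulr_gt0 ?exprn_gt0.
have wcE : walk_constant D rho dL dS dD = 2 * D%:R * (2 * K1 / rho + K') + 1.
  by rewrite /walk_constant K1E K'E.
have deg0 v : (0 < #|[set h : H | src h == v]|)%N.
  by rewrite card_tc_owner; apply: leq_trans (degree_ge3 v).
have degD v : (#|[set h : H | src h == v]| <= D)%N by rewrite card_tc_owner.
have poincare (g : 'I_n -> R) : exists a, \sum_v (g v - a) ^+ 2 <= K * energy src (src \o s) predT g.
  have [a] := two_blocks_poincare ex sw crossing g p0n.
  rewrite card_ord -K1E => h; exists a; rewrite /K -ler_pdivlMl // in h *.
  by apply: le_trans h _; apply: le_of_eq; field; rewrite gt_eqF.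
have signless (f : 'I_n -> R) :
    \sum_v f v ^+ 2 <= K' * \sum_h (f (src h) + f (src (s h))) ^+ 2.
  rewrite K'E; apply: (sum_square_le_signless_energy ex) eps_le _ _ _ _ => // i.
  rewrite card_ord; apply: le_trans (tc_internal_many i) _; rewrite ler_nat.
  rewrite -(crossing i) -card_tc_side.
  rewrite -(cardsID [set h | ~~ within comm src s h] [set h : H | tc_side h == i]).
  have -> : [set h : H | tc_side h == i] :&: [set h | ~~ within comm src s h]
      = [set h | (comm (src h) == i) && ~~ within comm src s h].
    by apply/setP => h; rewrite !inE.
  rewrite addKn; apply/subset_leq_card/fintype.subsetP => h; rewrite !inE negbK /within.
  by rewrite /tc_side => /andP[/eqP -> /eqP ->]; rewrite eqxx.
have n1 : (1 < n)%N.
  by apply: (@card_gt1_of_blocks _ _ comm ord0 ord_max) => //;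
     rewrite -(ltr_nat R); apply: lt_le_trans (ratio _); rewrite mulr_gt0.
have [gap gap0 [irr trelE rel_abs abs_le cut_le]] :=
  srw_relaxation sK deg0 degD K0 K'0 poincare signless n1.
have C1 : 1 <= walk_constant D rho dL dS dD.
  have q1 : 0 <= 2 * K1 / rho by rewrite divr_ge0 ?(ltW rho_gt0) // mulr_ge0 // ltW.
  by rewrite wcE lerDr mulr_ge0 ?addr_ge0 ?(ltW K'0) // mulr_ge0.
have degN i : \sum_(v in community comm i) deg R src v = (tc_N G i)%:R.
  by rewrite /tc_N natr_sum; apply: eq_bigr => v _; rewrite /deg card_tc_owner.
have gap_le : gap <= tc_alpha R G.
  have compl : ~: community comm ord0 = community comm ord_max.
    by apply/setP => v; rewrite !inE; case: (comm v) => -[|[|//]] ?.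
  have := cut_le (community comm ord0); rewrite compl !degN.
  move=> /(_ (tc_N_gt0 _) (tc_N_gt0 _)) h; apply: le_trans h _.
  have -> : tc_alpha R G = p%:R / (tc_N G ord0)%:R + p%:R / (tc_N G ord_max)%:R.
    rewrite /tc_alpha big_ord_recl big_ord1; congr (_ + _ / (tc_N G _)%:R); exact/val_inj.
  have -> : #|cutset src s predT (mem (community comm ord0))| = p.
    rewrite -(crossing ord0); apply: eq_card => h; rewrite !inE /= /within.
    by case: (comm (src h) =P ord0) => //= ->.
  apply: le_of_eq; field.
  by rewrite !gt_eqF ?tc_N_gt0.
split=> //.
  rewrite trelE lef_pV2 ?posrE ?mulr_gt0 //; last by lra.
  by apply: le_trans gap_le _; rewrite ler_peMl // ltW.
apply: le_trans abs_le _; rewrite ler_pdivlMr //.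
have KA : K * tc_alpha R G <= 2 * K1 / rho.
  have aN i : p%:R / (tc_N G i)%:R <= p%:R / (rho * n%:R) :> R.
    by rewrite ler_pM2l // lef_pV2 ?posrE ?tc_N_gt0 ?mulr_gt0 // tc_N_ge.
  have aU : tc_alpha R G <= 2 * (p%:R / (rho * n%:R)).
    rewrite /tc_alpha big_ord_recl big_ord1; have := aN ord0; have := aN (fintype.lift ord0 ord0); lra.
  apply: le_trans (ler_wpM2l (ltW K0) aU) _; rewrite /K; apply: le_of_eq.
  by field; rewrite !gt_eqF.
have K'A : K' * tc_alpha R G <= K' by rewrite ler_piMr // ltW.
have MA : Num.max K K' * tc_alpha R G <= 2 * K1 / rho + K'.
  have q1 : 0 <= 2 * K1 / rho by rewrite divr_ge0 ?(ltW rho_gt0) // mulr_ge0 // ltW.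
  have q2 := ltW K'0; have q3 := mulr_ge0 (ltW K0) (ltW a0).
  by rewrite /Num.max; case: ltP => _; lra.
rewrite -mulrA wcE.
have := ler_wpM2l (_ : 0 <= 2 * D%:R) MA; rewrite mulr_ge0 //; move=> /(_ isT); lra.
Qed.

End TwoCommunityWalk.

(** The crossing half-edges, 2 p in number, are the fixed points. *)
Definition along_within (G : two_communities) (s : {perm tc_half_edge G}) (h : tc_half_edge G) :=
  if within (@tc_comm G) (@tc_src G) s h then s h else h.

(** Three expansion events are needed: for spread colourings, for small sets, and for
    small sets with at least p / (4 D) vertices within their communities.  The last one
    comes from [small_expansion_whp] for [along_within], with Q = 2 p and Kp = 8 D. *)
Lemma two_communities_whp (R : realType) (D : nat) (rho : R) : (0 < D)%N -> 0 < rho ->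
  exists2 C : R, 0 < C & forall eta : R, 0 < eta -> exists n0 : nat,
    forall G : two_communities,
      (forall v : 'I_(tc_n G), (3 <= tc_deg v)%N) ->
      (forall v : 'I_(tc_n G), (tc_deg v <= D)%N) ->
      tc_alpha R G <= 1 ->
      (forall i, rho * (tc_n G)%:R <= #|community (@tc_comm G) i|%:R) ->
      (n0 <= tc_n G)%N ->
      1 - eta <= tc_prob (relaxation_bounds C (tc_alpha R G) (n := tc_n G)).
Proof.
move=> D0n rho0; have D0 : 0 < D%:R :> R by rewrite ltr0n.
have [epsS epsS0 whpS] := @small_expansion_whp R 2 D 0 rho rho0.
have [epsW epsW0 whpW] := @small_expansion_whp R 2 D (8 * D) rho rho0.
pose kap := rho ^+ 2 / (2 * D%:R).
have kap0 : 0 < kap by rewrite divr_gt0 ?exprn_gt0 ?mulr_gt0.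
pose eps := Num.min (Num.min epsS epsW) (Num.min (1 / 4) (kap / (4 * D%:R))).
have eps0 : 0 < eps by rewrite !lt_min epsS0 epsW0 !divr_gt0 // mulr_gt0.
have eps_S : eps <= epsS by rewrite /eps !ge_min lexx.
have eps_W : eps <= epsW by rewrite /eps !ge_min lexx orbT.
have eps_4 : eps <= 1 / 4 by rewrite /eps !ge_min lexx orbT.
have eps_k : eps <= kap / (4 * D%:R) by rewrite /eps !ge_min lexx !orbT.
have [dL dL0 whpL] := @large_expansion_whp R 2 D rho eps rho0 eps0 eps_4 D0n.
pose dS : R := 1 / 12; pose dD := Num.min dS (Num.min (dL / 2) (kap / 4)).
have dS0 : 0 < dS by rewrite divr_gt0.
have dL2 : 0 < dL / 2 by rewrite divr_gt0.
have kap4 : 0 < kap / 4 by apply: divr_gt0.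
have dD0 : 0 < dD by rewrite !lt_min dS0 dL2 kap4.
have dD_S : dD <= dS by rewrite /dD !ge_min lexx.
have dD_L : dD <= dL / 2 by rewrite /dD !ge_min lexx orbT.
have dD_k : dD <= kap / 4 by rewrite /dD !ge_min lexx !orbT.
exists (walk_constant D rho dL dS dD); first exact: walk_constant_gt0.
move=> eta eta0; have eta3 : 0 < eta / 3 by rewrite divr_gt0.
have [nS nSP] := whpS _ eta3; have [nW nWP] := whpW _ eta3; have [nL nLP] := whpL _ eta3.
exists (maxn nS (maxn nW nL)).+1 => G deg3 degD alpha1 ratio n_ge.
have n0 : (0 < tc_n G)%N := leq_ltn_trans (leq0n _) n_ge.
move: n_ge; rewrite !gtn_max => /and3P[/ltnW nSn /ltnW nWn /ltnW nLn].
pose M := tc_pairing R deg3; rewrite (tc_probE deg3).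
have tm : tame 2 D rho M by apply: tc_tame.
have lawE (s : {perm half_edge M}) : law s != 0 ->
  two_stage_law R (tc_outgoing G) (@tc_matchings G) s != 0 by [].
have match_ (s : {perm half_edge M}) : law s != 0 -> perfect_matching s by apply: law_matching.
have sK (s : {perm half_edge M}) : law s != 0 -> involutive s.
  by move=> /match_ /forallP sP h; have /andP[_ /eqP] := sP h.
have cardM : #|vertex M| = tc_n G by rewrite card_ord.
have withinS (s : {perm half_edge M}) h : involutive s ->
    within (@tc_comm G) (@tc_src G) s (s h) = within (@tc_comm G) (@tc_src G) s h.
  by move=> sI; rewrite /within sI eq_sym.
pose phiS (s : {perm half_edge M}) : half_edge M -> half_edge M := s.
pose phiW (s : {perm half_edge M}) : half_edge M -> half_edge M := @along_within G s.
have badS : Pr (M := M) (fun s => ~~ small_expansion phiS epsS (1 / 6) 0 0 s) <= eta / 3.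
  apply: nSP => //; first by rewrite cardM.
  - by move=> g s h _; rewrite /phiS conjgE !permM permK.
  - move=> s /match_ /forallP sP; rewrite leqn0 cards_eq0; apply/eqP/setP => h.
    by rewrite !inE; have /andP[/negbTE] := sP h.
have badW : Pr (M := M) (fun s => ~~ small_expansion phiW epsW (1 / 6) (8 * D) (2 * tc_p G) s) <= eta / 3.
  apply: nWP => //; first by rewrite cardM.
  - move=> s ls h; have sI := sK s ls; rewrite /phiW /along_within.
    have [w|/negbTE w] := boolP (within (@tc_comm G) (@tc_src G) s h); last by rewrite w.
    by rewrite withinS // w sI.
  - move=> g s h gk; rewrite /phiW /along_within /within.
    have gs k : tc_comm (tc_src (g k)) = tc_comm (tc_src k) by have := gk k; case.
    have tg k : (s ^ g)%g (g k) = g (s k) by rewrite conjgE !permM permK.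
    by rewrite tg !gs; case: ifP.
  - move=> s ls; have sP := match_ s ls.
    apply: (@leq_trans #|[set h | ~~ within (@tc_comm G) (@tc_src G) s h]|).
      apply/subset_leq_card/fintype.subsetP => h; rewrite !inE /phiW /along_within.
      by case: ifP => // _; have /forallP/(_ h)/andP[/negbTE ->] := sP.
    rewrite -sum1_card (partition_big (fun h : tc_half_edge G => tc_comm (tc_src h)) predT) //=.
    rewrite (eq_bigr (fun=> tc_p G)); last first.
      move=> i _; rewrite -(tc_crossing i (lawE s ls)) sum1_card; apply: eq_card => h.
      by rewrite unfold_in /= !inE andbC.
    by rewrite sum_nat_const card_ord.
have badL : Pr (M := M) (fun s => ~~ @large_expansion R M eps dL s) <= eta / 3.
  by apply: nLP => //; rewrite cardM.
have goodP := Pr_and_ge (Pr_and_ge (Pr_ge badS) badW) badL.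
rewrite (_ : eta / 3 + eta / 3 + eta / 3 = eta) in goodP; last by field.
apply: le_trans goodP _; apply: Pr_le => s ls /andP[/andP[gS gW] gL]; apply/asboolP.
have rk : eps < 1 / 2 by apply: le_lt_trans eps_4 _; lra.
have V0 : (0 < #|vertex M|)%N by rewrite cardM.
have ex := @expanding_of_good R M 2 D rho eps epsS dL tm rho0 V0 D0n eps0 rk eps_S dL0 s ls
  (fun h => erefl) gL gS.
apply: (tc_relaxation deg3 degD alpha1 rho0 n0 ratio (lawE s ls) ex) => //.
move=> c cn pc; have [->|c0] := posnP #|[set v | c v]|; first by rewrite mulr0.
have /forallP/(_ c)/implyP := gW; rewrite c0 /=.
have -> : #|[set v | c v]|%:R <= epsW * #|vertex M|%:R.
  by apply: le_trans cn _; rewrite ler_wpM2r.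
have -> : (2 * tc_p G <= 8 * D * #|[set v | c v]|)%N.
  by move: pc; rewrite -(leq_pmul2l (isT : 0 < 2)%N) !mulnA.
move=> /(_ isT) mis.
have := @bichromatic_le_cutset _ _ (@tc_src G) s (within (@tc_comm G) (@tc_src G) s) c
  (sK s ls) (fun h => withinS s h (sK s ls)).
have -> : [set h | within (@tc_comm G) (@tc_src G) s h && (c (tc_src (s h)) != c (tc_src h))]
    = mismatches (phiW s) id (@on_half_edges R M bool false c).
  apply/setP => h; rewrite !inE !ffunE /= /phiW /along_within.
  by case: ifP => // _; rewrite eqxx.
rewrite -(ler_nat R) natrM /dS; lra.
Qed.

(** * Several communities *)

(** Read a list with e j copies of each j along an enumeration of O. *)
Lemma function_with_fibers (H C : finType) (c0 : C) (O : {set H}) (e : C -> nat) :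
  (\sum_j e j)%N = #|O| ->
  exists f : H -> C, forall j, #|[set h in O | f h == j]| = e j.
Proof.
move=> eO; pose t := flatten [seq nseq (e j) j | j <- enum C].
have size_t : size t = #|O|.
  rewrite size_flatten /shape -map_comp sumnE big_map -eO big_enum /=.
  by apply: eq_bigr => j _; rewrite /= size_nseq.
pose f h := nth c0 t (index h (enum O)).
have mapE : [seq f h | h <- enum O] = t.
  apply: (@eq_from_nth _ c0); first by rewrite size_map -cardE size_t.
  move=> i; rewrite size_map -cardE => iO.
  have [h0 _] : exists h0, h0 \in O by apply/card_gt0P; apply: leq_ltn_trans iO.
  by rewrite (nth_map h0) -?cardE // /f index_uniq ?enum_uniq // -cardE.
exists f => j; transitivity (count_mem j t).
  rewrite -mapE count_map cardE -size_filter; congr size.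
  rewrite /enum_mem -filter_predI; apply: eq_filter => h; rewrite /= !inE andbC //.
rewrite /t count_flatten -map_comp sumnE big_map big_enum /= (bigD1 j) //=.
rewrite count_nseq /= eqxx mul1n big1 ?addn0 // => i ij.
by rewrite /= count_nseq /= (negbTE ij).
Qed.

Section ManyCommunityPairing.

Variables (R : realType) (m : nat) (G : m_communities m).
Hypothesis int_ge3 : forall v : 'I_(mc_n G), (3 <= mc_int v)%N.
Local Notation H := (mc_half_edge G).
Local Notation side := (@mc_side m G).
Local Notation internal := (@mc_internal m G).

Lemma card_mc_fiber (v : 'I_(mc_n G)) (Q : pred ('I_(mc_int v) + 'I_(mc_out v))%type) (S : pred H) :
  (forall x, S (Tagged (fun v => ('I_(mc_int v) + 'I_(mc_out v))%type) x) = Q x) ->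
  #|[set h : H | (mc_src h == v) && S h]| = #|[set x | Q x]|.
Proof.
exact: (@card_tag_fiber _ (fun v : 'I_(mc_n G) => ('I_(mc_int v) + 'I_(mc_out v))%type : finType)).
Qed.

Lemma card_mc_owner v : #|[set h : H | mc_src h == v]| = (mc_int v + mc_out v)%N.
Proof.
have := @card_mc_fiber v predT predT (fun=> erefl).
rewrite cardsT card_sum !card_ord => <-; apply: eq_card => h.
by rewrite !inE andbT.
Qed.

Lemma card_mc_internal v : #|[set h : H | (mc_src h == v) && internal h]| = mc_int v.
Proof.
pose Q (x : 'I_(mc_int v) + 'I_(mc_out v)) := if x is inl _ then true else false.
rewrite (@card_mc_fiber v Q) // -[RHS]card_ord -cardsT.
rewrite -[RHS](card_imset _ (_ : injective (@inl _ 'I_(mc_out v)))); last by move=> x y [].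
apply: eq_card => -[x|y]; rewrite !inE /=; first by apply/esym/imsetP; exists x; rewrite ?inE.
by apply/esym/imsetP => -[].
Qed.

Lemma card_mc_outer v : #|[set h : H | (mc_src h == v) && ~~ internal h]| = mc_out v.
Proof.
have := cardsID [set h | internal h] [set h : H | mc_src h == v].
rewrite card_mc_owner -[in RHS](card_mc_internal v).
have -> : [set h : H | mc_src h == v] :&: [set h | internal h]
    = [set h : H | (mc_src h == v) && internal h] by apply/setP => h; rewrite !inE.
move/eqP; rewrite eqn_add2l => /eqP <-; apply: eq_card => h; rewrite !inE andbC //.
Qed.

Lemma card_mc_side (S : pred H) (f : 'I_(mc_n G) -> nat) i :
  (forall v, #|[set h : H | (mc_src h == v) && S h]| = f v) ->
  #|[set h : H | (side h == i) && S h]| = (\sum_(v in community (@mc_comm m G) i) f v)%N.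
Proof.
move=> fE; rewrite -sum1_card (partition_big (@mc_src m G) (mem (community (@mc_comm m G) i))) /=.
  apply: eq_bigr => v; rewrite inE => vi; rewrite -fE sum1_card; apply: eq_card => h.
  by rewrite unfold_in /= !inE /mc_side; case: (mc_src h =P v) => [->|]; rewrite ?andbF ?andbT // vi.
by move=> h; rewrite !inE => /andP[].
Qed.

Lemma card_mc_side_internal i : #|[set h : H | (side h == i) && internal h]| = mc_E G i i.
Proof. by rewrite (card_mc_side i card_mc_internal) mc_E_int. Qed.

Lemma labelling_card (l : {ffun H -> 'I_m}) i j : l \in mc_labellings G ->
  #|[set h | (side h, l h) == (i, j)]| = mc_E G i j.
Proof.
rewrite inE => /andP[/forallP li /forallP lE]; have [->|ji] := eqVneq j i.
  rewrite -card_mc_side_internal; apply: eq_card => h; rewrite !inE xpair_eqE.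
  by have /eqP <- := li h; case: (side h =P i) => [->|].
have /forallP/(_ j)/implyP/(_ ji)/eqP <- := lE i.
by apply: eq_card => h; rewrite !inE xpair_eqE.
Qed.

Lemma mc_labellings_gt0 : (0 < #|mc_labellings G|)%N.
Proof.
have fiber i : exists f : H -> 'I_m, forall j,
    #|[set h in [set h | (side h == i) && ~~ internal h] | f h == j]|
    = if j == i then 0%N else mc_E G i j.
  apply: function_with_fibers => //.
  rewrite (card_mc_side i card_mc_outer) -mc_E_out [RHS]big_mkcond.
  by apply: eq_bigr => j _; case: (j == i).
have [f fP] := boolp.choice fiber.
pose l : {ffun H -> 'I_m} := [ffun h => if internal h then side h else f (side h) h].
have out h : ~~ internal h -> f (side h) h != side h.
  move=> hi; apply/negP => /eqP E; have := fP (side h) (side h); rewrite eqxx => /eqP.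
  rewrite cards_eq0 => /eqP/setP/(_ h); rewrite !inE eqxx hi E eqxx //.
apply/card_gt0P; exists l; rewrite inE; apply/andP; split.
  apply/forallP => h; rewrite ffunE; case: (boolP (internal h)) => hi; first by rewrite eqxx.
  by rewrite (negbTE (out h hi)).
apply/forallP => i; apply/forallP => j; apply/implyP => ji; apply/eqP.
have := fP i j; rewrite (negbTE ji) => <-; apply: eq_card => h; rewrite !inE ffunE.
case: (side h =P i) => //= hi; rewrite hi; case: (boolP (internal h)) => //= _.
by rewrite eq_sym (negbTE ji).
Qed.

Lemma mc_matchings_gt0 (l : {ffun H -> 'I_m}) : l \in mc_labellings G -> (0 < #|mc_matchings l|)%N.
Proof.
move=> ll; pose tau (k : 'I_m * 'I_m) := (k.2, k.1).
have tauK : involutive tau by case.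
have [||s sm sP] := @matching_exists _ _ (fun h => (side h, l h)) tau tauK.
- by case=> i j; rewrite /tau /= !labelling_card // -[in LHS]mc_E_sym mxE.
- by case=> i j [-> _]; rewrite labelling_card // mc_E_even.
apply/card_gt0P; exists s; rewrite inE sm /=; apply/forallP => h.
by have [-> ->] := sP h; rewrite !eqxx.
Qed.

Definition relabel (g : {perm H}) (l : {ffun H -> 'I_m}) : {ffun H -> 'I_m} :=
  [ffun h => l (g^-1 h)%g].

Lemma relabel_perm g l h : relabel g l (g h) = l h.
Proof. by rewrite ffunE permK. Qed.

Lemma mc_law_conj (g s : {perm H}) :
  (forall h, side (g h) = side h) -> (forall h, internal (g h) = internal h) ->
  two_stage_law R (mc_labellings G) (@mc_matchings m G) (s ^ g)%g
  = two_stage_law R (mc_labellings G) (@mc_matchings m G) s.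
Proof.
move=> gs gi; apply: (@two_stage_law_conj _ _ _ _ _ _ (relabel g)).
- move=> l l' E; apply/ffunP => h.
  by rewrite -(relabel_perm g l) E relabel_perm.
- move=> l; rewrite !inE; congr andb.
    apply/forallP/forallP => Q h; first by have := Q (g h); rewrite relabel_perm gs gi.
    by rewrite -(permKV g h); move: (g^-1 h)%g => k; rewrite relabel_perm gs gi.
  apply: eq_forallb => i; apply: eq_forallb => j; congr (_ ==> (_ == _)).
  rewrite -[RHS](card_imset _ (@perm_inj _ g)); apply: eq_card => h.
  rewrite -(permKV g h); move: (g^-1 h)%g => k.
  by rewrite [RHS]mem_imset ?inE ?relabel_perm ?gs //; apply: perm_inj.
move=> l t; have tg h : (t ^ g)%g (g h) = g (t h) by rewrite conjgE !permM permK.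
rewrite !inE; congr andb.
  apply/forallP/forallP => Q h; first by have := Q (g h); rewrite !tg !(inj_eq perm_inj).
  by rewrite -(permKV g h); move: (g^-1 h)%g => k; rewrite !tg !(inj_eq perm_inj).
apply/forallP/forallP => Q h; first by have := Q (g h); rewrite !tg !relabel_perm !gs.
by rewrite -(permKV g h); move: (g^-1 h)%g => k; rewrite !tg !relabel_perm !gs.
Qed.

Definition mc_slot (p : 'I_(mc_n G) * 'I_3) : H :=
  Tagged (fun v : 'I_(mc_n G) => ('I_(mc_int v) + 'I_(mc_out v))%type)
    (inl (widen_ord (int_ge3 p.1) p.2)).

Lemma mc_slot_inj : injective mc_slot.
Proof.
move=> [v j] [w k] E; have vw : v = w := congr1 tag E; subst w; congr (_, _).
have := @eq_Tagged _ (fun v : 'I_(mc_n G) => ('I_(mc_int v) + 'I_(mc_out v))%type : eqType)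
  (mc_slot (v, j)) (inl (widen_ord (int_ge3 v) k)).
rewrite [X in X == _]E eqxx /mc_slot /= => /esym/eqP [] jk.
exact: val_inj.
Qed.

(** Only internal half-edges are live, as a vertex may have no other ones. *)
Definition mc_pairing : random_pairing R.
Proof.
refine (@RandomPairing R 'I_(mc_n G) 'I_m H (@mc_comm m G) (@mc_src m G) internal
  mc_slot mc_slot_inj (fun p => erefl) (fun p => isT)
  (two_stage_law R (mc_labellings G) (@mc_matchings m G)) _ _ _ _).
- exact: two_stage_law_ge0.
- by apply: two_stage_law_total; [exact: mc_labellings_gt0|exact: mc_matchings_gt0].
- by move=> g s gk; apply: mc_law_conj => h; have := gk h; case.
- by move=> s /two_stage_law_support[l _]; rewrite inE => /andP[].
Defined.

Lemma mc_support (s : {perm H}) : two_stage_law R (mc_labellings G) (@mc_matchings m G) s != 0 ->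
  (forall i j, #|[set h | (side h == i) && (side (s h) == j)]| = mc_E G i j) /\
  (forall h, internal h = (side (s h) == side h)).
Proof.
move/two_stage_law_support => [l ll]; rewrite inE => /andP[_ /forallP sl].
have sE h : side (s h) = l h by have /andP[/eqP] := sl h.
split=> [i j|h].
  rewrite -(labelling_card i j ll); apply: eq_card => h.
  by rewrite !inE xpair_eqE sE.
by rewrite sE; move: ll; rewrite inE => /andP[/forallP/(_ h)/eqP].
Qed.

Lemma mc_probE (ev : 'M[R]_(mc_n G) -> Prop) :
  mc_prob ev = Pr (M := mc_pairing) (fun s => `[< ev (srw R (@mc_src m G) s) >]).
Proof. exact: unif_mean_two_stage. Qed.

End ManyCommunityPairing.

(** * The Cheeger constant of the quotient chain *)

Section QuotientChain.

Variables (R : realType) (m : nat) (G : m_communities m).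
Hypothesis m_ge2 : (2 <= m)%N.
Hypothesis Q_irreducible : irreducible (mc_Q R G).
Local Notation Q := (mc_Q R G).
Local Notation e i j := ((mc_E G i j)%:R : R).

Definition volume (i : 'I_m) : R := (\sum_l mc_E G i l)%:R.
Definition set_volume (A : {set 'I_m}) : R := \sum_(i in A) volume i.
Definition edges_out (A : {set 'I_m}) : R := \sum_(i in A) \sum_(j in ~: A) e i j.

Hypothesis volume_gt0 : forall i, 0 < volume i.

Lemma mc_E_C i j : mc_E G i j = mc_E G j i.
Proof. by rewrite -[in LHS]mc_E_sym mxE. Qed.

Lemma edges_outC A : edges_out (~: A) = edges_out A.
Proof.
rewrite /edges_out exchange_big /= finset.setCK; apply: eq_bigr => i _; apply: eq_bigr => j _.
by rewrite mc_E_C.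
Qed.

Lemma volumeE i : volume i = \sum_j e i j.
Proof. by rewrite /volume natr_sum. Qed.

Lemma mc_Q_ge0 i j : 0 <= Q i j.
Proof. by rewrite mxE divr_ge0. Qed.

Lemma mc_Q_pow_ge0 t i j : 0 <= (Q ^+ t) i j.
Proof.
elim: t i j => [|t IH] i j; first by rewrite expr0 mxE ler0n.
by rewrite exprSr mxE sumr_ge0 // => k _; rewrite mulr_ge0 // mc_Q_ge0.
Qed.

Lemma closed_class (S : pred 'I_m) i : S i ->
  (forall k j, S k -> 0 < e k j -> S j) -> forall j, S j.
Proof.
move=> Si closed j; have [t] := Q_irreducible i j.
elim: t j => [|t IH] j; first by rewrite expr0 mxE; case: eqP => [<-|_] //; rewrite ltxx.
rewrite exprSr mxE => sum_gt0.
have [k /andP[k1 k2]|none] := pickP (fun k => (0 < (Q ^+ t) i k) && (0 < Q k j)).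
  apply: closed (IH k k1) _; move: k2; rewrite mxE pmulr_lgt0 // invr_gt0; exact: volume_gt0.
move: sum_gt0; rewrite big1 ?ltxx // => k _; have := none k.
rewrite !lt0r mc_Q_pow_ge0 mc_Q_ge0 !andbT => /negbT; rewrite negb_and !negbK.
by case/orP => /eqP ->; rewrite ?mul0r ?mulr0.
Qed.

Lemma set_volumeT_gt0 : 0 < set_volume [set: 'I_m].
Proof.
have i0 : 'I_m by apply: Ordinal (ltnW m_ge2).
rewrite /set_volume (bigD1 i0) ?inE //= ltr_pwDl //.
by apply: sumr_ge0 => i _; apply: ltW.
Qed.

(** Since E is symmetric the volume is invariant for Q.  For any other invariant
    distribution, the density u with respect to the volume is harmonic, so it has no
    energy and is constant by irreducibility. *)
Lemma invariant_mc_Q : Defs.invariant Q = \row_i (volume i / set_volume [set: 'I_m]).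
Proof.
set T := set_volume _; have T0 : 0 < T := set_volumeT_gt0.
have TE : \sum_i volume i = T by rewrite /T /set_volume; apply: eq_bigl => i; rewrite inE.
pose pi0 : 'rV[R]_m := \row_i (volume i / T).
have pi0P : invariant_distribution Q pi0.
  split=> [x||].
  - by rewrite mxE divr_ge0 // ltW.
  - by rewrite (eq_bigr (fun i => volume i / T)) => [|i _]; rewrite ?mxE // -mulr_suml TE divff // gt_eqF.
  - apply/rowP => j; rewrite !mxE volumeE mulr_suml; apply: eq_bigr => i _.
    rewrite !mxE mc_E_C -/(volume i); field.
    by rewrite (gt_eqF T0) (gt_eqF (volume_gt0 i)).
rewrite /Defs.invariant; case: xgetP => [pi _ [pi_ge0 pi_sum piQ]|none]; last by case: (none pi0).
pose u i := pi 0 i / volume i.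
have piE i : pi 0 i = u i * volume i by rewrite /u divfK // gt_eqF.
have uE j : \sum_i u i * e i j = u j * volume j.
  rewrite -piE -[in RHS]piQ mxE; apply: eq_bigr => i _.
  by rewrite mxE -/(volume i) piE; field; rewrite (gt_eqF (volume_gt0 i)).
have energy0 : \sum_i \sum_j e i j * (u i - u j) ^+ 2 = 0.
  have -> : \sum_i \sum_j e i j * (u i - u j) ^+ 2 =
      \sum_i \sum_j e i j * u i ^+ 2 + \sum_i \sum_j e i j * u j ^+ 2 - 2 * \sum_j \sum_i u j * (u i * e i j).
    rewrite [\sum_j \sum_i u j * _]exchange_big mulr_sumr -big_split -sumrB /=; apply: eq_bigr => i _.
    by rewrite mulr_sumr -big_split -sumrB /=; apply: eq_bigr => j _; ring.
  have d1 : \sum_i \sum_j e i j * u i ^+ 2 = \sum_i volume i * u i ^+ 2.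
    by apply: eq_bigr => i _; rewrite volumeE mulr_suml.
  have d2 : \sum_i \sum_j e i j * u j ^+ 2 = \sum_i volume i * u i ^+ 2.
    rewrite exchange_big; apply: eq_bigr => j _; rewrite volumeE mulr_suml.
    by apply: eq_bigr => i _; rewrite mc_E_C.
  have d3 : \sum_j \sum_i u j * (u i * e i j) = \sum_i volume i * u i ^+ 2.
    by apply: eq_bigr => j _; rewrite -mulr_sumr uE; ring.
  by rewrite d1 d2 d3; ring.
have term_ge0 i j : 0 <= e i j * (u i - u j) ^+ 2 by rewrite mulr_ge0 ?sqr_ge0.
have i0 : 'I_m by apply: Ordinal (ltnW m_ge2).
have uc j : u j = u i0.
  apply/eqP; apply: (@closed_class (fun j => u j == u i0) i0) => // k l /eqP <- ekl.
  have := psumr_eq0P (fun i _ => sumr_ge0 _ (fun j _ => term_ge0 i j)) energy0 (i := k) isT.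
  move/(psumr_eq0P (fun j _ => term_ge0 k j))/(_ l isT)/eqP.
  by rewrite mulf_eq0 gt_eqF //= sqrf_eq0 subr_eq0 eq_sym.
have uT : u i0 * T = 1.
  rewrite -pi_sum -TE mulr_sumr; apply: eq_bigr => i _; by rewrite piE uc.
apply/rowP => i; rewrite mxE piE uc; apply: (mulIf (_ : T != 0)); first by rewrite gt_eqF.
by rewrite mulrAC uT mul1r divfK // gt_eqF.
Qed.

Local Notation T := (set_volume [set: 'I_m]).

Lemma set_volumeC A : set_volume A + set_volume (~: A) = T.
Proof.
rewrite /set_volume [RHS](bigID (mem A)) /=; congr (_ + _); apply: eq_bigl => i; by rewrite !inE.
Qed.

Lemma edges_out_le_volume A : edges_out A <= set_volume A.
Proof.
apply: ler_sum => i _; rewrite volumeE [leRHS](bigID (mem A)) /= addrC.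
rewrite (eq_bigl (fun j => j \notin A)) => [|j]; last by rewrite inE.
by rewrite lerDl sumr_ge0.
Qed.

Lemma cheegerE : cheeger Q = inf [set edges_out A / set_volume A | A in
  [set A : {set 'I_m} | 0 < set_volume A <= T / 2]]%classic.
Proof.
have T0 := set_volumeT_gt0.
rewrite /cheeger invariant_mc_Q.
have massE (A : {set 'I_m}) : \sum_(x in A) (\row_i (volume i / T)) 0 x = set_volume A / T.
  by rewrite /set_volume mulr_suml; apply: eq_bigr => x _; rewrite mxE.
have flowE (A : {set 'I_m}) : \sum_(x in A) \sum_(y in ~: A) (\row_i (volume i / T)) 0 x * Q x y = edges_out A / T.
  rewrite mulr_suml; apply: eq_bigr => x _; rewrite mulr_suml; apply: eq_bigr => y _.
  by rewrite !mxE -/(volume x); field; rewrite (gt_eqF T0) (gt_eqF (volume_gt0 x)).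
have cond A : (0 < set_volume A / T <= 2^-1) = (0 < set_volume A <= T / 2).
  by rewrite pmulr_lgt0 ?invr_gt0 // ler_pdivrMr // [2^-1 * _]mulrC.
have ratioE A : 0 < set_volume A <= T / 2 ->
    edges_out A / T / (set_volume A / T) = edges_out A / set_volume A.
  by move=> /andP[A0 _]; field; rewrite (gt_eqF A0) (gt_eqF T0).
congr inf; apply/seteqP; split=> _ [A /= AP <-]; exists A => //=.
- by move: AP; rewrite massE cond.
- by move: AP; rewrite massE cond flowE => /ratioE.
- by rewrite massE cond.
- by rewrite massE flowE ratioE.
Qed.

Lemma cheeger_le A : 0 < set_volume A -> set_volume A <= T / 2 ->
  cheeger Q * set_volume A <= edges_out A.
Proof.
move=> A0 A2; rewrite -ler_pdivlMr // cheegerE; apply: ge_inf.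
  by exists 0 => _ [B /= /andP[B0 _] <-]; rewrite divr_ge0 ?(ltW B0) // sumr_ge0 // => i _; rewrite sumr_ge0.
by exists A => //=; rewrite A0 A2.
Qed.

(** One of a singleton and its complement qualifies. *)
Lemma half_block : exists A : {set 'I_m}, 0 < set_volume A <= T / 2.
Proof.
pose A : {set 'I_m} := [set Ordinal (ltnW m_ge2)].
have vol1 i : 0 < set_volume [set i] by rewrite /set_volume big_set1.
have A0 := vol1 (Ordinal (ltnW m_ge2)); have := set_volumeC A; rewrite -/A in A0 *.
have A'0 : 0 < set_volume (~: A).
  rewrite /set_volume (bigD1 (Ordinal m_ge2)) /=; last by rewrite !inE.
  by rewrite ltr_pwDl // sumr_ge0 // => i _; apply: ltW.
move=> tot; have [h|h] := leP (set_volume A) (T / 2); first by exists A; rewrite A0 h.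
by exists (~: A); rewrite A'0 /=; lra.
Qed.

(** The minimum is attained, and a set without outgoing edges would be closed. *)
Lemma cheeger_gt0_le1 : 0 < cheeger Q <= 1.
Proof.
have T0 := set_volumeT_gt0.
have [A0 A0P] := half_block.
pose ok (A : {set 'I_m}) := 0 < set_volume A <= T / 2.
have [A Aok Amin] := @Order.TotalTheory.arg_minP _ _ _ A0 ok (fun A => edges_out A / set_volume A) A0P.
have cheeger_ge : edges_out A / set_volume A <= cheeger Q.
  rewrite cheegerE; apply: lb_le_inf; first by exists (edges_out A0 / set_volume A0), A0.
  by move=> _ [B /= Bok <-]; apply: Amin.
move: Aok => /andP[Apos A2].
apply/andP; split; last first.
  have := cheeger_le Apos A2; have := edges_out_le_volume A => h1 h2.
  by rewrite -(ler_pM2r Apos) mul1r; apply: le_trans h2 h1.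
apply: lt_le_trans cheeger_ge; rewrite divr_gt0 //.
rewrite lt0r sumr_ge0 ?andbT => [|i _]; last by rewrite sumr_ge0.
apply/negP => /eqP out0.
have [i iA] : exists i, i \in A.
  have [i iA|none] := pickP (fun i => i \in A); first by exists i.
  by move: Apos; rewrite /set_volume big_pred0 ?ltxx.
have allA : forall j, j \in A.
  apply: (@closed_class (fun j => j \in A) i iA) => k j kA ekj.
  apply/negPn/negP => jA; move: ekj; rewrite lt0r => /andP[/eqP + _]; apply.
  have sum0 := psumr_eq0P (fun i _ => sumr_ge0 _ (fun j _ => ler0n R (mc_E G i j))) out0 (i := k) kA.
  by apply: (psumr_eq0P _ sum0) => //; rewrite inE.
have AT : A = [set: 'I_m] by apply/setP => j; rewrite allA inE.
move: A2; rewrite AT; lra.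
Qed.

Lemma edges_out_ge (A : {set 'I_m}) (i j : 'I_m) (x : R) : i \in A -> j \notin A ->
  (forall k, x <= volume k) -> 0 <= x -> cheeger Q * x <= edges_out A.
Proof.
move=> iA jA xv x0; have /andP[c0 _] := cheeger_gt0_le1.
have volA (B : {set 'I_m}) k : k \in B -> x <= set_volume B.
  move=> kB; apply: le_trans (xv k) _; rewrite /set_volume (bigD1 k) //= lerDl.
  by apply: sumr_ge0 => l _; apply: ltW.
have vol0 (B : {set 'I_m}) k : k \in B -> 0 < set_volume B.
  move=> kB; rewrite /set_volume (bigD1 k) //= ltr_pwDl //.
  by apply: sumr_ge0 => l _; apply: ltW.
have jA' : j \in ~: A by rewrite inE.
have tot := set_volumeC A.
have [h|h] := leP (set_volume A) (T / 2).
  apply: le_trans (cheeger_le (vol0 A i iA) h); rewrite ler_pM2l //; exact: volA iA.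
rewrite -edges_outC; have h' : set_volume (~: A) <= T / 2 by lra.
apply: le_trans (cheeger_le (vol0 _ j jA') h'); rewrite ler_pM2l //; exact: volA jA'.
Qed.

(** Pigeonhole: m values cannot meet all of m + 1 consecutive intervals. *)
Lemma empty_interval (u : 'I_m -> R) (x y : R) : x < y -> exists t,
  [/\ x <= t, t + (y - x) / m.+1%:R <= y & forall k, ~~ ((t < u k) && (u k <= t + (y - x) / m.+1%:R))].
Proof.
move=> xy; pose d := (y - x) / m.+1%:R.
have d0 : 0 < d by rewrite divr_gt0 // subr_gt0.
pose t (l : 'I_m.+1) := x + l%:R * d.
have [l /forallP lP|none] := pickP (fun l : 'I_m.+1 => [forall k, ~~ ((t l < u k) && (u k <= t l + d))]).
  exists (t l); split=> //; first by rewrite /t lerDl mulr_ge0 // ltW.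
  have -> : t l + d = x + l.+1%:R * d by rewrite /t -natr1; ring.
  have -> : y = x + m.+1%:R * d by rewrite /d; field.
  by rewrite lerD2l ler_pM2r // ler_nat.
have hit l : exists k, (t l < u k) && (u k <= t l + d).
  have /negbT := none l; rewrite negb_forall => /existsP[k]; rewrite negbK => kP; by exists k.
have [f fP] := boolp.choice hit.
have inj : injective f.
  have half (l l' : 'I_m.+1) : f l = f l' -> (l <= l')%N.
    move=> ff; rewrite leqNgt; apply/negP => ll.
    have /andP[h1 _] := fP l; have /andP[_ h2] := fP l'; rewrite ff in h1.
    have : t l < t l' + d by apply: lt_le_trans h1 h2.
    have -> : t l' + d = x + l'.+1%:R * d by rewrite /t -natr1; ring.
    by rewrite /t ltrD2l ltr_pM2r // ltr_nat ltnNge ll.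
  by move=> l l' ff; apply/val_inj/eqP; rewrite eqn_leq !half.
by have := leq_card f inj; rewrite !card_ord ltnn.
Qed.

(** Cut the communities at an interval free of values of u, as given by
    [empty_interval].  All edges across this cut contribute to the right-hand side, and
    the Cheeger constant says that there are many. *)
Lemma spread_le_block_energy (u : 'I_m -> R) (i j : 'I_m) (x : R) :
  (forall k, x <= volume k) -> 0 <= x ->
  cheeger Q * x * (u i - u j) ^+ 2 <= m.+1%:R ^+ 2 * \sum_k \sum_l e k l * (u k - u l) ^+ 2.
Proof.
move=> xv x0; wlog ij : i j / u i <= u j.
  move=> W; have [h|/ltW h] := leP (u i) (u j); first exact: W.
  by have -> : (u i - u j) ^+ 2 = (u j - u i) ^+ 2 by [ring]; apply: W.
have F_ge0 k l : 0 <= e k l * (u k - u l) ^+ 2 by rewrite mulr_ge0 ?sqr_ge0.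
have /andP[c0 _] := cheeger_gt0_le1.
move: ij; rewrite le_eqVlt => /orP[/eqP ->|ij].
  rewrite subrr expr0n mulr0 mulr_ge0 ?sqr_ge0 // sumr_ge0 // => k _; exact: sumr_ge0.
have [t [it tj empty]] := empty_interval u ij; set d := (u j - u i) / _ in tj empty.
have d0 : 0 < d by rewrite divr_gt0 // subr_gt0.
pose A := [set k | t < u k].
have iA : i \notin A by rewrite inE -leNgt.
have jA : j \in A by rewrite inE; apply: lt_le_trans tj; rewrite ltrDl.
have out := edges_out_ge jA iA xv x0.
have cross : edges_out A * d ^+ 2 <= \sum_k \sum_l e k l * (u k - u l) ^+ 2.
  rewrite /edges_out mulr_suml [leRHS](bigID (mem A)) /=.
  apply: ler_wpDr; first by apply: sumr_ge0 => k _; apply: sumr_ge0.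
  apply: ler_sum => k kA; rewrite mulr_suml [leRHS](bigID (mem (~: A))) /=.
  apply: ler_wpDr; first exact: sumr_ge0.
  apply: ler_sum => l lA; rewrite ler_wpM2l //; apply: lerXn2r; rewrite ?nnegrE ?(ltW d0) //.
    by move: kA lA; rewrite !inE -leNgt; lra.
  have := empty k; move: kA lA; rewrite !inE -leNgt => -> /= lt; rewrite -ltNge; lra.
have -> : u i - u j = - (m.+1%:R * d) by rewrite /d; field.
rewrite sqrrN exprMn mulrCA ler_pM2l ?exprn_gt0 //.
by apply: le_trans _ cross; rewrite ler_wpM2r ?sqr_ge0.
Qed.

End QuotientChain.

(** * Poincare inequality for several communities *)

(** As [walk_constant], but at least 2 since the cuts only show gap <= 2 alpha. *)
Definition block_walk_constant (R : realType) (m D : nat) (rho dL dS dD : R) : R :=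
  2 * D%:R * (2 * (24 * D%:R / dS ^+ 2 + 24 * m%:R * D%:R / dL ^+ 2 + 6)
    + 2 * m.+1%:R ^+ 2 * (3 + 6 * D%:R * (24 * D%:R / dS ^+ 2 + 24 * m%:R * D%:R / dL ^+ 2 + 6)) / rho
    + 8 * D%:R / dD ^+ 2) + 2.

Lemma block_walk_constant_ge2 (R : realType) (m D : nat) (rho dL dS dD : R) : 0 < rho ->
  2 <= block_walk_constant m D rho dL dS dD.
Proof.
move=> rho0; rewrite /block_walk_constant lerDr; have D0 : 0 <= D%:R :> R by [].
have q (k x y : R) : 0 <= k -> 0 <= x -> 0 <= k * x / y ^+ 2.
  by move=> k0 x0; rewrite divr_ge0 ?sqr_ge0 // mulr_ge0.
have q1 := q 24 D%:R dS (ler0n _ _) D0.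
have q2 := q (24 * m%:R) D%:R dL (mulr_ge0 (ler0n _ _) (ler0n _ _)) D0.
have q5 := q 8 D%:R dD (ler0n _ _) D0.
move: q1 q2 q5; move: (24 * D%:R / _) (24 * m%:R * _ / _) (8 * D%:R / _) => x1 x2 x5 q1 q2 q5.
have c0 : 0 <= x1 + x2 + 6 by lra.
move: (x1 + x2 + 6) c0 => c c0; apply: mulr_ge0; first by rewrite mulr_ge0.
rewrite !addr_ge0 //; first by rewrite mulr_ge0.
rewrite divr_ge0 ?(ltW rho0) // mulr_ge0 ?mulr_ge0 ?sqr_ge0 // addr_ge0 // mulr_ge0 // mulr_ge0 //.
Qed.

Section ManyCommunityWalk.

Variables (R : realType) (m : nat) (G : m_communities m) (D : nat) (rho : R).
Hypothesis m_ge2 : (2 <= m)%N.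
Hypothesis Q_irreducible : irreducible (mc_Q R G).
Hypothesis int_ge3 : forall v : 'I_(mc_n G), (3 <= mc_int v)%N.
Hypothesis degree_le : forall v : 'I_(mc_n G), (mc_int v + mc_out v <= D)%N.
Hypotheses (rho_gt0 : 0 < rho) (n_gt0 : (0 < mc_n G)%N).
Hypothesis ratio : forall i, rho * (mc_n G)%:R <= #|community (@mc_comm m G) i|%:R.
Local Notation H := (mc_half_edge G).
Local Notation src := (@mc_src m G).
Local Notation comm := (@mc_comm m G).
Local Notation side := (@mc_side m G).
Local Notation internal := (@mc_internal m G).
Local Notation n := (mc_n G).
Local Notation M := (mc_pairing R int_ge3).
Local Notation alpha := (cheeger (mc_Q R G)).
Local Notation vol := (volume R G).

Lemma mc_tame : tame m D rho M.
Proof.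
split; first by rewrite card_ord.
  by move=> v; apply: leq_trans (degree_le v); rewrite -card_mc_owner.
by move=> i; rewrite card_ord; apply: le_trans (ratio i) _.
Qed.

Lemma mc_D_gt0 : (0 < D)%N.
Proof.
apply: leq_trans (degree_le (Ordinal n_gt0)).
by apply: leq_trans (leq_addr _ _); apply: leq_trans (int_ge3 _).
Qed.

Lemma mc_internal_many i : rho * n%:R <= (mc_E G i i)%:R.
Proof.
apply: le_trans (ratio i) _; rewrite ler_nat mc_E_int -sum1_card; apply: leq_sum => v _.
exact: leq_trans (int_ge3 v).
Qed.

Lemma volume_ge i : rho * n%:R <= vol i.
Proof.
apply: le_trans (mc_internal_many i) _; rewrite /volume ler_nat (bigD1 i) //=.
exact: leq_addr.
Qed.

Lemma mc_volume_gt0 i : 0 < vol i.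
Proof. by apply: lt_le_trans (volume_ge i); rewrite mulr_gt0 // ltr0n. Qed.

Section FixedMatching.

Variable s : {perm H}.
Hypothesis ls : two_stage_law R (mc_labellings G) (@mc_matchings m G) s != 0.

Lemma sum_block_pairs (F : 'I_m -> 'I_m -> R) :
  \sum_h F (side h) (side (s h)) = \sum_i \sum_j (mc_E G i j)%:R * F i j.
Proof.
have [EE _] := mc_support ls.
rewrite (partition_big side predT) //=; apply: eq_bigr => i _.
rewrite (partition_big (fun h => side (s h)) predT) //=; apply: eq_bigr => j _.
rewrite (eq_bigr (fun=> F i j)) => [|h /andP[/eqP -> /eqP -> //]].
rewrite sumr_const -[_ *+ _]mulr_natl -EE; congr (_%:R * _); apply: eq_card => h.
by rewrite inE.
Qed.

Lemma sum_block_volume (A : {set 'I_m}) :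
  \sum_(v in [set v | comm v \in A]) deg R src v = set_volume R G A.
Proof.
have degE v : deg R src v = (mc_int v + mc_out v)%:R by rewrite /deg card_mc_owner.
rewrite (partition_big comm (mem A)) /=; last by move=> v; rewrite inE.
apply: eq_bigr => i iA; rewrite /volume (bigD1 i) //= mc_E_int mc_E_out natrD !natr_sum -big_split /=.
rewrite [LHS]big_mkcond [RHS]big_mkcond; apply: eq_bigr => v _; rewrite !inE.
by case: (comm v =P i) => [->|]; rewrite ?andbF // iA degE natrD.
Qed.

Lemma card_block_cut (A : {set 'I_m}) :
  #|cutset src s predT (mem [set v | comm v \in A])|%:R = edges_out R G A.
Proof.
transitivity (\sum_h (((side h \in A) && (side (s h) \notin A))%:R : R)).
  rewrite -sum1_card natr_sum big_mkcond; apply: eq_bigr => h _.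
  have memA v : (mem [set v | comm v \in A] : pred _) v = (comm v \in A).
    by transitivity (v \in [set v | comm v \in A]); [|rewrite inE].
  by rewrite inE !memA /mc_side /=; case: (_ && _).
rewrite (sum_block_pairs (fun i j => ((i \in A) && (j \notin A))%:R)) /edges_out.
rewrite [RHS]big_mkcond; apply: eq_bigr => i _; case: (i \in A) => /=; last first.
  by rewrite big1 // => j _; rewrite mulr0.
rewrite [RHS]big_mkcond; apply: eq_bigr => j _; rewrite inE.
by case: (j \in A) => /=; rewrite ?mulr0 ?mulr1.
Qed.

Variables (eps dL dS dD : R).
Hypothesis ex : expanding comm src s internal D eps dL dS.
Local Notation E := (energy src (src \o s) predT).
Local Notation C3 := (24 * D%:R / dS ^+ 2 + 24 * m%:R * D%:R / dL ^+ 2 + 6).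

(** Subtract from g a quantile u of each community: the difference g' is controlled by the
    energy inside the communities.  The edges between communities then bound the energy F
    of u on the quotient, and [spread_le_block_energy] bounds the spread of u by F, at the
    cost of the factor 1 / alpha. *)
Lemma mc_poincare (g : 'I_n -> R) : exists a,
  \sum_v (g v - a) ^+ 2 <=
    (2 * C3 + 2 * m.+1%:R ^+ 2 * (3 + 6 * D%:R * C3) / rho) / alpha * E g.
Proof.
have /andP[a0 a1] := cheeger_gt0_le1 m_ge2 Q_irreducible mc_volume_gt0.
have n0 : 0 < n%:R :> R by rewrite ltr0n.
have [_ intE] := mc_support ls.
have qex : forall i, exists u, quantile comm eps g i u by move=> i; apply: quantile_exists ex g i.
have [u uP] := boolp.choice qex.
pose g' v := g v - u (comm v).
have q' i : quantile comm eps g' i 0.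
  have [h1 h2] := uP i; split.
    apply: le_trans h1; rewrite ler_nat; apply/subset_leq_card/fintype.subsetP => v.
    by rewrite !inE /g' => /andP[/eqP ->]; rewrite subr_lt0 eqxx.
  apply: lt_le_trans h2 _; rewrite ler_nat; apply/subset_leq_card/fintype.subsetP => v.
  by rewrite !inE /g' => /andP[/eqP -> gu]; rewrite subr_le0 eqxx.
have := sum_square_le_quantiles ex q'; rewrite card_ord.
have [c c0 ->] : exists2 c, 0 <= c & C3 = c.
  exists C3 => //; rewrite !addr_ge0 // divr_ge0 ?sqr_ge0 // ?mulr_ge0 //.
rewrite [\sum_i 0 ^+ 2]big1 => [|i _]; last by rewrite expr0n.
rewrite mulr0 addr0; set S := \sum_v g' v ^+ 2 => S_le.
have E0 : 0 <= E g by apply: energy_ge0.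
have SE : S <= c * E g.
  apply: le_trans S_le _; rewrite ler_wpM2l // /energy big_mkcond /=; apply: ler_sum => h _.
  case: ifP => [|_]; last exact: sqr_ge0.
  by rewrite intE /g' /= => /eqP; rewrite /mc_side => ->; rewrite opprB addrA subrK.
pose F := \sum_k \sum_l (mc_E G k l)%:R * (u k - u l) ^+ 2.
have F_le : F <= (3 + 6 * D%:R * c) * E g.
  have point h : (u (side h) - u (side (s h))) ^+ 2 <=
      3 * (g (src h) - g (src (s h))) ^+ 2 + 3 * g' (src h) ^+ 2 + 3 * g' (src (s h)) ^+ 2.
    rewrite /g' /mc_side; set x := g (src h); set y := g _; set a := u _; set b := u _.
    have := sqr_ge0 ((x - y) + (x - a)); have := sqr_ge0 ((x - y) - (y - b)); have := sqr_ge0 ((x - a) + (y - b)).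
    have -> : (a - b) ^+ 2 = ((x - y) - (x - a) + (y - b)) ^+ 2 by ring.
    by move: (x - y) (x - a) (y - b) => p q r; nra.
  rewrite /F -(sum_block_pairs (fun k l => (u k - u l) ^+ 2)).
  apply: le_trans (ler_sum _ (fun h _ => point h)) _; rewrite !big_split /= -!mulr_sumr.
  have deg1 v : (#|[set h : H | src h == v]| <= D)%N by rewrite card_mc_owner.
  have sq0 v : 0 <= g' v ^+ 2 by apply: sqr_ge0.
  have b1 := @sum_fibers_le R 'I_n H predT src (fun v => g' v ^+ 2) D sq0 deg1.
  have b2 : \sum_h g' (src (s h)) ^+ 2 <= D%:R * S.
    by rewrite (sum_partner s (fun h => g' (src h) ^+ 2)).
  have b3 : D%:R * S <= D%:R * (c * E g) by rewrite ler_wpM2l.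
  move: b1; rewrite -/S => b1; rewrite -/(E g).
  have -> : (3 + 6 * D%:R * c) * E g = 3 * E g + 6 * (D%:R * (c * E g)) by ring.
  change (\sum_h (g (src h) - g (src (s h))) ^+ 2) with (E g).
  lra.
have i0 : 'I_m by apply: Ordinal (ltnW m_ge2).
exists (u i0).
have far k : n%:R * (u k - u i0) ^+ 2 <= m.+1%:R ^+ 2 * F / (alpha * rho).
  rewrite ler_pdivlMr ?mulr_gt0 //.
  have := spread_le_block_energy m_ge2 Q_irreducible mc_volume_gt0 u k i0 volume_ge
    (ltW (mulr_gt0 rho_gt0 n0)).
  rewrite -/F; congr (_ <= _); ring.
have split_sum : \sum_v (g v - u i0) ^+ 2 <= 2 * S + 2 * (m.+1%:R ^+ 2 * F / (alpha * rho)).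
  apply: le_trans (_ : \sum_v (2 * g' v ^+ 2 + 2 * (u (comm v) - u i0) ^+ 2) <= _).
    apply: ler_sum => v _; rewrite /g'; move: (g v) (u (comm v)) (u i0) => x y z.
    rewrite -subr_ge0; have -> : 2 * (x - y) ^+ 2 + 2 * (y - z) ^+ 2 - (x - z) ^+ 2
      = (x - y - (y - z)) ^+ 2 by ring.
    exact: sqr_ge0.
  rewrite big_split /= -!mulr_sumr lerD2l ler_pM2l //.
  apply: le_trans (_ : \sum_(v : 'I_n) (m.+1%:R ^+ 2 * F / (alpha * rho)) / n%:R <= _).
    by apply: ler_sum => v _; rewrite ler_pdivlMr // mulrC.
  by rewrite sumr_const card_ord -[_ *+ _]mulr_natr divfK // gt_eqF.
apply: le_trans split_sum _.
have -> : (2 * c + 2 * m.+1%:R ^+ 2 * (3 + 6 * D%:R * c) / rho) / alpha * E g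
    = 2 * (c * E g / alpha) + 2 * (m.+1%:R ^+ 2 * ((3 + 6 * D%:R * c) * E g) / (alpha * rho)).
  by field; rewrite !gt_eqF.
apply: lerD.
  rewrite ler_pM2l //; apply: le_trans SE _; rewrite ler_pdivlMr // ler_piMr // mulr_ge0 //.
rewrite ler_pM2l // ler_pM2r ?invr_gt0 ?mulr_gt0 // ler_pM2l // exprn_gt0 //.
Qed.

(** Every set of communities is a cut of the graph, which bounds the spectral gap by
    2 alpha. *)
Lemma mc_relaxation :
  eps <= rho / (4 * D%:R) -> 0 < dD -> dD <= dS -> dD <= dL / 2 -> dD <= rho / 4 ->
  relaxation_bounds (block_walk_constant m D rho dL dS dD) alpha (srw R src s).
Proof.
move=> eps_le dD0 dDS dDL dDk.
have /andP[a0 a1] := cheeger_gt0_le1 m_ge2 Q_irreducible mc_volume_gt0.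
have sK := expanding_inv ex; have D0n := mc_D_gt0.
have D0 : 0 < D%:R :> R by rewrite ltr0n.
have n0 : 0 < n%:R :> R by rewrite ltr0n.
have C2 := block_walk_constant_ge2 m D dL dS dD rho_gt0.
have [KK KKE KK0] : exists2 k, k = 2 * C3 + 2 * m.+1%:R ^+ 2 * (3 + 6 * D%:R * C3) / rho & 0 < k.
  eexists; first by [].
  have : 0 < C3 by rewrite ltr_wpDl // addr_ge0 // divr_ge0 ?sqr_ge0 // ?mulr_ge0.
  move: C3 => c c0; apply: ltr_pwDl; first by rewrite mulr_gt0.
  rewrite divr_ge0 ?(ltW rho_gt0) // mulr_ge0 // ?mulr_ge0 ?sqr_ge0 //.
  by rewrite addr_ge0 // mulr_ge0 ?(ltW c0) // mulr_ge0.
have [K' K'E K'0] : exists2 k : R, k = 8 * D%:R / dD ^+ 2 & 0 < k.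
  by eexists; first by []; rewrite divr_gt0 ?mulr_gt0 ?exprn_gt0.
have wcE : block_walk_constant m D rho dL dS dD = 2 * D%:R * (KK + K') + 2.
  by rewrite /block_walk_constant KKE K'E.
have K0 : 0 < KK / alpha by rewrite divr_gt0.
have deg0 v : (0 < #|[set h : H | src h == v]|)%N.
  by rewrite card_mc_owner; apply: leq_trans (leq_addr _ _); apply: leq_trans (int_ge3 v).
have degD v : (#|[set h : H | src h == v]| <= D)%N by rewrite card_mc_owner.
have poincare (g : 'I_n -> R) : exists a, \sum_v (g v - a) ^+ 2 <= KK / alpha * E g.
  by rewrite KKE; apply: mc_poincare.
have signless (f : 'I_n -> R) :
    \sum_v f v ^+ 2 <= K' * \sum_h (f (src h) + f (src (s h))) ^+ 2.
  apply: le_trans (_ : K' * \sum_(h | internal h) (f (src h) + f (src (s h))) ^+ 2 <= _); last first.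
    rewrite ler_pM2l // [leRHS](bigID internal) /= lerDl; apply: sumr_ge0 => h _; exact: sqr_ge0.
  rewrite K'E; apply: (sum_square_le_signless_energy ex) eps_le _ _ _ _ => // i.
  rewrite card_ord; apply: le_trans (mc_internal_many i) _; rewrite ler_nat.
  rewrite -card_mc_side_internal; apply/subset_leq_card/fintype.subsetP => h; rewrite !inE.
  have [_ intE] := mc_support ls; move=> /andP[hi hint]; rewrite hint [_ == i]hi.
  by move: hint; rewrite intE /mc_side => /eqP ->; rewrite [_ == i]hi.
have n1 : (1 < n)%N.
  by apply: (@card_gt1_of_blocks _ _ comm (Ordinal (ltnW m_ge2)) (Ordinal m_ge2)) => //;
     rewrite -(ltr_nat R); apply: lt_le_trans (ratio _); rewrite mulr_gt0.
have [gap gap0 [irr trelE rel_abs abs_le cut_le]] :=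
  srw_relaxation sK deg0 degD K0 K'0 poincare signless n1.
have gap_le : gap <= 2 * alpha.
  rewrite -ler_pdivrMl // mulrC (cheegerE m_ge2 Q_irreducible mc_volume_gt0).
  apply: lb_le_inf.
    by have [A AP] := half_block m_ge2 mc_volume_gt0; exists (edges_out R G A / set_volume R G A), A.
  move=> _ [A /= /andP[A0 A2] <-].
  have tot := set_volumeC R G A.
  have T0 := set_volumeT_gt0 m_ge2 mc_volume_gt0.
  have B0 : 0 < set_volume R G (~: A) by lra.
  have := cut_le [set v | comm v \in A].
  have -> : ~: [set v | comm v \in A] = [set v | comm v \in ~: A] by apply/setP => v; rewrite !inE.
  rewrite !sum_block_volume card_block_cut /= tot => /(_ A0 B0) h.
  have out0 : 0 <= edges_out R G A by rewrite sumr_ge0 // => i _; rewrite sumr_ge0.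
  rewrite ler_pdivrMr //; apply: le_trans h _.
  move: tot A0 A2 B0 T0; set a := set_volume R G A; set b := set_volume R G (~: A); set T := set_volume R G _.
  move=> tot A0' A2' B0 T0; have -> : edges_out R G A * T / (a * b) = edges_out R G A / a * (T / b).
    by field; rewrite !gt_eqF.
  have Tb : T / b <= 2 by rewrite ler_pdivrMr //; lra.
  by apply: ler_wpM2l Tb; rewrite divr_ge0 // ltW.
split=> //.
  rewrite trelE lef_pV2 ?posrE ?mulr_gt0 //; last by lra.
  by apply: le_trans gap_le _; rewrite ler_pM2r.
apply: le_trans abs_le _; rewrite ler_pdivlMr //.
(* The constant K' of the signless inequality does not depend on alpha, which is at most 1. *)
have K'A : K' * alpha <= K' by rewrite ler_piMr // ltW.
have MA : Num.max (KK / alpha) K' * alpha <= KK + K'.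
  have KA : KK / alpha * alpha = KK by rewrite divfK // gt_eqF.
  rewrite /Num.max; case: ltP => _; last by rewrite KA; lra.
  by apply: le_trans K'A _; rewrite lerDr ltW.
rewrite -mulrA wcE; have : 2 * D%:R * (Num.max (KK / alpha) K' * alpha) <= 2 * D%:R * (KK + K').
  by rewrite ler_wpM2l // mulr_ge0.
lra.
Qed.

End FixedMatching.

End ManyCommunityWalk.

(** Since every vertex has three internal half-edges, two expansion events suffice, both
    inside the communities. *)
Lemma many_communities_whp (R : realType) (m D : nat) (rho : R) :
  (2 <= m)%N -> (0 < D)%N -> 0 < rho ->
  exists2 C : R, 0 < C & forall eta : R, 0 < eta -> exists n0 : nat,
    forall G : m_communities m,
      irreducible (mc_Q R G) ->
      (forall v : 'I_(mc_n G), (3 <= mc_int v)%N) ->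
      (forall v : 'I_(mc_n G), (mc_int v + mc_out v <= D)%N) ->
      (forall i, rho * (mc_n G)%:R <= #|community (@mc_comm m G) i|%:R) ->
      (n0 <= mc_n G)%N ->
      1 - eta <= mc_prob (relaxation_bounds C (cheeger (mc_Q R G)) (n := mc_n G)).
Proof.
move=> m2 D0n rho0; have D0 : 0 < D%:R :> R by rewrite ltr0n.
have [epsS epsS0 whpS] := @small_expansion_whp R m D 0 rho rho0.
pose eps := Num.min epsS (Num.min (1 / 4) (rho / (4 * D%:R))).
have eps0 : 0 < eps by rewrite !lt_min epsS0 !divr_gt0 // mulr_gt0.
have eps_S : eps <= epsS by rewrite /eps !ge_min lexx.
have eps_4 : eps <= 1 / 4 by rewrite /eps !ge_min lexx orbT.
have eps_k : eps <= rho / (4 * D%:R) by rewrite /eps !ge_min lexx !orbT.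
have [dL dL0 whpL] := @large_expansion_whp R m D rho eps rho0 eps0 eps_4 D0n.
pose dS : R := 1 / 12; pose dD := Num.min dS (Num.min (dL / 2) (rho / 4)).
have dS0 : 0 < dS by rewrite divr_gt0.
have dL2 : 0 < dL / 2 by rewrite divr_gt0.
have rho4 : 0 < rho / 4 by apply: divr_gt0.
have dD0 : 0 < dD by rewrite !lt_min dS0 dL2 rho4.
have dD_S : dD <= dS by rewrite /dD !ge_min lexx.
have dD_L : dD <= dL / 2 by rewrite /dD !ge_min lexx orbT.
have dD_k : dD <= rho / 4 by rewrite /dD !ge_min lexx !orbT.
exists (block_walk_constant m D rho dL dS dD).
  exact: lt_le_trans (block_walk_constant_ge2 m D dL dS dD rho0).
move=> eta eta0; have eta2 : 0 < eta / 2 by rewrite divr_gt0.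
have [nS nSP] := whpS _ eta2; have [nL nLP] := whpL _ eta2.
exists (maxn nS nL).+1 => G irr int3 degD ratio n_ge.
have n0 : (0 < mc_n G)%N := leq_ltn_trans (leq0n _) n_ge.
move: n_ge; rewrite gtn_max => /andP[/ltnW nSn /ltnW nLn].
pose M := mc_pairing R int3; rewrite (mc_probE int3).
have tm : tame m D rho M by apply: mc_tame.
have lawE (s : {perm half_edge M}) : law s != 0 ->
  two_stage_law R (mc_labellings G) (@mc_matchings m G) s != 0 by [].
have match_ (s : {perm half_edge M}) : law s != 0 -> perfect_matching s by apply: law_matching.
have sK (s : {perm half_edge M}) : law s != 0 -> involutive s.
  by move=> /match_ /forallP sP h; have /andP[_ /eqP] := sP h.
have cardM : #|vertex M| = mc_n G by rewrite card_ord.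
pose phiS (s : {perm half_edge M}) : half_edge M -> half_edge M := s.
have badS : Pr (M := M) (fun s => ~~ small_expansion phiS epsS (1 / 6) 0 0 s) <= eta / 2.
  apply: nSP => //; first by rewrite cardM.
  - by move=> g s h _; rewrite /phiS conjgE !permM permK.
  - move=> s /match_ /forallP sP; rewrite leqn0 cards_eq0; apply/eqP/setP => h.
    by rewrite !inE; have /andP[/negbTE] := sP h.
have badL : Pr (M := M) (fun s => ~~ @large_expansion R M eps dL s) <= eta / 2.
  by apply: nLP => //; rewrite cardM.
have goodP := Pr_and_ge (Pr_ge badS) badL.
rewrite (_ : eta / 2 + eta / 2 = eta) in goodP; last by field.
apply: le_trans goodP _; apply: Pr_le => s ls /andP[gS gL]; apply/asboolP.
have rk : eps < 1 / 2 by apply: le_lt_trans eps_4 _; lra.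
have V0 : (0 < #|vertex M|)%N by rewrite cardM.
have slive h : @live R M (s h) = @live R M h.
  have [_ intE] := mc_support (lawE s ls).
  by rewrite [LHS]intE [RHS]intE (sK s ls) eq_sym.
have ex := @expanding_of_good R M m D rho eps epsS dL tm rho0 V0 D0n eps0 rk eps_S dL0 s ls
  slive gL gS.
exact: (mc_relaxation m2 irr int3 degD rho0 n0 ratio (lawE s ls) ex).
Qed.

(** * Constants and limits *)

Lemma cvg_to_one (R : realType) (n : nat -> nat) (u : nat -> R) :
  (n @ \oo --> \oo)%classic -> (forall k, u k <= 1) ->
  (forall eta : R, 0 < eta -> exists n0, forall k, (n0 <= n k)%N -> 1 - eta <= u k) ->
  (u @ \oo --> (1 : R))%classic.
Proof.
move=> n_oo u1 uP; apply/cvgrPdist_le => eta eta0; have [n0 n0P] := uP _ eta0.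
have n_ge : (\forall k \near \oo, (n0 <= n k)%N)%classic by exact: (n_oo _ (nbhs_infty_ge n0)).
near=> k; have n0k : (n0 <= n k)%N by near: k; apply: n_ge.
by rewrite ger0_norm ?subr_ge0 // lerBlDr -lerBlDl n0P.
Unshelve. all: by end_near.
Qed.

Section CommunityRatio.

Variables (R : realType) (m : nat) (n : nat -> nat) (comm : forall k, 'I_(n k) -> 'I_m).
Local Notation size k i := (#|community (@comm k) i|%:R : R).

Lemma community_ratio_le k i j : community_ratio R comm * size k j <= size k i.
Proof.
have [->|j0] := eqVneq (size k j) 0; first by rewrite mulr0.
have j_gt0 : 0 < size k j by rewrite lt0r j0 ler0n.
rewrite -ler_pdivlMr //; apply: ge_inf; last by exists k, i, j.
by exists 0 => _ [k' [i' [j' ->]]]; rewrite divr_ge0.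
Qed.

Lemma community_share k i : community_ratio R comm / m%:R * (n k)%:R <= size k i.
Proof.
have m0 : 0 < m%:R :> R by rewrite ltr0n; case: m i => // -[].
rewrite mulrAC ler_pdivrMr //.
have -> : (n k)%:R = \sum_j size k j by rewrite (sum_card_fiber (@comm k) R) card_ord.
rewrite mulr_sumr; apply: le_trans (ler_sum _ (fun j _ => community_ratio_le k i j)) _.
by rewrite sumr_const card_ord mulr_natr.
Qed.

Lemma community_ratio_gt0 (c : R) : 0 < c -> (0 < m)%N ->
  (forall k i, (0 < #|community (@comm k) i|)%N) ->
  (forall k i j, c * size k j <= size k i) -> 0 < community_ratio R comm.
Proof.
move=> c0 m0 n0 cP; apply: lt_le_trans c0 _; apply: lb_le_inf.
  by eexists; exists 0%N, (Ordinal m0), (Ordinal m0).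
by move=> _ [k [i [j ->]]]; rewrite ler_pdivlMr // ltr0n.
Qed.

End CommunityRatio.

(** The N_i are comparable and degrees lie between 3 and D, so the n_i are comparable.  No
    community is empty because N_i >= p >= 2. *)
Lemma tc_ratio_gt0 (R : realType) (D : nat) (G : nat -> two_communities) :
  tc_assumptions R D G -> 0 < community_ratio R (fun k => @tc_comm (G k)).
Proof.
move=> [_ [[c [c0 cP]] _] deg3 degD].
have N_le k i j : (tc_N (G k) j)%:R <= (c + 1) * (tc_N (G k) i)%:R :> R.
  have [le01 le10] := cP k.
  have N0 l : 0 <= (tc_N (G k) l)%:R :> R by [].
  have two (l : 'I_2) : l = 0 \/ l = 1.
    by case: l => -[|[|//]] ?; [left|right]; apply: val_inj.
  have := N0 0; have := N0 1; rewrite mulrDl mul1r.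
  case: (two i) => ->; case: (two j) => ->; nra.
have N_ge k i : (3 * #|community (@tc_comm (G k)) i| <= tc_N (G k) i)%N.
  by rewrite mulnC -sum_nat_const; apply: leq_sum => v _; apply: deg3.
have N_D k i : (tc_N (G k) i <= D * #|community (@tc_comm (G k)) i|)%N.
  by rewrite mulnC -sum_nat_const; apply: leq_sum => v _; apply: degD.
have n0 k i : (0 < #|community (@tc_comm (G k)) i|)%N.
  have := N_D k i; have := leq_trans (tc_p_ge2 (G k)) (@tc_p_le (G k) i).
  by rewrite -/(tc_N (G k) i); case: #|_| => //; rewrite muln0; case: tc_N.
have K0 : 0 < (c + 1) * D.+1%:R by rewrite mulr_gt0 // addr_gt0.
apply: (@community_ratio_gt0 _ _ _ _ (3 / ((c + 1) * D.+1%:R))) => //.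
  by rewrite divr_gt0.
move=> k i j; rewrite mulrAC ler_pdivrMr //.
have := N_ge k j; rewrite -(ler_nat R) natrM => /le_trans; apply.
apply: le_trans (N_le k i j) _; rewrite [leRHS]mulrC -mulrA ler_pM2l ?addr_gt0 //.
by rewrite -natrM ler_nat; apply: leq_trans (N_D k i) _; rewrite leq_mul2r leqnSn orbT.
Qed.

(** Without vertices E vanishes, and then so does Q. *)
Lemma mc_n_gt0 (R : realType) (m : nat) (G : m_communities m) : (2 <= m)%N ->
  irreducible (mc_Q R G) -> (0 < mc_n G)%N.
Proof.
move=> m2 irr; rewrite lt0n; apply/negP => /eqP n0.
have empty (v : 'I_(mc_n G)) : False by case: v => v; rewrite n0.
have sum0 (A : {set 'I_(mc_n G)}) (f : 'I_(mc_n G) -> nat) : (\sum_(v in A) f v = 0)%N.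
  by apply: big1 => v; case: (empty v).
have Q0 : mc_Q R G = 0.
  apply/matrixP => i j; rewrite !mxE; have [->|ji] := eqVneq j i.
    by rewrite mc_E_int sum0 mul0r.
  have /eqP := mc_E_out G i; rewrite sum0 sum_nat_eq0 => /forallP/(_ j)/implyP/(_ ji)/eqP ->.
  by rewrite mul0r.
have [[|t]] := irr (Ordinal (ltnW m2)) (Ordinal m2).
  by rewrite expr0 mxE /= ltxx.
by rewrite Q0 exprS mul0r mxE ltxx.
Qed.

Lemma mc_ratio_gt0 (R : realType) (m D : nat) (G : nat -> m_communities m) : (2 <= m)%N ->
  mc_assumptions R D G -> 0 < community_ratio R (fun k => @mc_comm m (G k)).
Proof.
move=> m2 [irr ni _ _]; have [c cP] := boolp.choice ni.
have n_gt0 k : 0 < (mc_n (G k))%:R :> R by rewrite ltr0n; apply: mc_n_gt0 (irr k).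
have c0 i : 0 < c i by have [] := cP i.
have C0 i : c i <= \sum_l c l.
  by rewrite (bigD1 i) //= lerDl; apply: sumr_ge0 => l _; apply: ltW.
have S0 : 0 < \sum_l c l by apply: lt_le_trans (c0 (Ordinal m2)) (C0 _).
have n_le k i : (mc_n (G k))%:R <= c i * #|community (@mc_comm m (G k)) i|%:R.
  by have [_ /(_ k)[]] := cP i.
apply: (@community_ratio_gt0 _ _ _ _ (\sum_l c l)^-1) => //; first by rewrite invr_gt0.
- exact: ltnW.
- move=> k i; rewrite -(ltr0n R) -(pmulr_rgt0 _ (c0 i)).
  exact: lt_le_trans (n_gt0 k) (n_le k i).
move=> k i j; rewrite mulrC ler_pdivrMr //.
apply: le_trans (_ : (mc_n (G k))%:R <= _).
  by rewrite ler_nat -[leqRHS]card_ord; apply: max_card.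
by apply: le_trans (n_le k i) _; rewrite mulrC ler_wpM2l.
Qed.

Local Open Scope classical_set_scope.
Local Open Scope ring_scope.

(* D bounds the maximal degrees; C depends only on D, on inf_k min_(i, j) n_i / n_j
   and, for m communities, on m. *)
Theorem proposition1p5 (R : realType) :
  (exists C : nat -> R -> R, (forall D r, 0 < C D r) /\
    forall (D : nat) (G : nat -> two_communities),
      (fun k => tc_n (G k)) @ \oo --> \oo ->
      tc_assumptions R D G ->
      (fun k => tc_prob (relaxation_bounds
         (C D (community_ratio R (fun k => @tc_comm (G k))))
         (tc_alpha R (G k)) (n := tc_n (G k)))) @ \oo --> (1 : R))
  /\
  (forall m : nat, (2 <= m)%N ->
    exists C : nat -> R -> R, (forall D r, 0 < C D r) /\
    forall (D : nat) (G : nat -> m_communities m),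
      (fun k => mc_n (G k)) @ \oo --> \oo ->
      mc_assumptions R D G ->
      (fun k => mc_prob (relaxation_bounds
         (C D (community_ratio R (fun k => @mc_comm m (G k))))
         (cheeger (mc_Q R (G k))) (n := mc_n (G k)))) @ \oo --> (1 : R)).
Proof.
split.
  (* The value for r <= 0 is arbitrary; D.+1 is used so that the degree bound is positive. *)
  have exC (q : nat * R) : exists C : R, 0 < C /\ (0 < q.2 -> forall eta : R, 0 < eta ->
      exists n0 : nat, forall G : two_communities,
        (forall v : 'I_(tc_n G), (3 <= tc_deg v)%N) ->
        (forall v : 'I_(tc_n G), (tc_deg v <= q.1.+1)%N) ->
        tc_alpha R G <= 1 ->
        (forall i, q.2 / 2 * (tc_n G)%:R <= #|community (@tc_comm G) i|%:R) ->
        (n0 <= tc_n G)%N ->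
        1 - eta <= tc_prob (relaxation_bounds C (tc_alpha R G) (n := tc_n G))).
    have [r0|r0] := ltP 0 q.2; last by exists 1; split.
    have [C C0 CP] := @two_communities_whp R q.1.+1 (q.2 / 2) isT (divr_gt0 r0 (ltr0Sn R 1)).
    by exists C.
  have [C CP] := boolp.choice exC; exists (fun D r => C (D, r)); split=> [D r|D G n_oo GP].
    by have [] := CP (D, r).
  have [_ whp] := CP (D, community_ratio R (fun k => @tc_comm (G k))).
  have {}whp := whp (tc_ratio_gt0 GP); have [alpha1 _ deg3 degD] := GP.
  apply: (cvg_to_one n_oo) => [k|eta eta0]; first by rewrite (tc_probE (deg3 k)) Pr_le1.
  have [n0 n0P] := whp eta eta0; exists n0 => k n0k; apply: n0P n0k => //.
    by move=> v; apply: leqW.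
  by move=> i; apply: community_share.
move=> m m2.
have exC (q : nat * R) : exists C : R, 0 < C /\ (0 < q.2 -> forall eta : R, 0 < eta ->
    exists n0 : nat, forall G : m_communities m,
      irreducible (mc_Q R G) ->
      (forall v : 'I_(mc_n G), (3 <= mc_int v)%N) ->
      (forall v : 'I_(mc_n G), (mc_int v + mc_out v <= q.1.+1)%N) ->
      (forall i, q.2 / m%:R * (mc_n G)%:R <= #|community (@mc_comm m G) i|%:R) ->
      (n0 <= mc_n G)%N ->
      1 - eta <= mc_prob (relaxation_bounds C (cheeger (mc_Q R G)) (n := mc_n G))).
  have [r0|r0] := ltP 0 q.2; last by exists 1; split.
  have m0 : 0 < m%:R :> R by rewrite ltr0n ltnW.
  have [C C0 CP] := @many_communities_whp R m q.1.+1 (q.2 / m%:R) m2 isT (divr_gt0 r0 m0).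
  by exists C.
have [C CP] := boolp.choice exC; exists (fun D r => C (D, r)); split=> [D r|D G n_oo GP].
  by have [] := CP (D, r).
have [_ whp] := CP (D, community_ratio R (fun k => @mc_comm m (G k))).
have {}whp := whp (mc_ratio_gt0 m2 GP); have [irr _ int3 degD] := GP.
apply: (cvg_to_one n_oo) => [k|eta eta0]; first by rewrite (mc_probE (int3 k)) Pr_le1.
have [n0 n0P] := whp eta eta0; exists n0 => k n0k; apply: n0P n0k => //.
  by move=> v; apply: leqW.
by move=> i; apply: community_share.
Qed.
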